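(* Let $M=\mathbb{R}^2/\mathbb{Z}^2$ be the square torus with coordinates $(x,y)$, let $(N,G)$ be a smooth closed Riemannian manifold, and let $\eta>0$ be a constant. For $(\alpha,\beta)\in\mathbb{R}^2$ with $\beta\neq0$ let $L_{\alpha,\beta}:\mathbb{R}^2\to\mathbb{R}^2$ be the linear map sending $(1,0)$ to $(1/\beta,0)$ and $(0,1)$ to $(\alpha,\beta)$, and consider the two-parameter family of flat unit-area metrics $L_{\alpha,\beta}^*(g_E)$ on $M$, where $g_E=dx^2+dy^2$. Let $(u,g)$ be a solution of the flow $$\frac{\partial u}{\partial t}=\tau_g(u),\qquad \frac{\partial g}{\partial t}=\frac{\eta^2}{4}\,\mathrm{Re}\big(P_g(\Phi(u,g))\big)$$ on $M$ whose domain metric starts in this family. Because the family is horizontal (that is, its tangent vectors are real parts of holomorphic quadratic differentials), the solution can be viewed as a time-dependent map $u:M\to N$ together with a domain metric $g(t)=L_{\alpha(t),\beta(t)}^*(g_E)$ on $M$. Writing $u=U\circ L_{\alpha,\beta}$, so that $U$ is a map defined on $M_{\alpha,\beta}$, the flow makes $\alpha$ and $\beta$ evolve according to $$\dot\beta=-\frac{\eta^2}{4}\frac{\beta}{2}\int_{M_{\alpha,\beta}}\big(|U_x|^2-|U_y|^2\big),\qquad \dot\alpha=\frac{\eta^2}{4}\int_{M_{\alpha,\beta}}\Big(\frac{\alpha}{2}\big(|U_x|^2-|U_y|^2\big)+2\beta\langle U_x,U_y\rangle\Big).$$ Consequently $a=\alpha\beta$ and $b=\beta^2$ evolve according to $$\dot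 a=\frac{\eta^2}{4}\,2b\int_M\big(\langle u_x,u_y\rangle-a|u_x|^2\big),$$ $$\dot b=\frac{\eta^2}{4}\int_M\Big(-(b^2-a^2)|u_x|^2+|u_y|^2-2a\langle u_x,u_y\rangle\Big),$$ which agrees with the formulae in the flow of Ding-Li-Liu in the case $\eta^2=2$.
   Context: $\tau_g(u)=\mathrm{tr}\,\nabla du$ is the tension field of $u:(M,g)\to(N,G)$. In a local complex coordinate $w=p+iq$ compatible with $g$, the Hopf differential of $u$ is $\Phi(u,g)=\phi\,dw^2$, where $dw^2=dw\otimes dw$ and $\phi=|u_p|^2-|u_q|^2-2i\langle u_p,u_q\rangle$. $P_g$ is the $L^2$-orthogonal projection (with respect to the Hermitian inner product induced by $g$) from quadratic differentials onto holomorphic quadratic differentials on $(M,g)$; on a flat torus the latter are precisely the parallel ones. $M_{\alpha,\beta}$ is the flat unit-area torus obtained as the quotient of the Euclidean plane $(\mathbb{R}^2,g_E)$ by the group of translations generated by $(1/\beta,0)$ and $(\alpha,\beta)$. The derivatives $U_x,U_y$ and the integrals over $M_{\alpha,\beta}$ are taken with respect to the Euclidean coordinates on $M_{\alpha,\beta}$; the derivatives $u_x,u_y$ and the integrals over $M$ are taken with respect to the fixed coordinates $(x,y)$ on $M=\mathbb{R}^2/\mathbb{Z}^2$ (with measure $dx\,dy$). Dots denote time derivatives. Ding-Li-Liu consider the conformal tori given by the quotient of $\mathbb{R}^2$ by the lattice generated by $(1,0)$ and $(a,b)$; with $a=\alpha\beta$ and $b=\beta^2$ this torus is a dilation of $M_{\alpha,\beta}$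 by the factor $\beta$. *)

(* Defs.v *)
From HB Require Import structures.
From mathcomp Require Import all_boot all_order all_algebra.
From mathcomp Require Import all_classical all_reals all_analysis.
From mathcomp Require Import complex.

Set Implicit Arguments.
Unset Strict Implicit.
Unset Printing Implicit Defensive.

Import Order.TTheory GRing.Theory Num.Theory numFieldNormedType.Exports.

Local Open Scope classical_set_scope.
Local Open Scope ring_scope.

(* The torus M = R^2/Z^2 is handled through its universal cover: a map, metric *)
(* or tensor on M is a Z^2-periodic one on R * R, tensors being given by their *)
(* components in the coordinates (x, y).                                       *)

Section Smooth.
Variables (R : realType) (V W : normedModType R).

(* Difference quotients are restricted to increments that stay in A.  On open  *)
(* sets this is the usual directional derivative; on [0, T[ x R^2 it is        *)
(* one-sided at t = 0, which gives smoothness up to the initial time.          *)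
Definition dquot (A : set V) (f : V -> W) (v x : V) :=
  (fun h : R => h^-1 *: (f (x + h *: v) - f x))
    @ within [set h : R | A (x + h *: v)] 0^'.

Definition dderiv (A : set V) (f : V -> W) (v x : V) : W := lim (dquot A f v x).

Fixpoint Ck (k : nat) (A : set V) (f : V -> W) : Prop :=
  {within A, continuous f} /\
  match k with
  | 0%N => True
  | k'.+1 => forall v : V,
      (forall x, A x -> cvg (dquot A f v x)) /\ Ck k' A (dderiv A f v)
  end.

Definition smooth_on (A : set V) (f : V -> W) : Prop := forall k, Ck k A f.

End Smooth.

Definition time_deriv (R : realType) (W : normedModType R) (I : set R)
    (f : R -> W) (t : R) (l : W) : Prop :=
  (fun h : R => h^-1 *: (f (t + h) - f t)) @ within [set h : R | I (t + h)] 0^'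
    --> l.

Section Manifold.
Variable R : realType.

Definition bilin n (A : 'M[R]_n) (v w : 'rV[R]_n) : R := (v *m A *m w^T) 0 0.

(* A smooth atlas (boundaryless, as chart ranges are open) and, in each chart, *)
(* the matrix of the metric.  [chart_at] only records that the charts cover.   *)
Record riemannian_manifold (n : nat) (N : topologicalType) := RiemannianManifold {
  chart : Type;
  dom : chart -> set N;
  crd : chart -> N -> 'rV[R]_n;
  prm : chart -> 'rV[R]_n -> N;
  chart_at : N -> chart;
  metric : chart -> 'rV[R]_n -> 'M[R]_n;
  dom_chart_at : forall y, dom (chart_at y) y;
  open_dom : forall c, open (dom c);
  open_ran : forall c, open (crd c @` dom c);
  crdK : forall c y, dom c y -> prm c (crd c y) = y;
  continuous_crd : forall c, {within dom c, continuous (crd c)};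
  continuous_prm : forall c, {within crd c @` dom c, continuous (prm c)};
  smooth_transition : forall c d,
    smooth_on (crd c @` (dom c `&` dom d)) (crd d \o prm c);
  smooth_metric : forall c i j,
    smooth_on (crd c @` dom c) (fun x => metric c x i j);
  metric_sym : forall c x, (crd c @` dom c) x -> (metric c x)^T = metric c x;
  metric_pos : forall c x v, (crd c @` dom c) x -> v != 0 ->
    0 < bilin (metric c x) v v;
  metric_transition : forall c d x v w, (crd c @` (dom c `&` dom d)) x ->
    let f := crd d \o prm c in
    bilin (metric c x) v w = bilin (metric d (f x)) ('D_v f x) ('D_w f x)
}.

(* Second countability follows from compactness and the charts.                *)
Definition closed_manifold (N : topologicalType) : Prop :=
  compact [set: N] /\ hausdorff_space N.

(* Gamma^l_(ij) of g with respect to the frame e of constant vectors.          *)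
Definition christoffel (V : normedModType R) n (e : 'I_n -> V)
    (g : V -> 'M[R]_n) (x : V) (l i j : 'I_n) : R :=
  2^-1 * \sum_m invmx (g x) l m *
    ('D_(e i) (fun y => g y j m) x + 'D_(e j) (fun y => g y i m) x
       - 'D_(e m) (fun y => g y i j) x).

End Manifold.

Section Maps.
Variables (R : realType) (n : nat) (N : topologicalType).
Variable G : riemannian_manifold R n N.

Definition smooth_map (V : normedModType R) (A : set V) (F : V -> N) : Prop :=
  {within A, continuous F} /\
  forall c : chart G, smooth_on (A `&` F @^-1` dom c) (crd c \o F).

(* <du(v), du(w)>_G at z; it does not depend on the chart around u z.          *)
Definition inner_du (u : R * R -> N) (v w : R * R) (z : R * R) : R :=
  let c := chart_at G (u z) in
  let f := crd c \o u in
  bilin (metric c (f z)) ('D_v f z) ('D_w f z).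

Definition e_x : R * R := (1, 0).
Definition e_y : R * R := (0, 1).
Definition e2 (i : 'I_2) : R * R := if i == 0 then e_x else e_y.

(* Components of tr (nabla du) in the chart c around u z.                      *)
Definition tension (g : R * R -> 'M[R]_2) (u : R * R -> N) (c : chart G)
    (z : R * R) : 'rV[R]_n :=
  let f := crd c \o u in
  \row_k \sum_i \sum_j invmx (g z) i j *
    ('D_(e2 i) ('D_(e2 j) f) z 0 k
     - \sum_l christoffel e2 g z l i j * 'D_(e2 l) f z 0 k
     + \sum_m \sum_p
         christoffel (fun a : 'I_n => 'e_a : 'rV[R]_n) (metric c) (f z) k m p
         * 'D_(e2 i) f z 0 m * 'D_(e2 j) f z 0 p).

End Maps.

Arguments e_x {R}.
Arguments e_y {R}.
Arguments e2 {R}.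

Section Torus.
Variable R : realType.
Implicit Types (g : R * R -> 'M[R]_2) (w : R * R -> R * R) (O : set (R * R)).

Definition coef (v : R * R) (i : 'I_2) : R := if i == 0 then v.1 else v.2.

(* Invariance under the translations generated by b 0 and b 1.                 *)
Definition lattice_periodic (T : Type) (b : 'I_2 -> R * R)
    (f : R * R -> T) : Prop :=
  forall i z, f (z + b i) = f z.

Definition torus_metric g : Prop :=
  [/\ lattice_periodic e2 g, forall z, (g z)^T = g z &
      forall z v, v != 0 -> 0 < bilin (g z) v v].

Definition gdot g (z v v' : R * R) : R :=
  \sum_i \sum_j g z i j * coef v i * coef v' j.

Definition unit_square : set (R * R) := `[0, 1] `*` `[0, 1].

Definition integral2 (D : set (R * R)) (f : R * R -> R) : R :=
  (\int[(lebesgue_measure \x lebesgue_measure)%E]_(z in D) f z)%R.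

Definition integral_M (f : R * R -> R) : R := integral2 unit_square f.

(* A coordinate w = p + iq is the map z |-> (p, q); [jac w z] has rows dp, dq, *)
(* and the columns of its inverse are the coordinate vector fields.            *)
Definition jac w (z : R * R) : 'M[R]_2 :=
  \matrix_(a, i) coef ('D_(e2 i) w z) a.

Definition coord_vec w (z : R * R) (a : 'I_2) : R * R :=
  (invmx (jac w z) 0 a, invmx (jac w z) 1 a).
Definition dp w z := coord_vec w z 0.
Definition dq w z := coord_vec w z 1.

(* Local complex coordinate on O compatible with g: a positively oriented      *)
(* coordinate in which g = rho (dp^2 + dq^2).                                  *)
Definition complex_coord g O w : Prop :=
  [/\ open O, smooth_on O w,
      forall z z', O z -> O z' -> w z = w z' -> z = z',
      forall z, O z -> 0 < \det (jac w z) &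
      forall z, O z ->
        gdot g z (dp w z) (dp w z) = gdot g z (dq w z) (dq w z) /\
        gdot g z (dp w z) (dq w z) = 0].

(* Quadratic differentials, as complex bilinear forms in the frame (dx, dy).   *)
Definition qdiff := R * R -> 'M[R[i]]_2.

Definition dw w (z : R * R) (i : 'I_2) : R[i] :=
  (('D_(e2 i) w z).1 +i* ('D_(e2 i) w z).2)%C.

(* Psi = psi dw (x) dw on O                                                    *)
Definition qdiff_in_coord O w (Psi : qdiff) (psi : R * R -> R[i]) : Prop :=
  forall z, O z -> forall i j, Psi z i j = psi z * dw w z i * dw w z j.

Definition holomorphic_in O w (psi : R * R -> R[i]) : Prop :=
  let a z := complex.Re (psi z) in
  let b z := complex.Im (psi z) in
  [/\ smooth_on O a, smooth_on O b &
      forall z, O z -> 'D_(dp w z) a z = 'D_(dq w z) b z /\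
                       'D_(dq w z) a z = - 'D_(dp w z) b z].

Definition holomorphic_qdiff g (Psi : qdiff) : Prop :=
  lattice_periodic e2 Psi /\
  forall z0, exists O w psi,
    [/\ complex_coord g O w, O z0, qdiff_in_coord O w Psi psi &
        holomorphic_in O w psi].

Definition is_hopf (n : nat) (N : topologicalType)
    (G : riemannian_manifold R n N) g (u : R * R -> N) (Phi : qdiff) : Prop :=
  lattice_periodic e2 Phi /\
  forall z0, exists O w,
    [/\ complex_coord g O w, O z0 &
        qdiff_in_coord O w Phi (fun z =>
          ((inner_du G u (dp w z) (dp w z) z - inner_du G u (dq w z) (dq w z) z)
           +i* (- 2 * inner_du G u (dp w z) (dq w z) z))%C)].

(* g^(ik) g^(jl) A_(ij) conj(B_(kl))                                           *)
Definition qdiff_inner g (A B : qdiff) (z : R * R) : R[i] :=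
  \sum_i \sum_j \sum_k \sum_l
    ((invmx (g z) i k * invmx (g z) j l)%:C)%C * A z i j * conjc (B z k l).

Definition L2_inner g (A B : qdiff) : R[i] :=
  (integral_M (fun z => complex.Re (qdiff_inner g A B z) * Num.sqrt (\det (g z)))
   +i* integral_M
         (fun z => complex.Im (qdiff_inner g A B z) * Num.sqrt (\det (g z))))%C.

(* Psi = P_g(Phi)                                                              *)
Definition is_projection g (Phi Psi : qdiff) : Prop :=
  holomorphic_qdiff g Psi /\
  forall Theta, holomorphic_qdiff g Theta ->
    L2_inner g (fun z => Phi z - Psi z) Theta = 0.

(* L_(alpha, beta), the pulled-back metric L^* g_E, and integration over       *)
(* M_(alpha, beta) by means of the fundamental domain L([0, 1]^2).             *)
Definition Lmap (alpha beta : R) (z : R * R) : R * R :=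
  z.1 *: (beta^-1, 0) + z.2 *: (alpha, beta).

Definition Lmetric (alpha beta : R) : R * R -> 'M[R]_2 := fun _ =>
  \matrix_(i, j) \sum_k
    coef (Lmap alpha beta (e2 i)) k * coef (Lmap alpha beta (e2 j)) k.

Definition integral_Mab (alpha beta : R) (f : R * R -> R) : R :=
  integral2 (Lmap alpha beta @` unit_square) f.

Definition time_interval (T : \bar R) : set R := [set t | 0 <= t /\ (t%:E < T)%E].

End Torus.

Section Flow.
Variables (R : realType) (n : nat) (N : topologicalType).
Variable G : riemannian_manifold R n N.

(* Smooth solution on M x [0, T[; the metrics g t are not assumed to be flat,  *)
(* nor of unit area, for t > 0.                                                *)
Record flow_solution (eta : R) (T : \bar R)
    (u : R -> R * R -> N) (g : R -> R * R -> 'M[R]_2) : Prop := FlowSolution {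
  u_periodic : forall t, time_interval T t -> lattice_periodic e2 (u t);
  u_smooth : smooth_map G (time_interval T `*` [set: R * R])
               (fun p : R * (R * R) => u p.1 p.2);
  g_metric : forall t, time_interval T t -> torus_metric (g t);
  g_smooth : forall i j, smooth_on (time_interval T `*` [set: R * R])
               (fun p : R * (R * R) => g p.1 p.2 i j);
  flow_u : forall t z (c : chart G), time_interval T t -> dom c (u t z) ->
    time_deriv (time_interval T) (fun s => crd c (u s z)) t
      (tension (g t) (u t) c z);
  flow_g : forall t, time_interval T t ->
    exists Phi Psi, [/\ is_hopf G (g t) (u t) Phi, is_projection (g t) Phi Psi &
      forall z i j, time_deriv (time_interval T) (fun s => g s z i j) t
        (eta ^+ 2 / 4 * complex.Re (Psi z i j))]
}.

Definition in_family (T : \bar R) (g : R -> R * R -> 'M[R]_2)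
    (alpha beta : R -> R) : Prop :=
  [/\ {within time_interval T, continuous alpha},
      {within time_interval T, continuous beta} &
      forall t, time_interval T t ->
        beta t != 0 /\ g t = Lmetric (alpha t) (beta t)].

(* Right-hand sides of the Ding-Li-Liu equations for the torus with lattice    *)
(* generated by (1, 0) and (a, b).                                             *)
Definition dll_a (a b : R) (u : R * R -> N) : R :=
  b * integral_M (fun z => inner_du G u e_x e_y z - a * inner_du G u e_x e_x z).

Definition dll_b (a b : R) (u : R * R -> N) : R :=
  2^-1 * integral_M (fun z => - (b ^+ 2 - a ^+ 2) * inner_du G u e_x e_x z
    + inner_du G u e_y e_y z - 2 * a * inner_du G u e_x e_y z).

End Flow.

(* Main.v *)
(* The heart of the matter is that the flow keeps the metric in the family.  Let
   k = eta^2 / 4 and let Psi be the projected Hopf differential.  The velocity k Re Psi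
   is trace free, so det g = 1 for all time and g is determined by E = g_xx and F = g_xy;
   a local complex coordinate w satisfies w_y = mu w_x with mu = (F + i) / E.
   Holomorphy of Psi then says that f = k Psi_xx = f1 + i f2, where f1 = E_t and
   f2 = F E_t - E F_t, solves the Beltrami-type equation f_y - mu f_x = 2 mu_x f.
   Hence |grad f|^2 is bounded by |grad E|^2 + |grad F|^2 up to a multiple of the null form
   f1_x f2_y - f1_y f2_x, whose integral over the torus is 0.  By Gronwall's inequality
   the energy int |grad E|^2 + |grad F|^2 vanishes for all time, so that g(t) is
   flat with constant coefficients and unit area.
   Once the metric is in the family, holomorphic differentials are the c dw^2, P_g is the
   mean value, and the evolution equations follow by comparing coefficients. *)

Require Import Defs.
From HB Require Import structures.
From mathcomp Require Import all_boot all_order all_algebra.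
From mathcomp Require Import all_classical all_reals all_analysis.
From mathcomp Require Import measurable_realfun.
From mathcomp Require Import complex ring lra.
Set Implicit Arguments.
Unset Strict Implicit.
Unset Printing Implicit Defensive.
Import Order.TTheory GRing.Theory Num.Theory numFieldNormedType.Exports.
Local Open Scope classical_set_scope.
Local Open Scope ring_scope.

(** * Integration over the square *)

(** Any smooth solution is examined, and its metric might a priori leave the flat ones. The obstacle
    is a loss of derivatives: the rate of the energy contains the gradients of E_t and F_t, which
    the energy does not control pointwise. The system for f = f1 + i f2 is elliptic, since Im mu = 1
    / E > 0, and this returns the lost derivative, but only up to the null form. The null form must
    appear with a constant coefficient, or its integral would not vanish; this is why the system is
    divided by E before it is used. The flow provides Psi separately at each time, with no
    regularity in t. So f2 is written F E_t - E F_t, which is smooth in space and time. At t = 0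
    derivatives are one-sided. Gronwall's inequality is therefore used on t > 0, with an energy that
    is at most C t in place of an initial value. That Psi is parallel on a flat torus is not taken
    from Liouville's theorem: constancy in space of g(s) at all times makes Re Psi constant, and Im
    mu != 0 gives the rest. *)

Section PlaneMeasure.
Variable R : realType.
Local Notation mR := (measurableTypeR R).
Local Notation mu := (@lebesgue_measure R).
Local Notation mu2 := (mu \x mu)%E.

(** Measurability here is that of the product sigma-algebra. An open set is the union of the
    countably many squares with rational centre and rational radius that it contains. *)
Lemma open_measurable_plane (U : set (R * R)) :
  open U -> measurable (U : set (mR * mR)).
Proof.
move=> oU.
pose B (q : rat * rat * rat) : set (R * R) :=
  ball (ratr q.1.1 : R) (ratr q.2) `*` ball (ratr q.1.2 : R) (ratr q.2).
have -> : U = \bigcup_(q in [set q | B q `<=` U]) B q.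
  apply/seteqP; split => [[x y] Uxy|z [q /= qU] /qU //].
  have /nbhs_ballP[e /= e0 eU] : nbhs (x, y) U by exact: open_nbhs_nbhs.
  (* With a radius below e / 2, a square containing (x, y) stays within e of it. *)
  have e2 : 0 < e / 2 by rewrite divr_gt0.
  have [r] : exists r : rat, ratr r \in `]0, e / 2[ by apply: rat_in_itvoo.
  rewrite in_itv /= => /andP[r0 re].
  have rat_close (c : R) : exists q : rat, `|c - ratr q| < ratr r.
    have [q] : exists q : rat, ratr q \in `]c - ratr r, c + ratr r[.
      by apply: rat_in_itvoo; lra.
    by rewrite in_itv /= => /andP[q1 q2]; exists q; rewrite ltr_norml; lra.
  have [a xa] := rat_close x; have [b yb] := rat_close y.
  exists ((a, b), r) => /=; last first.
    by split; rewrite /= -ball_normE /= distrC.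
  move=> [x' y'] [/= xx' yy']; apply: eU; split => /=.
    move: xx'; rewrite -!ball_normE /= => xx'.
    by have := ler_distD (ratr a) x x'; lra.
  move: yy'; rewrite -!ball_normE /= => yy'.
  by have := ler_distD (ratr b) y y'; lra.
rewrite bigcup_mkcond; apply: countable_bigcupT_measurable.
  exact: countableP.
move=> q; case: ifP => _; last exact: measurable0.
by apply: measurableX; exact: measurable_ball.
Qed.

Lemma continuous_measurable_plane (f : R * R -> R) :
  continuous f -> measurable_fun setT (f : mR * mR -> mR).
Proof.
move=> /continuousP cf.
apply: (measurability _ (RGenOpens.measurableE R)).
move=> _ [_ [a [b ->] <-]]; rewrite setTI; apply: open_measurable_plane.
exact/cf/interval_open.
Qed.

Lemma compact_measurable_plane (D : set (R * R)) :
  compact D -> measurable (D : set (mR * mR)).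
Proof.
move=> cD; rewrite -[D]setCK; apply: measurableC; apply: open_measurable_plane.
by rewrite openC; apply: compact_closed => //; exact: norm_hausdorff.
Qed.

Lemma compact_plane_finite (D : set (R * R)) : compact D -> (mu2 D < +oo)%E.
Proof.
move=> cD; have [M [_ DM]] := compact_bounded cD.
pose B : set (R * R) := `[- (M + 1), M + 1] `*` `[- (M + 1), M + 1].
have DB : D `<=` B.
  move=> [x y] Dxy; have := DM (M + 1) _ _ Dxy; rewrite ltrDl ltr01 => /(_ isT).
  rewrite /Num.norm /= ge_max => /andP[xM yM].
  by split; rewrite /= in_itv /= -ler_norml.
apply: (@le_lt_trans _ _ (mu2 B)).
  rewrite le_measure// inE; first exact: compact_measurable_plane.
  by apply: measurableX; exact: measurable_itv.
rewrite product_measure1E //= !lebesgue_measure_itv /=.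
by case: ifP => _; rewrite ?mule0 ?ltry// -EFinB -EFinM ltry.
Qed.

Lemma continuous_integrable_plane (D : set (R * R)) (f : R * R -> R) :
  compact D -> continuous f -> mu2.-integrable D (EFin \o f).
Proof.
move=> cD cf; apply: measurable_bounded_integrable.
- exact: compact_measurable_plane.
- exact: compact_plane_finite.
- by apply: measurable_funTS; exact: continuous_measurable_plane.
- have /compact_bounded[M [_ mrt]] := continuous_compact (continuous_subspaceT cf) cD.
  by exists M; split; rewrite ?num_real // => ? ? ? ?; exact: mrt.
Qed.

Lemma unit_square_compact : compact (@unit_square R).
Proof. by apply: compact_setX; exact: segment_compact. Qed.

Lemma measurable_unit_square : measurable (@unit_square R : set (mR * mR)).
Proof. apply: compact_measurable_plane; exact: unit_square_compact. Qed.

Lemma unit_square_area : mu2 (@unit_square R) = 1%:E.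
Proof.
rewrite product_measure1E //= !lebesgue_measure_itv /= lte_fin ltr01.
by rewrite -EFinB subr0 mule1.
Qed.

Lemma integral_MZ (c : R) (f : R * R -> R) :
  continuous f -> integral_M (fun z => c * f z) = c * integral_M f.
Proof.
move=> cf; apply: RintegralZl; first exact: measurable_unit_square.
by apply: continuous_integrable_plane => //; exact: unit_square_compact.
Qed.

Lemma integral_MD (f g : R * R -> R) : continuous f -> continuous g ->
  integral_M (fun z => f z + g z) = integral_M f + integral_M g.
Proof.
move=> cf cg; apply: RintegralD; first exact: measurable_unit_square.
all: by apply: continuous_integrable_plane => //; exact: unit_square_compact.
Qed.

Lemma integral_M_cst (c : R) : integral_M (fun=> c) = c.
Proof.
rewrite /integral_M /integral2 Rintegral_cst; last exact: measurable_unit_square.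
by rewrite (_ : fine _ = 1) ?mulr1 //; exact: (congr1 fine unit_square_area).
Qed.

Lemma le_integral_M (f g : R * R -> R) : continuous f -> continuous g ->
  (forall z, unit_square z -> f z <= g z) -> integral_M f <= integral_M g.
Proof.
move=> cf cg fg; apply: le_Rintegral => //; first exact: measurable_unit_square.
all: by apply: continuous_integrable_plane => //; exact: unit_square_compact.
Qed.

Lemma eq_integral_M (f g : R * R -> R) :
  (forall z, unit_square z -> f z = g z) -> integral_M f = integral_M g.
Proof. by move=> fg; apply: eq_Rintegral => z /set_mem; exact: fg. Qed.

(** Fubini on the whole plane, applied to the extension of f by zero. *)
Lemma integral_plane_iter (f : R * R -> R) : continuous f ->
  (\int[mu]_(x in `[0%R, 1%R]) \int[mu]_(y in `[0%R, 1%R]) (f (x, y))%:E =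
   \int[mu2]_(z in @unit_square R) (f z)%:E)%E.
Proof.
move=> cf.
have fi : mu2.-integrable setT ((EFin \o f) \_ (@unit_square R)).
  apply/integrable_restrict => //; first exact: measurable_unit_square; rewrite setTI.
  by apply: continuous_integrable_plane => //; exact: unit_square_compact.
rewrite [RHS]integral_mkcond -[RHS](integral12_prod_meas1 fi) integral_mkcond.
apply: eq_integral => x _; rewrite patchE; case: ifPn => [x01|x01].
  rewrite integral_mkcond; apply: eq_integral => y _; rewrite /= !patchE.
  by rewrite /unit_square in_setX x01.
rewrite /fubini_F /fubini_G integral0_eq // => y _; rewrite patchE /unit_square in_setX.
by rewrite (negbTE x01).
Qed.

Lemma integral_plane_iter_swap (f : R * R -> R) : continuous f ->
  (\int[mu]_(y in `[0%R, 1%R]) \int[mu]_(x in `[0%R, 1%R]) (f (x, y))%:E =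
   \int[mu2]_(z in @unit_square R) (f z)%:E)%E.
Proof.
move=> cf.
have fi : mu2.-integrable setT ((EFin \o f) \_ (@unit_square R)).
  apply/integrable_restrict => //; first exact: measurable_unit_square; rewrite setTI.
  by apply: continuous_integrable_plane => //; exact: unit_square_compact.
rewrite [RHS]integral_mkcond -[RHS](integral21_prod_meas1 fi) integral_mkcond.
apply: eq_integral => y _; rewrite patchE; case: ifPn => [y01|y01].
  rewrite integral_mkcond; apply: eq_integral => x _; rewrite /= !patchE.
  by rewrite /unit_square in_setX y01 andbT.
rewrite /fubini_F /fubini_G integral0_eq // => x _; rewrite patchE /unit_square in_setX.
by rewrite (negbTE y01) andbF.
Qed.

Lemma integral_periodic_derive1 (F f : R -> R) : continuous f ->
  (forall x, is_derive x (1 : R) F (f x)) -> F 1 = F 0 ->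
  (\int[mu]_(x in `[0%R, 1%R]) (f x)%:E = 0)%E.
Proof.
move=> cf dF F10.
have cF x : {for x, continuous F}.
  by apply: differentiable_continuous; apply/derivable1_diffP; have [] := dF x.
rewrite (@continuous_FTC2 _ f F) ?ltr01 //; last 3 first.
- exact: continuous_subspaceT.
- split; first by move=> x _; have [] := dF x.
  + exact/cvg_at_right_filter/cF.
  + exact/cvg_at_left_filter/cF.
- by move=> x _; rewrite derive1E; exact: derive_val.
by rewrite F10 -EFinB subrr.
Qed.

Lemma is_derive_line (V W : normedModType R) (phi : V -> W) (v z : V) (t : R) :
  derivable phi (z + t *: v) v ->
  is_derive t (1 : R) (fun s => phi (z + s *: v)) ('D_v phi (z + t *: v)).
Proof.
move=> dphi.
have E : (fun h : R => h^-1 *: (phi (z + (h *: 1 + t) *: v) - phi (z + t *: v))) =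
    (fun h => h^-1 *: (phi (h *: v + (z + t *: v)) - phi (z + t *: v))).
  apply/funext => h; do 3 f_equal.
  by rewrite [h *: 1]mulr1 scalerDl addrCA.
by split; rewrite /derivable /derive /= E.
Qed.

(** The inner integral is taken in the direction of the derivative, where the boundary terms cancel
    by periodicity; hence both orders of integration occur. *)
Lemma integral_M_derive (phi : R * R -> R) (i : 'I_2) :
  (forall z, derivable phi z (e2 i)) -> continuous ('D_(e2 i) phi) ->
  lattice_periodic e2 phi -> integral_M ('D_(e2 i) phi) = 0.
Proof.
move=> dphi cphi pphi; rewrite /integral_M /integral2 /Rintegral.
have D0 : i = 0 \/ i = 1 by case: i {dphi cphi} => [[|[|//]] /= h]; [left|right]; apply: val_inj.
case: D0 dphi cphi => -> dphi cphi.
  rewrite -integral_plane_iter_swap // integral0_eq //= => y _.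
  apply: (@integral_periodic_derive1 (fun x => phi (x, y)) (fun x => 'D_(e2 0) phi (x, y))).
  - move=> x; apply: (@continuous_comp R (R * R)%type R (fun x : R => (x, y)) ('D_(e2 0) phi)); last exact: cphi.
    by apply: (@cvg_pair _ _ _ (nbhs x) (nbhs x) (nbhs y)); [exact: cvg_id|exact: cvg_cst].
  - move=> x; have := @is_derive_line (R * R)%type R phi (e2 0) (0, y) x.
    have E t : (0, y) + t *: e2 0 = (t, y) :> R * R.
      by congr pair; rewrite /= /GRing.scale /= ?mulr1 ?mulr0 ?add0r ?addr0.
    rewrite E => /(_ (dphi _)).
    by rewrite (_ : (fun s => phi _) = (fun x => phi (x, y))) //; apply/funext => s; rewrite E.
  - rewrite -(pphi 0 (0, y)); congr phi.
    by congr pair; rewrite /= ?add0r ?addr0.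
rewrite -integral_plane_iter // integral0_eq //= => x _.
apply: (@integral_periodic_derive1 (fun y => phi (x, y)) (fun y => 'D_(e2 1) phi (x, y))).
- move=> y; apply: (@continuous_comp R (R * R)%type R (fun y : R => (x, y)) ('D_(e2 1) phi)); last exact: cphi.
  by apply: (@cvg_pair _ _ _ (nbhs y) (nbhs x) (nbhs y)); [exact: cvg_cst|exact: cvg_id].
- move=> y; have := @is_derive_line (R * R)%type R phi (e2 1) (x, 0) y.
  have E t : (x, 0) + t *: e2 1 = (x, t) :> R * R.
    by congr pair; rewrite /= /GRing.scale /= ?mulr1 ?mulr0 ?add0r ?addr0.
  rewrite E => /(_ (dphi _)).
  by rewrite (_ : (fun s => phi _) = (fun y => phi (x, y))) //; apply/funext => s; rewrite E.
- rewrite -(pphi 1 (x, 0)); congr phi.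
  by congr pair; rewrite /= ?add0r ?addr0.
Qed.

End PlaneMeasure.

(** * Integration over the image of the square under a unimodular linear map *)

Section LinearPlaneMeasure.
Variable R : realType.
Local Notation mR := (measurableTypeR R).
Local Notation mu := (@lebesgue_measure R).
Local Notation mu2 := (mu \x mu)%E.

(** If f is positive at a point, it exceeds half that value on a small square of area r^2 inside the
    unit square, and the integral is positive. *)
Lemma integral_M_eq0 (f : R * R -> R) : continuous f ->
  (forall z, unit_square z -> 0 <= f z) -> integral_M f = 0 ->
  forall z, unit_square z -> f z = 0.
Proof.
move=> cf f0 If0 [x0 y0] Qz; apply/eqP/negPn/negP => fz0.
have fz_gt0 : 0 < f (x0, y0) by rewrite lt_def fz0 f0.
have : \forall z \near (x0, y0), f (x0, y0) / 2 < f z.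
  by apply: (cvgr_gt (f (x0, y0)) (cf (x0, y0))); lra.
move=> /nbhs_ballP[e /= e_gt0 ef].
pose r := Num.min e 1 / 3.
have r_gt0 : 0 < r by rewrite divr_gt0 // lt_min e_gt0 ltr01.
have me : Num.min e 1 <= e by rewrite ge_min lexx.
have m1 : Num.min e 1 <= 1 by rewrite ge_min lexx orbT.
have re : r < e by rewrite /r; lra.
have r3 : r <= 3^-1 by rewrite /r; lra.
(* The point may lie on the boundary, so each side extends from c towards the middle of [0, 1]; r <=
   1/3 keeps it inside. *)
pose I (c : R) : set R := if c <= 2^-1 then `[c, c + r]%classic else `[c - r, c]%classic.
have mI c : measurable (I c : set mR) by rewrite /I; case: ifP => _; exact: measurable_itv.
have Ir c : mu (I c) = r%:E.
  rewrite /I; case: ifP => _; rewrite lebesgue_measure_itv /= lte_fin.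
    by rewrite ifT -?EFinB; [congr EFin; ring|lra].
  by rewrite ifT -?EFinB; [congr EFin; ring|lra].
have Isub c x : 0 <= c <= 1 -> I c x -> [/\ 0 <= x, x <= 1 & `|c - x| < e].
  move=> c01; rewrite /I; case: ifPn => cc; rewrite /= in_itv /= => xc.
    by split; [lra|lra|rewrite ltr_norml; lra].
  by move: cc; rewrite -ltNge => cc; split; [lra|lra|rewrite ltr_norml; lra].
have [/= + +] := Qz; rewrite !in_itv /= => x01 y01.
pose B : set (R * R) := I x0 `*` I y0.
have mB : measurable (B : set (mR * mR)) by exact: measurableX.
have BQ : B `<=` @unit_square R.
  move=> [x y] [/= /(Isub _ _ x01)[? ? _] /(Isub _ _ y01)[? ? _]].
  by split; rewrite /= in_itv /=; apply/andP; split.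
have Bf z : B z -> f (x0, y0) / 2 <= f z.
  move: z => [x y] [/= /(Isub _ _ x01)[_ _ ?] /(Isub _ _ y01)[_ _ ?]].
  by apply/ltW/ef; split; rewrite -ball_normE.
have muB : mu2 B = (r * r)%:E.
  by rewrite product_measure1E // EFinM; congr (_ * _)%E; exact: Ir.
have : ((f (x0, y0) / 2)%:E * (r * r)%:E <= \int[mu2]_(z in @unit_square R) (f z)%:E)%E.
  rewrite -muB.
  apply: (@le_trans _ _ (\int[mu2]_(z in B) (f z)%:E)%E).
    rewrite -integral_cst //; apply: ge0_le_integral => //.
    - by move=> z _; rewrite lee_fin; lra.
    - apply/measurable_EFinP; apply: measurable_funTS.
      exact: continuous_measurable_plane.
  apply: ge0_subset_integral => //; first exact: measurable_unit_square.
    apply/measurable_EFinP; apply: measurable_funTS.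
    exact: continuous_measurable_plane.
have iQ : mu2.-integrable (@unit_square R) (EFin \o f).
  by apply: continuous_integrable_plane => //; exact: unit_square_compact.
rewrite -(@fineK _ (\int[mu2]_(z in @unit_square R) (f z)%:E)%E); last first.
  by apply: integrable_fin_num => //; exact: measurable_unit_square.
rewrite [fine _]If0 -!EFinM lee_fin => ?.
have f2 : 0 < f (x0, y0) / 2 by lra.
have : 0 < f (x0, y0) / 2 * (r * r) by rewrite mulr_gt0 // mulr_gt0.
lra.
Qed.

Definition image_measure d1 d2 (T1 : measurableType d1) (T2 : measurableType d2)
    (m : {measure set T1 -> \bar R}) (f : T1 -> T2) (mf : measurable_fun setT f) :
    {measure set T2 -> \bar R} :=
  measure_function_pushforward__canonical__measure_function_Measure m mf.

Lemma measurable_affine (c d : R) : measurable_fun setT ((fun x : R => c + d * x) : mR -> mR).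
Proof. by apply: measurable_funD => //; apply: measurable_funM. Qed.

(** By uniqueness of Lebesgue measure it is enough to compare on intervals ]a, b]. For d < 0 the
    preimage is half-open on the other side. *)
Lemma lebesgue_measure_affine (c d : R) (A : set R) : d != 0 ->
  measurable (A : set mR) ->
  mu A = (`|d|%:E * mu ((fun x : R => (c + d * x)%R) @^-1` A))%E.
Proof.
move=> d0 mA.
pose phi : mR -> mR := fun x : R => c + d * x.
have mphi : measurable_fun setT phi by exact: measurable_affine.
pose m := mscale (NngNum (normr_ge0 d)) (image_measure mu mphi).
rewrite -[RHS]/(m A); apply: lebesgue_measure_unique => // _ [[a b] _ <-].
rewrite -[RHS]/(`|d|%:E * mu (phi @^-1` `]a, b]%classic))%E [LHS]lebesgue_measure_itv /=.
have [dgt0|dlt0|d00] := ltgtP 0 d; last by rewrite -d00 eqxx in d0.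
  rewrite [X in mu X](_ : _ = `](a - c) / d, (b - c) / d]%classic); last first.
    apply/seteqP; split => x /=; rewrite /phi !in_itv /= ltr_pdivrMr // ler_pdivlMr //; lra.
  rewrite lebesgue_measure_itv /= !lte_fin ltr_pM2r ?invr_gt0 // ltrD2r.
  case: ifP => _; last by rewrite mule0.
  by rewrite -!EFinB -EFinM gtr0_norm //; congr EFin; field.
rewrite [X in mu X](_ : _ = `[(b - c) / d, (a - c) / d[%classic); last first.
  apply/seteqP; split => x /=; rewrite /phi !in_itv /= ltr_ndivlMr // ler_ndivrMr //; lra.
rewrite lebesgue_measure_itv /= !lte_fin ltr_nM2r ?invr_lt0 // ltrD2r.
case: ifP => _; last by rewrite mule0.
by rewrite -!EFinB -EFinM ltr0_norm //; congr EFin; field.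
Qed.

Lemma ge0_integral_affine (c d : R) (g : R -> \bar R) : d != 0 ->
  measurable_fun setT (g : mR -> \bar R) -> (forall x, 0 <= g x)%E ->
  (\int[mu]_x g x = `|d|%:E * \int[mu]_x g (c + d * x)%R)%E.
Proof.
move=> d0 mg g0.
pose phi : mR -> mR := fun x : R => c + d * x.
have mphi : measurable_fun setT phi by exact: measurable_affine.
pose m := mscale (NngNum (normr_ge0 d)) (image_measure mu mphi).
rewrite (@eq_measure_integral _ _ _ _ m); last first.
  by move=> A mA _; exact: lebesgue_measure_affine.
rewrite ge0_integral_mscale //= ge0_integral_pushforward // => x _; exact: g0.
Qed.

Lemma LmapE (al be : R) (z : R * R) :
  Lmap al be z = (al * z.2 + be^-1 * z.1, be * z.2).
Proof.
case: z => x y; congr pair => /=; rewrite /GRing.scale /= ?mulr0; ring.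
Qed.

Lemma Lmap_continuous (al be : R) : continuous (Lmap al be).
Proof.
move=> z.
apply: (@continuousD _ _ _ (fun z : R * R => z.1 *: ((be^-1, 0) : R * R))
  (fun z : R * R => z.2 *: ((al, be) : R * R))).
  apply: (@continuousZr_tmp _ _ _ (fun z : R * R => z.1)); exact: cvg_fst.
apply: (@continuousZr_tmp _ _ _ (fun z : R * R => z.2)); exact: cvg_snd.
Qed.

Lemma measurable_Lmap (al be : R) :
  measurable_fun setT (Lmap al be : mR * mR -> mR * mR).
Proof.
rewrite (_ : Lmap al be = fun z => (al * z.2 + be^-1 * z.1, be * z.2)); last first.
  by apply/funext => z; exact: LmapE.
by apply/measurable_fun_pairP; split => /=; [apply: measurable_funD|];
  apply: measurable_funM.
Qed.

(** L maps horizontal lines to horizontal lines. Slicing horizontally, the factor |be| from the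
    heights cancels the factor 1 / |be| from the slices. *)
Lemma Lmap_measure_preserving (al be : R) (A : set (R * R)) : be != 0 ->
  measurable (A : set (mR * mR)) -> mu2 A = mu2 (Lmap al be @^-1` A).
Proof.
move=> be0 mA.
have mLA : measurable (Lmap al be @^-1` A : set (mR * mR)).
  by rewrite -[X in measurable X]setTI; exact: measurable_Lmap.
have mu12 (B : set (mR * mR)) : measurable B -> mu2 B = (\int[mu]_y mu (ysection B y))%E.
  move=> mB; transitivity ((mu \x^ mu)%E B) => //.
  by apply: product_measure_unique => // C D mC mD /=; rewrite product_measure2E.
have mS (B : set (mR * mR)) : measurable B ->
    measurable_fun setT (fun y => mu (ysection B y)).
  exact: measurable_fun_ysection.
rewrite !mu12 // (@ge0_integral_affine 0 be) //; last exact: mS.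
rewrite -ge0_integralZl //; last first.
  apply: (measurableT_comp (mS _ mA)); exact: measurable_affine.
apply: eq_integral => y _.
have bV0 : be^-1 != 0 by rewrite invr_eq0.
rewrite (@lebesgue_measure_affine (al * y) be^-1) //; last exact: measurable_ysection.
rewrite muleA -EFinM -normrM divff // normr1 mul1e; congr (mu _).
apply/seteqP; split => x /=; rewrite /ysection /= !inE /= LmapE add0r //.
Qed.

Lemma integral_Lmap (al be : R) (f : R * R -> R) : be != 0 -> continuous f ->
  integral_Mab al be f = integral_M (f \o Lmap al be).
Proof.
move=> be0 cf; rewrite /integral_Mab /integral_M /integral2 /Rintegral; congr fine.
have cL := @Lmap_continuous al be.
have Linj z : (Lmap al be @^-1` (Lmap al be @` @unit_square R)) z -> unit_square z.
  move=> [z' Qz']; rewrite !LmapE => -[e1 /(mulfI be0) e2'].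
  move: e1; rewrite e2' => /addrI /mulfI e1.
  by rewrite [z]surjective_pairing -e2' -e1 ?invr_eq0 // -surjective_pairing.
have LQ : Lmap al be @^-1` (Lmap al be @` @unit_square R) = @unit_square R.
  by apply/seteqP; split => [z /Linj //|z Qz]; exists z.
have mLQ : measurable (Lmap al be @` @unit_square R : set (mR * mR)).
  apply: compact_measurable_plane; apply: continuous_compact.
    exact: continuous_subspaceT.
  exact: unit_square_compact.
rewrite (@eq_measure_integral _ _ _ _ (image_measure mu2 (@measurable_Lmap al be))); last first.
  by move=> A mA _; exact: Lmap_measure_preserving.
have mf : measurable_fun setT (EFin \o f : mR * mR -> \bar R).
  by apply/measurable_EFinP; exact: continuous_measurable_plane.
have fLi : mu2.-integrable (Lmap al be @^-1` (Lmap al be @` @unit_square R))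
    ((EFin \o f) \o Lmap al be).
  rewrite LQ; apply: (@continuous_integrable_plane R (@unit_square R) (f \o Lmap al be)).
    exact: unit_square_compact.
  by move=> z; apply: continuous_comp; [exact: cL|exact: cf].
by rewrite [LHS](integral_pushforward (@measurable_Lmap al be) mf fLi) // LQ.
Qed.

End LinearPlaneMeasure.

(** * Smooth functions *)

Section CkTheory.
Variables (R : realType) (V W : normedModType R).
Implicit Types (A O : set V) (f g : V -> W) (v x : V).

Lemma near0_line O v x : nbhs x O -> \forall h \near (0 : R), O (x + h *: v).
Proof.
move=> nO.
have c : x + h *: v @[h --> (0 : R)] --> x.
  rewrite -[X in _ --> X]addr0 -[X in _ --> _ + X](scale0r v).
  by apply: cvgD; [exact: cvg_cst|apply: cvgZr_tmp; exact: cvg_id].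
exact: c.
Qed.

(** At an interior point the restriction on the increments is void. *)
Lemma dquot_nbhs A f v x : nbhs x A ->
  dquot A f v x = (fun h : R => h^-1 *: ((f \o shift x) (h *: v) - f x)) @ 0^'.
Proof.
move=> nA; rewrite /dquot.
have -> : within [set h : R | A (x + h *: v)] 0^' = 0^'.
  apply/seteqP; split => P; last exact: cvg_within.
  rewrite /within /= => HP; have : \forall h \near 0^', A (x + h *: v).
    by apply: nbhs_dnbhs; exact: near0_line.
  by move=> HA; apply: filterS2 HP HA => h /[apply].
rewrite (_ : (fun h : R => _ *: (f (x + _) - _)) =
  (fun h => h^-1 *: ((f \o shift x) (h *: v) - f x))) //.
by apply/funext => h /=; rewrite [h *: v + x]addrC.
Qed.

Lemma dderiv_nbhs A f v x : nbhs x A -> dderiv A f v x = 'D_v f x.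
Proof. by move=> nA; rewrite /dderiv dquot_nbhs. Qed.

Lemma eq_dquot A f g v x : {in A, f =1 g} -> A x -> dquot A f v x = dquot A g v x.
Proof.
move=> fg Ax.
have sub f1 f2 : {in A, f1 =1 f2} -> dquot A f1 v x `<=` dquot A f2 v x.
  move=> f12 P HP.
  have {}HP : (0 : R)^' (fun h => A (x + h *: v) -> P (h^-1 *: (f1 (x + h *: v) - f1 x))).
    exact: HP.
  rewrite -[dquot _ _ _ _ _]/((0 : R)^' (fun h => A (x + h *: v) -> P (h^-1 *: (f2 (x + h *: v) - f2 x)))).
  by apply: filterS HP => h HP Ah; move: (HP Ah); rewrite !f12 ?inE.
by apply/seteqP; split; apply: sub => // y Ay; rewrite fg.
Qed.

Lemma eq_Ck k A f g : {in A, f =1 g} -> Ck k A f -> Ck k A g.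
Proof.
elim: k f g => [|k IH] f g fg /= [cf df]; (split; first exact: subspace_eq_continuous cf) => //.
move=> v; have [dfv Cv] := df v; split => [x Ax|].
  by rewrite -(eq_dquot _ fg) //; exact: dfv.
apply: IH Cv => x /set_mem Ax; rewrite /dderiv; congr lim; exact: eq_dquot.
Qed.

Lemma Ck_S k A f : Ck k.+1 A f -> Ck k A f.
Proof.
elim: k f => [|k IH] f /= [cf df]; split => // v.
by have [dv Cv] := df v; split => //; apply: IH.
Qed.

Lemma Ck_open_sub k A O f : open O -> O `<=` A -> Ck k A f -> Ck k O f.
Proof.
move=> oO OA; elim: k f => [|k IH] f /= [cf df];
  (split; first exact: continuous_subspaceW cf) => // v.
have nO x : O x -> nbhs x O by move=> Ox; exact: open_nbhs_nbhs.
have nA x : O x -> nbhs x A by move=> /nO; apply: filterS.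
have [dv Cv] := df v; split => [x Ox|].
  by have := dv x (OA _ Ox); rewrite !dquot_nbhs //; [exact: nO|exact: nA].
apply: eq_Ck (IH _ Cv) => x /set_mem Ox.
by rewrite !dderiv_nbhs //; [exact: nO|exact: nA].
Qed.

Lemma smooth_on_sub A O f : open O -> O `<=` A -> smooth_on A f -> smooth_on O f.
Proof. by move=> oO OA sf k; exact: Ck_open_sub (sf k). Qed.

(** On an open set the recursion of [Ck] unfolds with genuine directional derivatives; the closure
    properties below are proved by induction in this form. *)
Lemma Ck_openS k O f : open O ->
  Ck k.+1 O f <-> (forall x, O x -> {for x, continuous f}) /\
    (forall v, (forall x, O x -> derivable f x v) /\ Ck k O ('D_v f)).
Proof.
move=> oO; have nO x : O x -> nbhs x O by move=> Ox; exact: open_nbhs_nbhs.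
rewrite /= continuous_open_subspace //; split => -[cf df]; split => [x Ox|v].
- by apply: cf; rewrite inE.
- have [dv Cv] := df v; split => [x Ox|].
    by have := dv _ Ox; rewrite dquot_nbhs //; exact: nO.
  by apply: eq_Ck Cv => x /set_mem Ox; rewrite dderiv_nbhs //; exact: nO.
- by apply: cf; move: Ox; rewrite inE.
- have [dv Cv] := df v; split => [x Ox|].
    by rewrite dquot_nbhs; [exact: dv|exact: nO].
  by apply: eq_Ck Cv => x /set_mem Ox; rewrite dderiv_nbhs //; exact: nO.
Qed.

Lemma smooth_on_continuous O f x : open O -> smooth_on O f -> O x ->
  {for x, continuous f}.
Proof. by move=> oO sf; have /(Ck_openS _ _ oO)[+ _] := sf 1%N; apply. Qed.

Lemma smooth_on_derivable O f x v : open O -> smooth_on O f -> O x ->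
  derivable f x v.
Proof. by move=> oO sf; have /(Ck_openS _ _ oO)[_ /(_ v)[+ _]] := sf 1%N; apply. Qed.

Lemma smooth_on_derive O f v : open O -> smooth_on O f -> smooth_on O ('D_v f).
Proof. by move=> oO sf k; have /(Ck_openS _ _ oO)[_ /(_ v)[_ +]] := sf k.+1. Qed.

Lemma eq_smooth_on A f g : {in A, f =1 g} -> smooth_on A f -> smooth_on A g.
Proof. by move=> fg sf k; apply: eq_Ck (sf k). Qed.

Lemma smooth_on_dderiv A f v : smooth_on A f -> smooth_on A (dderiv A f v).
Proof. by move=> sf k; have [_ /(_ v)[]] := sf k.+1. Qed.

Lemma smooth_on_within A f : smooth_on A f -> {within A, continuous f}.
Proof. by move=> sf; have [] := sf 0. Qed.

Lemma CkD k O f g : open O -> Ck k O f -> Ck k O g -> Ck k O (fun x => f x + g x).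
Proof.
move=> oO; elim: k f g => [|k IH] f g.
  by move=> [cf _] [cg _]; split => //; exact: within_continuousD.
move=> /(Ck_openS _ _ oO)[cf df] /(Ck_openS _ _ oO)[cg dg].
apply/Ck_openS => //; split => [x Ox|v]; first by apply: continuousD; [exact: cf|exact: cg].
have [dfv Cf] := df v; have [dgv Cg] := dg v; split => [x Ox|].
  by apply: derivableD; [exact: dfv|exact: dgv].
apply: eq_Ck (IH _ _ Cf Cg) => x /set_mem Ox; apply/esym/deriveD; [exact: dfv|exact: dgv].
Qed.

Lemma Ck_cst k O (w : W) : open O -> Ck k O (fun=> w).
Proof.
move=> oO; elim: k w => [|k IH] w.
  by split => //; apply: continuous_subspaceT => x; exact: cvg_cst.
apply/Ck_openS => //; split => [x _|v]; first exact: cvg_cst.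
split => [x _|]; first exact: derivable_cst.
by apply: eq_Ck (IH 0) => x _; rewrite derive_cst.
Qed.

Lemma smooth_on_cst O (w : W) : open O -> smooth_on O (fun=> w).
Proof. by move=> oO k; exact: Ck_cst. Qed.

Lemma smooth_onD O f g : open O -> smooth_on O f -> smooth_on O g ->
  smooth_on O (fun x => f x + g x).
Proof. by move=> oO sf sg k; exact: CkD. Qed.

Lemma smooth_on_linear O (f : {linear V -> W}) : open O -> continuous f -> smooth_on O f.
Proof.
move=> oO cf [|k]; first by split => //; exact: continuous_subspaceT.
have df x v : is_derive x v f (f v).
  have dx := linear_differentiable (x : V) cf.
  by split; [exact: diff_derivable|rewrite deriveE // diff_lin].
apply/Ck_openS => //; split => [x _|v]; first exact: cf.
split => [x _|]; first by have [] := df x v.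
by apply: eq_Ck (Ck_cst k (f v) oO) => x _; apply/esym; have [] := df x v.
Qed.

End CkTheory.

Section CkReal.
Variables (R : realType) (V : normedModType R).
Implicit Types (O : set V) (f g : V -> R).

Lemma CkM k O f g : open O -> Ck k O f -> Ck k O g -> Ck k O (fun x => f x * g x).
Proof.
move=> oO; elim: k f g => [|k IH] f g.
  move=> [cf _] [cg _]; split => //; move: cf cg; rewrite !continuous_open_subspace //.
  by move=> cf cg x Ox; apply: continuousM; [exact: cf|exact: cg].
move=> Cf Cg; have := Cf; have := Cg.
move=> /(Ck_openS _ _ oO)[cg dg] /(Ck_openS _ _ oO)[cf df].
apply/Ck_openS => //; split => [x Ox|v]; first by apply: continuousM; [exact: cf|exact: cg].
have [dfv Cfv] := df v; have [dgv Cgv] := dg v; split => [x Ox|].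
  by apply: derivableM; [exact: dfv|exact: dgv].
apply: eq_Ck (CkD oO (IH _ _ (Ck_S Cf) Cgv) (IH _ _ (Ck_S Cg) Cfv)) => x /set_mem Ox.
by apply/esym/deriveM; [exact: dfv|exact: dgv].
Qed.

Lemma smooth_onM O f g : open O -> smooth_on O f -> smooth_on O g ->
  smooth_on O (fun x => f x * g x).
Proof. by move=> oO sf sg k; exact: CkM. Qed.

Lemma smooth_onB O f g : open O -> smooth_on O f -> smooth_on O g ->
  smooth_on O (fun x => f x - g x).
Proof.
move=> oO sf sg.
apply: (@eq_smooth_on _ _ _ _ (fun x => f x + (-1) * g x)).
  by move=> x _; rewrite mulN1r.
by apply: smooth_onD => //; apply: smooth_onM => //; exact: smooth_on_cst.
Qed.

End CkReal.

(** * Restriction of smooth functions to time slices *)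

Section CkSlice.
Variables (R : realType) (V W : normedModType R).

(** An increment (0, v) leaves the time fixed, so the identity also holds at t = 0, where A is no
    neighbourhood of the point. *)
Lemma dquot_slice (A : set (R * V)) (phi : R * V -> W) t v z :
  dquot [set z | A (t, z)] (fun z => phi (t, z)) v z = dquot A phi (0, v) (t, z).
Proof.
have E (h : R) : (t, z) + h *: (0, v) = (t, z + h *: v) :> R * V.
  by congr pair; rewrite /= scaler0 addr0.
rewrite /dquot.
have -> : (fun h : R => h^-1 *: ((fun z => phi (t, z)) (z + h *: v) - (fun z => phi (t, z)) z)) =
    (fun h : R => h^-1 *: (phi ((t, z) + h *: (0, v)) - phi (t, z))).
  by apply/funext => h; rewrite E.
have -> : [set h : R | [set z | A (t, z)] (z + h *: v)] =
    [set h : R | A ((t, z) + h *: (0, v))].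
  by apply/funext => h /=; rewrite E.
by [].
Qed.

Lemma Ck_slice k (A : set (R * V)) (phi : R * V -> W) t :
  Ck k A phi -> Ck k [set z | A (t, z)] (fun z => phi (t, z)).
Proof.
elim: k phi => [|k IH] phi /= [cphi dphi]; (split;
  first (apply/subspace_continuousP => z Az;
  move/subspace_continuousP: cphi => /(_ (t, z) Az) cphi;
  apply: cvg_trans cphi => P; rewrite /fmap /within /= => -[[P1 P2] [/= H1 H2] HP];
  by apply: filterS H2 => z' H2 Az'; apply: (HP (t, z')) => //; split => //; exact: nbhs_singleton)) => // v.
have [dv Cv] := dphi (0, v); split => [z Az|].
  by rewrite dquot_slice; exact: dv.
by apply: eq_Ck (IH _ Cv) => z Az; rewrite /dderiv dquot_slice.
Qed.

Lemma smooth_on_slice (A : set (R * V)) (phi : R * V -> W) t :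
  smooth_on A phi -> smooth_on [set z | A (t, z)] (fun z => phi (t, z)).
Proof. by move=> sphi k; exact: Ck_slice. Qed.

End CkSlice.

(** * Symmetry of second derivatives *)

Section Schwarz.
Variable R : realType.

(** The mean value theorem between 0 and c, stated with absolute values to treat both signs of c at
    once. *)
Lemma MVT_abs (f df : R -> R) (c : R) :
  (forall s, `|s| <= `|c| -> is_derive s (1 : R) f (df s)) ->
  exists2 th, `|th| <= `|c| & f c - f 0 = df th * c.
Proof.
move=> dff.
have cf s : `|s| <= `|c| -> {for s, continuous f}.
  move=> sc; apply: differentiable_continuous; apply/derivable1_diffP.
  by have [] := dff s sc.
have [c0|c0] := leP 0 c.
  have sub s : s \in `[0, c] -> `|s| <= `|c|.
    by rewrite in_itv /= => /andP[s0 sc]; rewrite !ger0_norm.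
  have [||th thI ->] := @MVT_segment R f df 0 c c0.
  - by move=> s sI; apply: dff; apply: sub; exact: subset_itv_oo_cc.
  - by apply: continuous_in_subspaceT => s /set_mem sI; apply: cf; exact: sub.
  - by exists th; [exact: sub|rewrite subr0].
have sub s : s \in `[c, 0] -> `|s| <= `|c|.
  by rewrite in_itv /= => /andP[cs s0]; rewrite !ler0_norm ?(ltW c0) // lerN2.
have [||th thI E] := @MVT_segment R f df c 0 (ltW c0).
- by move=> s sI; apply: dff; apply: sub; exact: subset_itv_oo_cc.
- by apply: continuous_in_subspaceT => s /set_mem sI; apply: cf; exact: sub.
- by exists th; [exact: sub|rewrite -opprB E; ring].
Qed.

Lemma dist_half_disjoint (a b q : R) :
  `|a - q| < `|a - b| / 2 -> `|b - q| < `|a - b| / 2 -> False.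
Proof.
by have := ler_distD q a b; rewrite [X in _ <= _ + X]distrC; lra.
Qed.

Variable V : normedModType R.
Implicit Types (O U : set V) (f : V -> R) (v w x : V).

Lemma nbhs_plane U x v w : nbhs x U ->
  exists2 d : R, 0 < d & forall s t, `|s| <= d -> `|t| <= d -> U (x + s *: v + t *: w).
Proof.
move=> /nbhs_ballP[e /= e0 eU].
pose k := `|v| + `|w| + 1.
have k0 : 0 < k by rewrite ltr_wpDl // addr_ge0.
exists (e / 2 / k) => [|s t sd td]; first by rewrite !divr_gt0.
apply: eU; rewrite -ball_normE /= -addrA opprD addNKr normrN.
apply: (@le_lt_trans _ _ (e / 2)); last by lra.
apply: (le_trans (ler_normD _ _)); rewrite !normrZ.
apply: (@le_trans _ _ (e / 2 / k * `|v| + e / 2 / k * `|w|)).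
  by apply: lerD; apply: ler_wpM2r.
have -> : e / 2 = e / 2 / k * k by rewrite divfK ?gt_eqF.
rewrite mulfK ?gt_eqF // -mulrDr; apply: ler_wpM2l; last by rewrite /k lerDl.
by rewrite ltW // !divr_gt0.
Qed.

(** Two applications of the mean value theorem: along v to the difference [F] of f on two parallel
    segments, then along w to the derivative of f along v. *)
Lemma second_difference O f x v w (d : R) : open O -> smooth_on O f -> 0 <= d ->
  (forall s t, `|s| <= d -> `|t| <= d -> O (x + s *: v + t *: w)) ->
  exists s t, [/\ `|s| <= d, `|t| <= d &
    f (x + d *: v + d *: w) - f (x + d *: v) - f (x + d *: w) + f x =
    'D_w ('D_v f) (x + s *: v + t *: w) * d * d].
Proof.
move=> oO sf d0 dO; have nd : `|d| = d by rewrite ger0_norm.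
have df y u : O y -> derivable f y u by exact: smooth_on_derivable.
have dO0 s : `|s| <= d -> O (x + s *: v).
  by move=> sd; have := dO s 0 sd; rewrite normr0 scale0r addr0; exact.
pose F s := f (x + d *: w + s *: v) - f (x + s *: v).
pose dF s := 'D_v f (x + d *: w + s *: v) - 'D_v f (x + s *: v).
have [s|s] := @MVT_abs F dF d; rewrite nd => sd; last move=> Es.
  have d1 : is_derive s (1 : R) (fun s => f (x + d *: w + s *: v)) ('D_v f (x + d *: w + s *: v)).
    apply: is_derive_line; apply: df; rewrite addrAC.
    by apply: dO; rewrite ?nd.
  have d2 : is_derive s (1 : R) (fun s => f (x + s *: v)) ('D_v f (x + s *: v)).
    by apply: is_derive_line; apply: df; exact: dO0.
  exact: (is_deriveB d1 d2).
pose H t := 'D_v f (x + s *: v + t *: w).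
have [t|t] := @MVT_abs H (fun t => 'D_w ('D_v f) (x + s *: v + t *: w)) d;
  rewrite nd => td; last move=> Et.
  apply: is_derive_line; apply: (smooth_on_derivable (O := O)) => //.
    exact: smooth_on_derive.
  exact: dO.
exists s, t; split => //; rewrite -[in RHS]Et /H scale0r addr0.
rewrite (addrAC x (s *: v)) -[X in X * d]/(dF s) -Es /F scale0r !addr0 (addrAC x (d *: w)).
ring.
Qed.

(** The second difference is symmetric in v and w, so the two mixed derivatives agree at suitable
    points arbitrarily close to x. If they differed at x, continuity would separate them there. *)
Lemma schwarz O f x v w : open O -> smooth_on O f -> O x ->
  'D_w ('D_v f) x = 'D_v ('D_w f) x.
Proof.
move=> oO sf Ox; apply/eqP/negPn/negP => neq.
pose e := `|'D_w ('D_v f) x - 'D_v ('D_w f) x| / 2.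
have e0 : 0 < e by rewrite divr_gt0 // normr_gt0 subr_eq0.
have cD a b : {for x, continuous ('D_a ('D_b f))}.
  by apply: (smooth_on_continuous oO) => //; do 2 apply: smooth_on_derive => //.
have nO : nbhs x O by exact: open_nbhs_nbhs.
have /(cvgrPdist_lt) /(_ _ e0) n1 := cD w v.
have /(cvgrPdist_lt) /(_ _ e0) n2 := cD v w.
have [d d0 dU] := nbhs_plane v w (filterI nO (filterI n1 n2)).
have dO s t : `|s| <= d -> `|t| <= d -> O (x + s *: v + t *: w).
  by move=> sd td; have [] := dU s t sd td.
have [s [t [sd td E1]]] := second_difference oO sf (ltW d0) dO.
have dO' s' t' : `|s'| <= d -> `|t'| <= d -> O (x + s' *: w + t' *: v).
  by move=> sd' td'; rewrite addrAC; exact: dO.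
have [s' [t' [sd' td' E2]]] := second_difference oO sf (ltW d0) dO'.
have [_ [/= l1 _]] := dU s t sd td; have [_ [_ /= l2]] := dU t' s' td' sd'.
rewrite [x + t' *: v + _]addrAC in l2; rewrite [x + d *: v + d *: w]addrAC in E1.
move: l1 l2 E1 E2; rewrite /e.
move: ('D_w ('D_v f) (x + _ + _)) ('D_v ('D_w f) (x + _ + _)) => p q.
move: ('D_w ('D_v f) x) ('D_v ('D_w f) x) => a b.
move: (f _) (f _) (f _) (f _) => f1 f2 f3 f4 ap bq E1 E2.
have pq : p = q.
  have dn0 : d * d != 0 by rewrite mulf_neq0 // gt_eqF.
  by apply: (mulIf dn0); rewrite !mulrA -E1 -E2; ring.
by rewrite pq in ap; exact: (dist_half_disjoint ap bq).
Qed.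

End Schwarz.

(** * Smooth functions in finite dimension are differentiable *)

Section C1Differentiable.
Variables (R : realType) (V : normedModType R) (m : nat).
Variables (b : 'I_m -> V) (c : 'I_m -> V -> R) (K : R).
Hypothesis K0 : 0 < K.
Hypothesis c_lin : forall i (a : R) y z, c i (a *: y + z) = a * c i y + c i z.
Hypothesis bc : forall y, y = \sum_i c i y *: b i.
Hypothesis cK : forall i y, `|c i y| <= K * `|y|.

Let B := \sum_i `|b i|.

(** Corners of the path from 0 to y that moves along one basis vector at a time. *)
Let partial (k : nat) y := \sum_(i < m | (i < k)%N) c i y *: b i.

Let partialS (i : 'I_m) y : partial i.+1 y = partial i y + c i y *: b i.
Proof.
rewrite /partial (bigD1 i) //= addrC; congr (_ + _); apply: eq_bigl => j.
by rewrite ltnS ltn_neqAle andbC.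
Qed.

Let partial_le k y : `|partial k y| <= K * `|y| * B.
Proof.
apply: (le_trans (ler_norm_sum _ _ _)); rewrite /B mulr_sumr big_mkcond /=.
apply: ler_sum => i _; case: ifP => _; last by rewrite mulr_ge0 // mulr_ge0 // ltW.
by rewrite normrZ ler_wpM2r.
Qed.

(** The increment of f is telescoped along the path of corners. Each edge is treated by the mean
    value theorem, and continuity of the partial derivatives moves the intermediate point to x. *)
Lemma smooth_on_linear_approx (O : set V) (f : V -> R) x (e : R) :
  open O -> smooth_on O f -> O x -> 0 < e ->
  \forall y \near (0 : V),
    `|f (y + x) - f x - \sum_i c i y * 'D_(b i) f x| <= e * `|y|.
Proof.
move=> oO sf Ox e0.
(* Each of the m edges contributes an error of at most K |y| e'; the summand 1 keeps the divisor
   positive when m = 0. *)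
pose e' := e / (m%:R * K + 1).
have mK0 : 0 < m%:R * K + 1 by rewrite ltr_wpDl // mulr_ge0 // ltW.
have e'0 : 0 < e' by rewrite divr_gt0.
have nz : \forall z \near x, O z /\ forall i : 'I_m, `|'D_(b i) f x - 'D_(b i) f z| <= e'.
  near=> z; split; first by near: z; exact: open_nbhs_nbhs.
  near: z; apply: filter_forall => i.
  have : {for x, continuous ('D_(b i) f)}.
    by apply: (smooth_on_continuous oO) => //; exact: smooth_on_derive.
  by move=> /cvgrPdist_le; apply.
have /nbhs_ballP[d /= d0 dP] := nz.
have B0 : 0 <= B by apply: sumr_ge0.
have KB0 : 0 < K * B + K * B + 1 by rewrite ltr_wpDl // addr_ge0 // mulr_ge0 // ltW.
near=> y.
(* Every point of the path is within 2 K B |y| of x: one K B |y| for the corner, one for the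
   position on the edge. *)
have yd : `|y| < d / (K * B + K * B + 1).
  by near: y; apply: nbhs0_lt; rewrite divr_gt0.
have in_ball (i : 'I_m) th : `|th| <= `|c i y| -> ball x d (x + partial i y + th *: b i).
  move=> thc; rewrite -ball_normE /= -addrA opprD addNKr normrN.
  apply: (@le_lt_trans _ _ (K * `|y| * B + K * `|y| * B)).
    apply: (le_trans (ler_normD _ _)); apply: lerD; first exact: partial_le.
    rewrite normrZ; apply: ler_pM => //; first exact: (le_trans thc).
    by rewrite /B (bigD1 i) //= lerDl sumr_ge0.
  move: yd; rewrite ltr_pdivlMr // => yd; apply: (le_lt_trans _ yd).
  have : 0 <= `|y| by []. 
  lra.
have step (k : nat) : (k <= m)%N ->
    `|f (x + partial k y) - f x - \sum_(i < m | (i < k)%N) c i y * 'D_(b i) f x|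
      <= k%:R * (K * `|y| * e').
  elim: k => [_|k IH km].
    by rewrite /partial !big1 //= ?addr0 ?subrr ?subr0 ?normr0 ?mul0r // => i; rewrite ltn0.
  have {}IH := IH (ltnW km); pose i := Ordinal km.
  pose F s := f (x + partial i y + s *: b i).
  have [s sc|th thc Eth] := @MVT_abs R F (fun s => 'D_(b i) f (x + partial i y + s *: b i)) (c i y).
    apply: is_derive_line; apply: (smooth_on_derivable (O := O)) => //.
    by have [] := dP _ (in_ball i s sc).
  have [_ /(_ i) close] := dP _ (in_ball i th thc).
  have -> : \sum_(j < m | (j < k.+1)%N) c j y * 'D_(b j) f x =
      \sum_(j < m | (j < k)%N) c j y * 'D_(b j) f x + c i y * 'D_(b i) f x.
    rewrite (bigD1 i) //= addrC; congr (_ + _); apply: eq_bigl => j.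
    by rewrite ltnS ltn_neqAle andbC.
  have -> : f (x + partial k.+1 y) = f (x + partial k y) + 'D_(b i) f (x + partial i y + th *: b i) * c i y.
    by rewrite -Eth /F scale0r addr0 [RHS]addrC subrK (partialS i) addrA.
  rewrite -natr1 mulrDl mul1r.
  set p := f (x + partial k y) in IH *; set q := \sum_(j < m | _) _ in IH *.
  set D := 'D_(b i) f x in close *; set D' := 'D_(b i) f _ in close *.
  have -> : p + D' * c i y - f x - (q + c i y * D) = (p - f x - q) + (D' - D) * c i y by ring.
  apply: (le_trans (ler_normD _ _)); apply: lerD => //.
  rewrite normrM distrC mulrC; exact: ler_pM.
have := step m (leqnn m).
have -> : partial m y = y.
  transitivity (\sum_i c i y *: b i); last exact/esym/bc.
  by rewrite /partial; apply: eq_bigl => i; rewrite (ltn_ord i).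
have -> : \sum_(i < m | (i < m)%N) c i y * 'D_(b i) f x = \sum_i c i y * 'D_(b i) f x.
  by apply: eq_bigl => i; rewrite (ltn_ord i).
move=> H; rewrite [y + x]addrC; apply: (le_trans H).
have -> : m%:R * (K * `|y| * e') = (m%:R * K * e') * `|y| by ring.
apply: ler_wpM2r => //.
rewrite /e' mulrA ler_pdivrMr // mulrC ler_wpM2l ?ltW // ltrDl //.
Unshelve. all: by end_near. Qed.

Lemma smooth_on_differentiable (O : set V) (f : V -> R) x :
  open O -> smooth_on O f -> O x -> differentiable f x.
Proof.
move=> oO sf Ox.
pose L (y : V) : R := \sum_i c i y * 'D_(b i) f x.
have Llin : linear (L : V -> R^o).
  move=> a y z; rewrite /L scaler_sumr -big_split /=; apply: eq_bigr => i _.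
  by rewrite c_lin mulrDl [_ *: _]mulrA.
pose LM := GRing.isLinear.Build _ _ _ _ _ Llin.
pose LL : {linear V -> R^o} := HB.pack L LM.
have Lc : continuous LL.
  move=> y; apply/cvgrPdist_le => e e0.
  pose C := \sum_i K * `|'D_(b i) f x| + 1.
  have C0 : 0 < C by rewrite ltr_wpDl // sumr_ge0 // => i _; rewrite mulr_ge0 // ltW.
  near=> z; rewrite -[LL y - LL z]linearB /=.
  apply: (@le_trans _ _ (C * `|y - z|)).
    rewrite /L /C; apply: (le_trans (ler_norm_sum _ _ _)).
    rewrite mulrDl mulr_suml; apply: ler_wpDr; first by rewrite mul1r.
    apply: ler_sum => i _; rewrite normrM mulrAC; exact: ler_wpM2r.
  rewrite mulrC -ler_pdivlMr //; near: z; apply: cvgr_dist_le => //.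
  by rewrite divr_gt0.
have approx : f \o shift x = cst (f x) + LL +o_ (0 : V) id.
  apply/eqaddoP => e e0; near=> y.
  rewrite /= -[(f \o _ - _) y]/(f (y + x) - (f x + L y)) opprD addrA.
  by near: y; exact: (smooth_on_linear_approx oO sf Ox e0).
have dL := diff_unique Lc approx.
by apply/diff_locallyP; rewrite dL.
Unshelve. all: by end_near. Qed.

Lemma smooth_on_deriveD (O : set V) (f : V -> R) x (s t : R) (v w : V) :
  open O -> smooth_on O f -> O x ->
  'D_(s *: v + t *: w) f x = s * 'D_v f x + t * 'D_w f x.
Proof.
move=> oO sf Ox; have df := smooth_on_differentiable oO sf Ox.
by rewrite !deriveE // linearD !linearZ.
Qed.

End C1Differentiable.

(** * Vector-valued functions and the chain rule *)

Section MatrixValued.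
Variables (R : realType) (V : normedModType R).

Lemma continuous_sum_at (T : topologicalType) n (F : 'I_n -> T -> R) x :
  (forall i, {for x, continuous (F i)}) -> {for x, continuous (fun y => \sum_i F i y)}.
Proof.
elim: n F => [|n IH] F cF.
  rewrite (_ : (fun y => _) = fun=> 0); first exact: cvg_cst.
  by apply/funext => y; rewrite big_ord0.
rewrite (_ : (fun y => _) = fun y => F ord0 y + \sum_i F (lift ord0 i) y); last first.
  by apply/funext => y; rewrite big_ord_recl.
by apply: continuousD; [exact: cF|exact: (IH (fun i => F (lift ord0 i)))].
Qed.

Lemma derive_coord n (f : V -> 'rV[R]_n) x v j : derivable f x v ->
  'D_v (fun y => f y 0 j) x = 'D_v f x 0 j.
Proof. by move=> df; rewrite [in RHS]derive_mx // mxE. Qed.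

Lemma smooth_on_coord n (O : set V) (f : V -> 'rV[R]_n) j : open O ->
  smooth_on O f -> smooth_on O (fun x => f x 0 j).
Proof.
move=> oO sf k; have {sf} := sf k; elim: k f => [|k IH] f.
  move=> [cf _]; split => //; move: cf; rewrite !continuous_open_subspace // => cf x Ox.
  exact: (continuous_comp (cf _ Ox) (@coord_continuous _ _ _ 0 j _)).
move=> /(Ck_openS _ _ oO)[cf df]; apply/Ck_openS => //; split => [x Ox|v].
  exact: (continuous_comp (cf _ Ox) (@coord_continuous _ _ _ 0 j _)).
have [dfv Cfv] := df v; split => [x Ox|].
  by have /derivable_mxP := dfv x Ox; apply.
by apply: eq_Ck (IH _ Cfv) => x /set_mem Ox; rewrite derive_coord //; exact: dfv.
Qed.

Lemma smooth_on_differentiable_rV n (O : set 'rV[R]_n) (f : 'rV[R]_n -> R) x :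
  open O -> smooth_on O f -> O x -> differentiable f x.
Proof.
apply: (@smooth_on_differentiable _ _ _ (fun i : 'I_n => delta_mx 0 i : 'rV[R]_n)
  (fun i y => y 0 i) 1 ltr01).
- by move=> i a y z; rewrite !mxE.
- by move=> y; rewrite [LHS]row_sum_delta.
- move=> i y; rewrite mul1r [leRHS]/Num.norm /= mx_normrE.
  exact: (le_bigmax _ (fun k : 'I_1 * 'I_n => `|y k.1 k.2|) (0, i)).
Qed.

End MatrixValued.

Section ChainRule.
Variables (R : realType) (V : normedModType R).

Lemma derive_line0 (W : normedModType R) (F : V -> W) x v :
  'D_v F x = 'D_1 (fun h : R => F (h *: v + x)) 0.
Proof.
rewrite /derive; set g1 := fun h => h^-1 *: _; set g2 := fun h => h^-1 *: _.
suff -> : g1 = g2 by [].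
by rewrite funeqE /g1 /g2 => h /=; rewrite addr0 scale0r add0r [_%:A]mulr1.
Qed.

(** The inner map has only a derivative along v, so the problem is restricted to the curve h |-> f
    (h v + x), which is differentiable at 0. *)
Lemma derivable_comp_rV n (f : V -> 'rV[R]_n) (g : 'rV[R]_n -> R) x v :
  derivable f x v -> differentiable g (f x) ->
  derivable (g \o f) x v /\ 'D_v (g \o f) x = 'D_('D_v f x) g (f x).
Proof.
move=> df dg.
pose gam (h : R) := f (h *: v + x).
have gam0 : gam 0 = f x by rewrite /gam scale0r add0r.
have dgam : differentiable gam 0 := (derivable1_diffP gam 0).1 ((derivable1P f x v).1 df).
have dg0 : differentiable g (gam 0) by rewrite gam0.
have dc := differentiable_comp dgam dg0.
split; first exact: ((derivable1P (g \o f) x v).2 ((derivable1_diffP (g \o gam) 0).2 dc)).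
rewrite derive_line0 -[LHS]/('D_1 (g \o gam) 0) (deriveE (1 : R) dc) diff_comp //=.
by rewrite -(deriveE (1 : R) dgam) -derive_line0 -gam0 (deriveE _ dg0).
Qed.

Lemma derive_comp_rV n p (f : V -> 'rV[R]_n) (g : 'rV[R]_n -> 'rV[R]_p) x v :
  derivable f x v -> (forall j, differentiable (fun y => g y 0 j) (f x)) ->
  'D_v (g \o f) x = 'D_('D_v f x) g (f x).
Proof.
move=> df dg.
have dgf : derivable (g \o f) x v.
  apply/derivable_mxP => i j; rewrite ord1.
  by have [] := derivable_comp_rV df (dg j).
have dg' : derivable g (f x) ('D_v f x).
  by apply/derivable_mxP => i j; rewrite ord1; exact: diff_derivable.
apply/rowP => j; transitivity ('D_v (fun y => (g \o f) y 0 j) x).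
  exact: (esym (derive_coord j dgf)).
transitivity ('D_('D_v f x) (fun y => g y 0 j) (f x)); last exact: (derive_coord j dg').
by have [] := derivable_comp_rV df (dg j).
Qed.

End ChainRule.

Section PlaneDerivative.
Variable R : realType.

Lemma plane_basis (y : R * R) : y = \sum_(i < 2) coef y i *: e2 i.
Proof.
rewrite !big_ord_recl big_ord0 addr0; case: y => a b.
by congr pair; rewrite /coef /= /GRing.scale /= ?mulr1 ?mulr0 ?addr0 ?add0r.
Qed.

Lemma coef_le (i : 'I_2) (y : R * R) : `|coef y i| <= 1 * `|y|.
Proof.
rewrite mul1r [leRHS]/Num.norm /= le_max /coef; case: ifP => _; rewrite lexx ?orbT //.
Qed.

Lemma coef_lin (i : 'I_2) (a : R) (y z : R * R) : coef (a *: y + z) i = a * coef y i + coef z i.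
Proof. by rewrite /coef; case: ifP. Qed.

Lemma pairE (s t : R) : (s, t) = s *: e_x + t *: e_y.
Proof. by congr pair; rewrite /= /GRing.scale /= ?mulr1 ?mulr0 ?addr0 ?add0r. Qed.

Lemma derive_plane (O : set (R * R)) (f : R * R -> R) z (s t : R) :
  open O -> smooth_on O f -> O z ->
  'D_(s, t) f z = s * 'D_e_x f z + t * 'D_e_y f z.
Proof.
rewrite pairE.
exact: (smooth_on_deriveD ltr01 coef_lin plane_basis coef_le).
Qed.

Lemma derive_plane_rV n (O : set (R * R)) (f : R * R -> 'rV[R]_n) z (s t : R) :
  open O -> smooth_on O f -> O z ->
  'D_(s, t) f z = s *: 'D_e_x f z + t *: 'D_e_y f z.
Proof.
move=> oO sf Oz; apply/rowP => j.
rewrite [RHS]mxE [X in _ = X + _]mxE [X in _ = _ + X]mxE.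
have df v : derivable f z v by apply: (smooth_on_derivable (O := O)).
have E v : 'D_v f z 0 j = 'D_v (fun y => f y 0 j) z := esym (derive_coord j (df v)).
rewrite (E (s, t)) (E e_x) (E e_y); exact: (derive_plane _ _ oO (smooth_on_coord j oO sf) Oz).
Qed.

End PlaneDerivative.

(** * Differentials of maps into a manifold *)

Section InnerProduct.
Variables (R : realType) (n : nat) (N : topologicalType).
Variable G : riemannian_manifold R n N.

Lemma bilinE (A : 'M[R]_n) (v w : 'rV[R]_n) :
  bilin A v w = \sum_j \sum_i v 0 i * A i j * w 0 j.
Proof.
by rewrite /bilin mxE; apply: eq_bigr => j _; rewrite !mxE mulr_suml.
Qed.

Lemma bilin_pair (A : 'M[R]_n) (v w : 'rV[R]_n) (s t s' t' : R) :
  A^T = A ->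
  bilin A (s *: v + t *: w) (s' *: v + t' *: w) =
  s * s' * bilin A v v + (s * t' + t * s') * bilin A v w + t * t' * bilin A w w.
Proof.
move=> symA.
have bs : bilin A w v = bilin A v w.
  by rewrite /bilin -[in LHS](trmxK (w *m A *m v^T)) mxE !trmx_mul trmxK symA mulmxA.
have -> : bilin A (s *: v + t *: w) (s' *: v + t' *: w) =
    s * s' * bilin A v v + s * t' * bilin A v w + t * s' * bilin A w v + t * t' * bilin A w w.
  rewrite /bilin linearD /= !linearZ /= !mulmxDl !mulmxDr -!scalemxAl -!scalemxAr.
  by rewrite !mxE; ring.
rewrite bs; ring.
Qed.

Lemma open_overlap (c d : chart G) : open (crd c @` (dom c `&` dom d)).
Proof.
have -> : crd c @` (dom c `&` dom d) = (crd c @` dom c) `&` prm c @^-1` dom d.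
  apply/seteqP; split => x /=.
    by move=> [y [yc yd] <-]; split; [exists y|rewrite /= crdK].
  by move=> [[y yc <-]]; rewrite /= crdK // => yd; exists y.
have := @continuous_prm _ _ _ G c; rewrite continuous_open_subspace; last exact: open_ran.
by move=> /(continuous_inP _ (@open_ran _ _ _ G c)); apply; exact: open_dom.
Qed.

Variable u : R * R -> N.
Hypothesis u_cont : continuous u.
Hypothesis u_smooth : forall c : chart G, smooth_on (u @^-1` dom c) (crd c \o u).

Lemma open_preimage_dom (c : chart G) : open (u @^-1` dom c).
Proof. by move/continuousP: u_cont; apply; exact: open_dom. Qed.

(** The transformation law of the metric under the transition map, whose derivative carries du in
    one chart to du in the other by the chain rule. *)
Lemma inner_du_chart (c : chart G) v w z : dom c (u z) ->
  inner_du G u v w z =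
    bilin (metric c ((crd c \o u) z)) ('D_v (crd c \o u) z) ('D_w (crd c \o u) z).
Proof.
move=> cz; rewrite /inner_du; set d := chart_at G (u z).
have dz : dom d (u z) by exact: dom_chart_at.
pose fd := crd d \o u; pose fc := crd c \o u; pose tau := crd c \o prm d.
have xdc : (crd d @` (dom d `&` dom c)) (fd z) by exists (u z).
have tauE : tau (fd z) = fc z by rewrite /tau /fd /comp crdK.
have nd : nbhs z (u @^-1` dom d).
  by apply: open_nbhs_nbhs; split; [exact: open_preimage_dom|exact: dz].
have chain a : 'D_('D_a fd z) tau (fd z) = 'D_a fc z.
  have od := @open_overlap d c; have st := @smooth_transition _ _ _ G d c.
  transitivity ('D_a (tau \o fd) z).
    apply/esym/derive_comp_rV.
      apply: (smooth_on_derivable (O := u @^-1` dom d)).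
      + exact: open_preimage_dom.
      + exact: u_smooth.
      + exact: dz.
    move=> j; apply: (smooth_on_differentiable_rV od); last exact: xdc.
    exact: (smooth_on_coord j od st).
  by apply: near_eq_derive; apply: filterS nd => z' dz'; rewrite /tau /fd /comp crdK.
transitivity (bilin (metric c (tau (fd z))) ('D_('D_v fd z) tau (fd z))
   ('D_('D_w fd z) tau (fd z))); first exact: (metric_transition _ _ xdc).
by rewrite (chain v) (chain w) tauE.
Qed.

(** [chart_at] may jump as z moves; near z the chart around u z is kept fixed. *)
Lemma inner_du_continuous v w : continuous (inner_du G u v w).
Proof.
move=> z; pose c := chart_at G (u z); have cz : dom c (u z) by exact: dom_chart_at.
have oc := @open_preimage_dom c; have sc := @u_smooth c.
have nc : nbhs z (u @^-1` dom c) by apply: open_nbhs_nbhs; split; [exact: oc|exact: cz].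
pose f := crd c \o u.
suff cf : {for z, continuous (fun z' => bilin (metric c (f z')) ('D_v f z') ('D_w f z'))}.
  rewrite /continuous_at (inner_du_chart v w cz); apply: cvg_trans cf.
  by apply: near_eq_cvg; apply: filterS nc => z' cz'; rewrite (inner_du_chart v w cz').
rewrite (_ : (fun z' => _) = fun z' => \sum_j \sum_i 'D_v f z' 0 i * metric c (f z') i j * 'D_w f z' 0 j); last first.
  by apply/funext => z'; rewrite bilinE.
have fc : {for z, continuous f} by exact: (smooth_on_continuous oc sc).
have Dc a j : {for z, continuous (fun z' => 'D_a f z' 0 j)}.
  apply: (smooth_on_continuous oc) => //; apply: smooth_on_coord => //.
  exact: smooth_on_derive.
have mc i j : {for z, continuous (fun z' => metric c (f z') i j)}.
  apply: (@continuous_comp _ _ _ f (fun x => metric c x i j) z fc).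
  apply: (smooth_on_continuous (@open_ran _ _ _ G c) (@smooth_metric _ _ _ G c i j)).
  by exists (u z).
apply: continuous_sum_at => j; apply: continuous_sum_at => i.
by apply: continuousM; [apply: continuousM; [exact: Dc|exact: mc]|exact: Dc].
Qed.

Lemma inner_du_pair s t s' t' z :
  inner_du G u (s, t) (s', t') z =
  s * s' * inner_du G u e_x e_x z + (s * t' + t * s') * inner_du G u e_x e_y z
  + t * t' * inner_du G u e_y e_y z.
Proof.
rewrite /inner_du; set c := chart_at G (u z); have cz : dom c (u z) by exact: dom_chart_at.
have oc := @open_preimage_dom c; have sc := @u_smooth c.
rewrite [in LHS](derive_plane_rV s t oc sc cz) (derive_plane_rV s' t' oc sc cz) bilin_pair //.
by apply: (@Defs.metric_sym _ _ _ G c); exists (u z).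
Qed.

End InnerProduct.

Section LinearChange.
Variables (R : realType) (n : nat) (N : topologicalType).
Variable G : riemannian_manifold R n N.

Lemma Lmap_lin (al be : R) h (v z : R * R) :
  Lmap al be (h *: v + z) = h *: Lmap al be v + Lmap al be z.
Proof.
case: v z => [v1 v2] [z1 z2]; rewrite !LmapE; congr pair; rewrite /= /GRing.scale /=; ring.
Qed.

(** As L is linear, the difference quotients on both sides coincide, and u z = U (L z) selects the
    same chart. *)
Lemma inner_du_Lmap (al be : R) (u U : R * R -> N) v w z :
  (forall z, u z = U (Lmap al be z)) ->
  inner_du G u v w z = inner_du G U (Lmap al be v) (Lmap al be w) (Lmap al be z).
Proof.
move=> uU; rewrite /inner_du uU; set c := chart_at _ _.
have D a : 'D_a (crd c \o u) z = 'D_(Lmap al be a) (crd c \o U) (Lmap al be z).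
  rewrite /derive; set g1 := fun h => h^-1 *: _; set g2 := fun h => h^-1 *: _.
  suff -> : g1 = g2 by [].
  by apply/funext => h; rewrite /g1 /g2 /= !uU Lmap_lin.
by rewrite !D /= uU.
Qed.

(** The maps L are upper triangular of determinant 1, a class closed under inversion. *)
Lemma LmapK (al be : R) : be != 0 -> cancel (Lmap (- al) be^-1) (Lmap al be).
Proof.
move=> be0 [x y]; rewrite !LmapE /= invrK; congr pair; field => //.
Qed.

End LinearChange.

(** * Complex coordinates and quadratic differentials *)

Section Conformal.
Variable R : realType.

Lemma sum2E (W : nmodType) (F : 'I_2 -> W) : \sum_i F i = F 0 + F 1.
Proof.
rewrite !big_ord_recl big_ord0 addr0; congr (_ + F _); exact: val_inj.
Qed.

Lemma ord2P (P : 'I_2 -> Prop) : P 0 -> P 1 -> forall i, P i.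
Proof.
move=> P0 P1 [[|[|//]] h]; [have -> : Ordinal h = 0 by exact: val_inj|];
  [by []|have -> : Ordinal h = 1 by exact: val_inj]; by [].
Qed.

Lemma det22 (M : 'M[R]_2) : \det M = M 0 0 * M 1 1 - M 0 1 * M 1 0.
Proof.
rewrite (expand_det_row _ 0) sum2E /cofactor !det_mx11 !mxE /=.
rewrite (_ : lift 0 0 = 1 :> 'I_2); last exact: val_inj.
rewrite (_ : lift 1 0 = 0 :> 'I_2); last exact: val_inj.
by rewrite /= expr0 expr1 mul1r mulN1r mulrN.
Qed.

Lemma invmx22 (M : 'M[R]_2) : \det M != 0 ->
  [/\ invmx M 0 0 = M 1 1 / \det M, invmx M 0 1 = - M 0 1 / \det M,
      invmx M 1 0 = - M 1 0 / \det M & invmx M 1 1 = M 0 0 / \det M].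
Proof.
move=> d0; pose X : 'M[R]_2 := \matrix_(i, j)
  (if i == 0 then if j == 0 then M 1 1 / \det M else - M 0 1 / \det M
   else if j == 0 then - M 1 0 / \det M else M 0 0 / \det M).
have MX : M *m X = 1%:M.
  by apply/matrixP; apply: ord2P; apply: ord2P; rewrite !mxE sum2E !mxE /=;
    move: d0; rewrite det22 => d0; field.
have uM : M \in unitmx by rewrite unitmxE unitfE.
have -> : invmx M = X by rewrite -[X](mulKmx uM) MX mulmx1.
by rewrite !mxE.
Qed.

Lemma gdotE (g : R * R -> 'M[R]_2) (z v v' : R * R) : gdot g z v v' =
  g z 0 0 * v.1 * v'.1 + g z 0 1 * v.1 * v'.2 + g z 1 0 * v.2 * v'.1 + g z 1 1 * v.2 * v'.2.
Proof. by rewrite /gdot !sum2E /coef /=; ring. Qed.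

Lemma metric_entries (g : R * R -> 'M[R]_2) z : (g z)^T = g z -> (forall v, v != 0 -> 0 < bilin (g z) v v) ->
  [/\ 0 < g z 0 0, g z 1 0 = g z 0 1 & 0 < \det (g z)].
Proof.
move=> gs gp; have g10 : g z 1 0 = g z 0 1 by rewrite -[in RHS]gs mxE.
have gE (a b : R) : bilin (g z) (\row_j (if j == 0 then a else b)) (\row_j (if j == 0 then a else b)) =
    g z 0 0 * a * a + g z 0 1 * a * b *+ 2 + g z 1 1 * b * b.
  by rewrite bilinE !sum2E !mxE /= g10; ring.
have row_neq0 (a b : R) : (a != 0) || (b != 0) -> (\row_(j < 2) (if j == 0 then a else b)) != 0.
  move=> ab; apply/eqP => /rowP E; have := E 0; have := E 1; rewrite !mxE /= => b0 a0.
  by move: ab; rewrite a0 b0 eqxx.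
have E0 : 0 < g z 0 0.
  have := gp _ (row_neq0 1 0 _); rewrite gE oner_neq0 => /(_ isT); lra.
split => //; rewrite det22 g10.
(* On the vector (- F, E) the metric takes the value E det g. *)
have := gp _ (row_neq0 (- g z 0 1) (g z 0 0) _); rewrite gE (gt_eqF E0) orbT => /(_ isT).
set E := g z 0 0 in E0 *; set F := g z 0 1; set H := g z 1 1.
rewrite (_ : _ + _ = E * (E * H - F * F)); last by ring.
by rewrite pmulr_rgt0.
Qed.

Lemma det_jac (w : R * R -> R * R) z : \det (jac w z) =
  ('D_(e2 0) w z).1 * ('D_(e2 1) w z).2 - ('D_(e2 1) w z).1 * ('D_(e2 0) w z).2.
Proof. by rewrite det22 !mxE /coef /=. Qed.

Lemma dpE (w : R * R -> R * R) z : 0 < \det (jac w z) ->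
  dp w z = (('D_(e2 1) w z).2 / \det (jac w z), - ('D_(e2 0) w z).2 / \det (jac w z)).
Proof.
move=> dj; have dj0 : \det (jac w z) != 0 by rewrite gt_eqF.
have [i00 i01 i10 i11] := invmx22 dj0.
by rewrite /dp /coord_vec i00 i10 !mxE /coef /=.
Qed.

Lemma dqE (w : R * R -> R * R) z : 0 < \det (jac w z) ->
  dq w z = (- ('D_(e2 1) w z).1 / \det (jac w z), ('D_(e2 0) w z).1 / \det (jac w z)).
Proof.
move=> dj; have dj0 : \det (jac w z) != 0 by rewrite gt_eqF.
have [i00 i01 i10 i11] := invmx22 dj0.
by rewrite /dq /coord_vec i01 i11 !mxE /coef /=.
Qed.

(* (E w_y - F w_x)^2 = - D^2 w_x^2; the orientation selects the root i D w_x. *)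
Lemma conformal_dw_algebra (E F H D px py qx qy : R) :
  0 < E -> 0 < D -> D ^+ 2 = E * H - F * F -> 0 < px * qy - py * qx ->
  E * qy * qy - F * qy * qx *+ 2 + H * qx * qx = E * py * py - F * py * px *+ 2 + H * px * px ->
  - E * qy * py + F * qy * px + F * qx * py - H * qx * px = 0 ->
  E * py = F * px - D * qx /\ E * qy = F * qx + D * px.
Proof.
move=> E0 D0 D2 J0 c1 c2.
(* X + i Y is E w_y - F w_x; [XY1] and [XY2] are the two parts of the equation for its square, and
   [YX] is the orientation condition multiplied by E. *)
pose X := E * py - F * px; pose Y := E * qy - F * qx.
have XY1 : X ^+ 2 - Y ^+ 2 = - D ^+ 2 * (px ^+ 2 - qx ^+ 2).
  apply/eqP; rewrite -subr_eq0 /X /Y D2.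
  rewrite (_ : _ - _ = - E * ((E * qy * qy - F * qy * qx *+ 2 + H * qx * qx) -
    (E * py * py - F * py * px *+ 2 + H * px * px))); last by ring.
  by rewrite c1 subrr mulr0.
have XY2 : X * Y = - D ^+ 2 * (px * qx).
  apply/eqP; rewrite -subr_eq0 /X /Y D2.
  rewrite (_ : _ - _ = - E * (- E * qy * py + F * qy * px + F * qx * py - H * qx * px)); last by ring.
  by rewrite c2 mulr0.
have YX : 0 < px * Y - qx * X.
  by rewrite (_ : _ - _ = E * (px * qy - py * qx)) ?mulr_gt0 // /X /Y; ring.
(* |X + i Y - i D (px + i qx)|^2 |X + i Y + i D (px + i qx)|^2 = 0 *)
have prod0 : ((X + D * qx) ^+ 2 + (Y - D * px) ^+ 2) * ((X - D * qx) ^+ 2 + (Y + D * px) ^+ 2) = 0.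
  rewrite (_ : _ * _ = (X ^+ 2 - Y ^+ 2 + D ^+ 2 * (px ^+ 2 - qx ^+ 2)) ^+ 2 +
    4 * (X * Y + D ^+ 2 * (px * qx)) ^+ 2); last by ring.
  by rewrite XY1 XY2; ring.
have : (X + D * qx) ^+ 2 + (Y - D * px) ^+ 2 = 0.
  (* The other factor would give X + i Y = - i D w_x, which contradicts the orientation [YX]. *)
  move/eqP: prod0; rewrite mulf_eq0 => /orP[/eqP //|]; rewrite paddr_eq0 ?sqr_ge0 //.
  rewrite !sqrf_eq0 => /andP[/eqP x0 /eqP y0].
  have XE : X = D * qx by move: x0; lra.
  have YE : Y = - (D * px) by move: y0; lra.
  have : D * (px ^+ 2 + qx ^+ 2) < 0.
    by move: YX; rewrite XE YE (_ : px * _ - _ = - (D * (px ^+ 2 + qx ^+ 2))) ?oppr_gt0 //; ring.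
  by rewrite pmulr_rlt0 // ltNge addr_ge0 ?sqr_ge0.
move=> /eqP; rewrite paddr_eq0 ?sqr_ge0 // !sqrf_eq0 => /andP[/eqP x0 /eqP y0].
by move: x0 y0; rewrite /X /Y; split; lra.
Qed.

(** Conformality is given on the coordinate vectors, the columns of the inverse Jacobian;
    multiplication by J^2 clears the denominators. *)
Lemma conformal_dw_frame (E F H D px py qx qy J : R) :
  0 < E -> 0 < D -> D ^+ 2 = E * H - F * F -> J = px * qy - py * qx -> 0 < J ->
  E * (qy / J) * (qy / J) + F * (qy / J) * (- qx / J) + F * (- qx / J) * (qy / J)
    + H * (- qx / J) * (- qx / J) =
  E * (- py / J) * (- py / J) + F * (- py / J) * (px / J) + F * (px / J) * (- py / J)
    + H * (px / J) * (px / J) ->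
  E * (qy / J) * (- py / J) + F * (qy / J) * (px / J) + F * (- qx / J) * (- py / J)
    + H * (- qx / J) * (px / J) = 0 ->
  E * py = F * px - D * qx /\ E * qy = F * qx + D * px.
Proof.
move=> E0 D0 D2 JE J0 c1 c2; have Jn0 : J != 0 by rewrite gt_eqF.
apply: (conformal_dw_algebra E0 D0 D2); first by rewrite -JE.
  have /(congr1 (fun x => x * J ^+ 2)) := c1.
  set l := _ * _ ^+ 2; set r := _ * _ ^+ 2 => lr.
  have -> : E * qy * qy - F * qy * qx *+ 2 + H * qx * qx = l by rewrite /l; field.
  by rewrite lr /r; field.
have /(congr1 (fun x => x * J ^+ 2)) := c2; rewrite mul0r => <-.
by field.
Qed.

(** The form with a general D = sqrt (det g) serves the trace identity, which comes before det g = 1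
    is known. *)
Lemma conformal_dw (g : R * R -> 'M[R]_2) O w z (D : R) : complex_coord g O w -> O z ->
  0 < g z 0 0 -> g z 1 0 = g z 0 1 -> 0 < D -> D ^+ 2 = \det (g z) ->
  g z 0 0 * ('D_(e2 1) w z).1 = g z 0 1 * ('D_(e2 0) w z).1 - D * ('D_(e2 0) w z).2 /\
  g z 0 0 * ('D_(e2 1) w z).2 = g z 0 1 * ('D_(e2 0) w z).2 + D * ('D_(e2 0) w z).1.
Proof.
move=> [oO _ _ dj conf] Oz E0 g10 D0; rewrite det22 g10 => D2.
have j0 := dj z Oz; have [c1 c2] := conf z Oz.
move: c1 c2; rewrite !gdotE (dpE j0) (dqE j0) g10 => c1 c2.
exact: (conformal_dw_frame E0 D0 D2 (det_jac w z) j0 c1 c2).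
Qed.

End Conformal.

(** * Entries of quadratic differentials in the frame (dx, dy) *)

Section QuadraticDifferentials.
Variable R : realType.
Implicit Types (g : R * R -> 'M[R]_2) (w : R * R -> R * R) (O : set (R * R)).

Lemma complex_ext (x y : R[i]) : complex.Re x = complex.Re y -> complex.Im x = complex.Im y -> x = y.
Proof. by case: x y => [a b] [c d] /= -> ->. Qed.

(* For a metric of determinant 1 the coordinates satisfy w_y = frame_ratio * w_x. *)
Definition frame_ratio g (z : R * R) : R[i] := ((g z 0 1 / g z 0 0) +i* (g z 0 0)^-1)%C.

(** The components of dw divided by w_x. They depend on g alone, so for det g = 1 a differential psi
    dw^2 is determined by its xx entry. *)
Definition mupow g (z : R * R) (i : 'I_2) : R[i] := if i == 0 then 1 else frame_ratio g z.

Lemma dw_mu g O w z i : complex_coord g O w -> O z ->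
  0 < g z 0 0 -> g z 1 0 = g z 0 1 -> \det (g z) = 1 ->
  dw w z i = dw w z 0 * mupow g z i.
Proof.
move=> cw Oz E0 g10 d1; rewrite /mupow; move: i; apply: ord2P; first by rewrite mulr1.
have D2 : 1 ^+ 2 = \det (g z) by rewrite d1 expr1n.
have [e1 e2'] := conformal_dw cw Oz E0 g10 ltr01 D2.
move: e1 e2'; rewrite /dw /frame_ratio /=.
case: ('D_(e2 1) w z) => py qy; case: ('D_(e2 0) w z) => px qx /= e1 e2'.
have En0 : g z 0 0 != 0 by rewrite gt_eqF.
apply: complex_ext => /=; apply: (mulfI En0).
  by rewrite e1; field.
by rewrite e2'; field.
Qed.

Lemma qdiff_mu g O w z Psi psi i j : complex_coord g O w -> O z ->
  0 < g z 0 0 -> g z 1 0 = g z 0 1 -> \det (g z) = 1 -> qdiff_in_coord O w Psi psi ->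
  Psi z i j = Psi z 0 0 * mupow g z i * mupow g z j.
Proof.
move=> cw Oz E0 g10 d1 PE; rewrite !PE //.
rewrite (dw_mu i cw Oz E0 g10 d1) (dw_mu j cw Oz E0 g10 d1); ring.
Qed.

(** The left side phi w_x^2 is the complex bilinear extension of the form with entries A, B, C,
    evaluated twice on w_x (d_p - i d_q). That vector equals i (F - i, - E), in which w has
    disappeared. *)
Lemma hopf_algebra (E F px py qx qy J A B C : R) :
  0 < E -> E * py = F * px - 1 * qx -> E * qy = F * qx + 1 * px ->
  J = px * qy - py * qx -> 0 < J ->
  let dpdp := (qy / J) * (qy / J) * A + ((qy / J) * (- qx / J) + (- qx / J) * (qy / J)) * B
    + (- qx / J) * (- qx / J) * C in
  let dqdq := (- py / J) * (- py / J) * A + ((- py / J) * (px / J) + (px / J) * (- py / J)) * B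
    + (px / J) * (px / J) * C in
  let dpdq := (qy / J) * (- py / J) * A + ((qy / J) * (px / J) + (- qx / J) * (- py / J)) * B
    + (- qx / J) * (px / J) * C in
  ((dpdp - dqdq) +i* (- 2 * dpdq))%C * (px +i* qx)%C * (px +i* qx)%C =
  (- ((F ^+ 2 - 1) * A - 2 * E * F * B + E ^+ 2 * C) +i* (2 * (F * A - E * B)))%C.
Proof.
move=> E0 e1 e2' JE J0; have En0 : E != 0 by rewrite gt_eqF.
have pyE : py = (F * px - qx) / E by apply: (mulfI En0); rewrite e1; field.
have qyE : qy = (F * qx + px) / E by apply: (mulfI En0); rewrite e2'; field.
have JE' : J = (px ^+ 2 + qx ^+ 2) / E by rewrite JE pyE qyE; field.
have n0 : px ^+ 2 + qx ^+ 2 != 0.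
  by apply: contraTneq J0 => n0; rewrite JE' n0 mul0r ltxx.
rewrite pyE qyE JE' /=; apply: complex_ext => /=; field; by rewrite ?n0 ?En0.
Qed.

Lemma hopf_entry n (N : topologicalType) (G : riemannian_manifold R n N) g
    (u : R * R -> N) Phi z :
  continuous u -> (forall c : chart G, smooth_on (u @^-1` dom c) (crd c \o u)) ->
  0 < g z 0 0 -> g z 1 0 = g z 0 1 -> \det (g z) = 1 -> is_hopf G g u Phi ->
  (forall i j, Phi z i j = Phi z 0 0 * mupow g z i * mupow g z j) /\
  Phi z 0 0 = (- ((g z 0 1 ^+ 2 - 1) * inner_du G u e_x e_x z
       - 2 * g z 0 0 * g z 0 1 * inner_du G u e_x e_y z + g z 0 0 ^+ 2 * inner_du G u e_y e_y z)
     +i* (2 * (g z 0 1 * inner_du G u e_x e_x z - g z 0 0 * inner_du G u e_x e_y z)))%C.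
Proof.
move=> uc us E0 g10 d1 [_ HP]; have [Q [w [cw Oz PE]]] := HP z; split => [i j|].
  exact: (qdiff_mu i j cw Oz E0 g10 d1 PE).
rewrite PE //; have [oO sO injw dj conf] := cw; have j0 := dj z Oz.
have D2 : 1 ^+ 2 = \det (g z) by rewrite d1 expr1n.
have [e1 e2'] := conformal_dw cw Oz E0 g10 ltr01 D2.
have ip s1 t1 s2 t2 := inner_du_pair uc us s1 t1 s2 t2 z.
case: (dp w z) (dpE j0) => [s1 t1]; case: (dq w z) (dqE j0) => [s2 t2].
rewrite (ip s1 t1 s1 t1) (ip s2 t2 s2 t2) (ip s1 t1 s2 t2) => -[-> ->] [-> ->].
exact: (hopf_algebra _ _ _ E0 e1 e2' (det_jac w z) j0).
Qed.

Lemma holomorphic_qdiff_mu g Psi z : 0 < g z 0 0 -> g z 1 0 = g z 0 1 -> \det (g z) = 1 ->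
  holomorphic_qdiff g Psi -> forall i j, Psi z i j = Psi z 0 0 * mupow g z i * mupow g z j.
Proof.
move=> E0 g10 d1 [_ HP] i j; have [Q [w [psi [cw Oz PE _]]]] := HP z.
exact: (qdiff_mu i j cw Oz E0 g10 d1 PE).
Qed.

(* g^(ik) m_i conj(m_k) = 2 / E for m = mupow *)
Lemma qdiff_inner_mu g (A B : qdiff R) z :
  0 < g z 0 0 -> g z 1 0 = g z 0 1 -> \det (g z) = 1 ->
  (forall i j, A z i j = A z 0 0 * mupow g z i * mupow g z j) ->
  (forall i j, B z i j = mupow g z i * mupow g z j) ->
  qdiff_inner g A B z = ((2 / g z 0 0) ^+ 2)%:C%C * A z 0 0.
Proof.
move=> E0 g10 d1 hA hB; have En0 : g z 0 0 != 0 by rewrite gt_eqF.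
have dn0 : \det (g z) != 0 by rewrite d1 oner_neq0.
have [i00 i01 i10 i11] := invmx22 dn0; rewrite d1 !divr1 in i00 i01 i10 i11.
pose S := \sum_i \sum_k (invmx (g z) i k)%:C%C * mupow g z i * conjc (mupow g z k).
have SE : S = (2 / g z 0 0)%:C%C.
  rewrite /S !sum2E i00 i01 i10 i11 g10 /mupow /=.
  have : g z 1 1 = (1 + g z 0 1 ^+ 2) / g z 0 0.
    by apply: (mulfI En0); move: d1; rewrite det22 g10 => d1; rewrite -d1; field.
  by move=> ->; rewrite /frame_ratio; apply: complex_ext => /=; field.
transitivity (S * S * A z 0 0); last by rewrite SE -rmorphM -expr2.
rewrite /qdiff_inner /S !sum2E !hB (hA 0 1) (hA 1 0) (hA 1 1) !rmorphM.
have -> : mupow g z 0 = 1 by [].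
rewrite rmorph1; move: (mupow g z 1) (A z 0 0) => m a.
move: (invmx _ 0 0) (invmx _ 0 1) (invmx _ 1 0) (invmx _ 1 1) => a00 a01 a10 a11.
ring.
Qed.

End QuadraticDifferentials.

(** * Time derivatives that are one-sided at the initial time *)

Section TimeDerivative.
Variable R : realType.
Implicit Types (I : set R) (f g : R -> R) (t : R).

Definition time_filter I t : set_system R := within [set h : R | I (t + h)] 0^'.

Global Instance time_filter_filter I t : Filter (time_filter I t).
Proof. exact: within_filter. Qed.

(** Every t in [0, T[ has later times in the interval, so limits along admissible increments are
    unique. *)
Lemma time_filter_proper (T : \bar R) t : time_interval T t ->
  ProperFilter (time_filter (time_interval T) t).
Proof.
move=> [t0 tT]; apply: Build_ProperFilter; rewrite /time_filter /within /=.
move=> /nbhs_ballP[e /= e0 eP].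
have [d d0 dT] : exists2 d : R, 0 < d & ((t + d)%:E < T)%E.
  case: T tT {eP} => [r| |] //=; last by exists 1; rewrite ?ltry.
  rewrite lte_fin => tr; exists ((r - t) / 2); first by rewrite divr_gt0 // subr_gt0.
  by rewrite lte_fin; lra.
pose h := Num.min (e / 2) d; have h0 : 0 < h by rewrite lt_min d0 divr_gt0.
have hb : ball (0 : R) e h.
  rewrite -ball_normE /= sub0r normrN gtr0_norm //.
  have : h <= e / 2 by rewrite ge_min lexx.
  lra.
apply: (eP h hb); first by rewrite gt_eqF.
split; first by rewrite addr_ge0 // ltW.
by apply: le_lt_trans dT; rewrite lee_fin lerD2l ge_min lexx orbT.
Qed.

Lemma time_filter_neq0 I t : \forall h \near time_filter I t, h != 0.
Proof.
rewrite /time_filter near_withinE; near=> h => _; near: h; exact: nbhs_dnbhs_neq.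
Unshelve. all: by end_near. Qed.

Lemma time_filter_in I t : \forall h \near time_filter I t, I (t + h).
Proof. by rewrite /time_filter near_withinE; near=> h. Unshelve. all: by end_near. Qed.

Lemma time_filter_cvg0 I t : h @[h --> time_filter I t] --> (0 : R).
Proof. by apply: cvg_within_filter; apply: cvg_within_filter; exact: cvg_id. Qed.

Lemma within_time_cvg I f t : {within I, continuous f} -> I t ->
  f (t + h) @[h --> time_filter I t] --> f t.
Proof.
move=> /subspace_continuousP cf It; apply: cvg_trans (cf t It) => P.
rewrite /fmap /within /= => HP.
have c0 : t + h @[h --> (0 : R)] --> t.
  have c1 : {for 0, continuous (fun h : R => t + h)}.
    by apply: continuousD; [exact: cvg_cst|exact: cvg_id].
  exact: (eq_ind (t + 0) (fun y => t + h @[h --> (0 : R)] --> y) c1 t (addr0 t)).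
have H0 : \forall h \near (0 : R), I (t + h) -> P (f (t + h)) by exact: (c0 _ HP).
exact: (nbhs_dnbhs H0).
Qed.

Lemma time_deriv_cvg I f t l : time_deriv I f t l ->
  f (t + h) @[h --> time_filter I t] --> f t.
Proof.
move=> df; have : f t + h * (h^-1 *: (f (t + h) - f t)) @[h --> time_filter I t] --> f t + 0 * l.
  apply: cvgD; first exact: cvg_cst.
  by apply: cvgM; [exact: time_filter_cvg0|exact: df].
rewrite mul0r addr0; apply: cvg_trans; apply: near_eq_cvg.
near=> h; have h0 : h != 0 by near: h; exact: time_filter_neq0.
by rewrite /GRing.scale /=; field.
Unshelve. all: by end_near. Qed.

Lemma time_deriv_unique (T : \bar R) f t l l' : time_interval T t ->
  time_deriv (time_interval T) f t l -> time_deriv (time_interval T) f t l' -> l = l'.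
Proof.
by move=> /time_filter_proper pF dl dl'; apply: (cvg_unique _ dl dl'); exact: norm_hausdorff.
Qed.

Lemma eq_time_deriv I f g t l : (forall s, I s -> f s = g s) -> I t ->
  time_deriv I f t l -> time_deriv I g t l.
Proof.
move=> fg It; apply: cvg_trans; apply: near_eq_cvg.
near=> h; have Ih : I (t + h) by near: h; exact: time_filter_in.
by rewrite !fg.
Unshelve. all: by end_near. Qed.

Lemma time_derivM I f g t l m : time_deriv I f t l -> time_deriv I g t m ->
  time_deriv I (fun s => f s * g s) t (l * g t + f t * m).
Proof.
move=> df dg; have : (h^-1 *: (f (t + h) - f t)) * g (t + h) + f t * (h^-1 *: (g (t + h) - g t))
    @[h --> time_filter I t] --> l * g t + f t * m.
  by apply: cvgD; apply: cvgM; [exact: df|exact: time_deriv_cvg dg|exact: cvg_cst|exact: dg].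
apply: cvg_trans; apply: near_eq_cvg; near=> h.
rewrite /GRing.scale /=; ring.
Unshelve. all: by end_near. Qed.

Lemma time_derivV I f t l : f t != 0 -> time_deriv I f t l ->
  time_deriv I (fun s => (f s)^-1) t (- l / f t ^+ 2).
Proof.
move=> ft0 df; have cf := time_deriv_cvg df.
have : - (h^-1 *: (f (t + h) - f t)) * ((f (t + h))^-1 * (f t)^-1)
    @[h --> time_filter I t] --> - l * ((f t)^-1 * (f t)^-1).
  apply: cvgM; first exact: cvgN.
  by apply: cvgM; [exact: cvgV|exact: cvg_cst].
rewrite -invfM -expr2; apply: cvg_trans; apply: near_eq_cvg; near=> h.
have fh0 : f (t + h) != 0.
  near: h; have := cvgr_neq0 _ cf ft0; exact.
have h0 : h != 0 by near: h; exact: time_filter_neq0.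
by rewrite /GRing.scale /=; field; rewrite ft0 fh0 h0.
Unshelve. all: by end_near. Qed.

(** The difference of squares factors, and continuity of f gives the limit of f (t + h) + f t. In
    this way the derivative of beta comes from that of beta^2. *)
Lemma time_deriv_root I f t l : {within I, continuous f} -> I t -> f t != 0 ->
  time_deriv I (fun s => f s ^+ 2) t l -> time_deriv I f t (l / (2 * f t)).
Proof.
move=> cf It ft0 df; have cft := within_time_cvg cf It.
have f20 : f t + f t != 0 by rewrite -mulr2n mulrn_eq0 negb_or.
have cs : f (t + h) + f t @[h --> time_filter I t] --> f t + f t.
  by apply: cvgD; [exact: cft|exact: cvg_cst].
have : (h^-1 *: (f (t + h) ^+ 2 - f t ^+ 2)) * (f (t + h) + f t)^-1
    @[h --> time_filter I t] --> l * (f t + f t)^-1.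
  by apply: cvgM; [exact: df|exact: cvgV].
rewrite (_ : 2 * f t = f t + f t); last by ring.
apply: cvg_trans; apply: near_eq_cvg; near=> h.
have fh0 : f (t + h) + f t != 0.
  near: h; have := cvgr_neq0 _ cs f20; exact.
have h0 : h != 0 by near: h; exact: time_filter_neq0.
by rewrite /GRing.scale /=; field; rewrite h0 fh0.
Unshelve. all: by end_near. Qed.

End TimeDerivative.

(** * The family of flat metrics *)

Section FlatFamily.
Variable R : realType.
Implicit Types (al be : R).

Lemma Lmap_e2 al be : Lmap al be (e2 0) = (be^-1, 0) /\ Lmap al be (e2 1) = (al, be).
Proof. by rewrite !LmapE /=; split; congr pair; ring. Qed.

Lemma Lmetric_entries al be z :
  [/\ Lmetric al be z 0 0 = be^-1 ^+ 2, Lmetric al be z 0 1 = al / be,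
      Lmetric al be z 1 0 = al / be & Lmetric al be z 1 1 = al ^+ 2 + be ^+ 2].
Proof.
have [L0 L1] := Lmap_e2 al be.
by rewrite !mxE !sum2E L0 L1 /coef /=; split; ring.
Qed.

Lemma Lmetric_det al be z : be != 0 -> \det (Lmetric al be z) = 1.
Proof. by move=> be0; rewrite det22; have [-> -> -> ->] := Lmetric_entries al be z; field. Qed.

(** The ratio is the modulus a + i b of the torus. *)
Lemma Lmetric_mu al be z : be != 0 -> frame_ratio (Lmetric al be) z = (al * be +i* be ^+ 2)%C.
Proof.
move=> be0; rewrite /frame_ratio; have [-> -> _ _] := Lmetric_entries al be z.
by apply: complex_ext => /=; field.
Qed.

Lemma Lmetric00_gt0 al be z : be != 0 -> 0 < Lmetric al be z 0 0.
Proof.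
move=> be0; have [-> _ _ _] := Lmetric_entries al be z.
by rewrite exprn_even_gt0 //= invr_eq0.
Qed.

Lemma Lmetric_sym al be z : Lmetric al be z 1 0 = Lmetric al be z 0 1.
Proof. by have [_ -> -> _] := Lmetric_entries al be z. Qed.

Lemma Lmap_linear al be : linear (Lmap al be).
Proof. by move=> a y z; rewrite Lmap_lin. Qed.

Definition Lmap_lin_map al be : {linear (R * R)%type -> (R * R)%type} :=
  HB.pack (Lmap al be) (GRing.isLinear.Build _ _ _ _ _ (Lmap_linear al be)).

Lemma derive_Lmap al be v z : 'D_v (Lmap al be) z = Lmap al be v.
Proof.
have cL : continuous (Lmap_lin_map al be) by exact: Lmap_continuous.
have dL := linear_differentiable (z : R * R) cL.
by rewrite -[Lmap al be]/(Lmap_lin_map al be : _ -> _) deriveE // diff_lin.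
Qed.

Lemma smooth_Lmap al be : smooth_on setT (Lmap al be).
Proof.
apply: (@smooth_on_linear _ _ _ setT (Lmap_lin_map al be)); first exact: openT.
exact: Lmap_continuous.
Qed.

Lemma Lmap_complex_coord al be : be != 0 ->
  complex_coord (Lmetric al be) setT (Lmap al be).
Proof.
move=> be0; have [L0 L1] := Lmap_e2 al be.
have dj z : \det (jac (Lmap al be) z) = 1.
  by rewrite det_jac !derive_Lmap L0 L1 /=; field.
have dj0 z : 0 < \det (jac (Lmap al be) z) by rewrite dj.
split; [exact: openT|exact: smooth_Lmap| |by []|].
  move=> [x y] [x' y'] _ _; rewrite !LmapE /= => -[e1 /(mulfI be0) e2'].
  move: e1; rewrite e2' => /addrI /mulfI e1.
  by rewrite e1 // invr_eq0.
move=> z _; rewrite !gdotE (dpE (dj0 z)) (dqE (dj0 z)) dj !derive_Lmap L0 L1 /=.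
by have [-> -> -> ->] := Lmetric_entries al be z; split; field.
Qed.

Lemma dw_Lmap al be z i : dw (Lmap al be) z i = ((Lmap al be (e2 i)).1 +i* (Lmap al be (e2 i)).2)%C.
Proof. by rewrite /dw derive_Lmap. Qed.

Definition parallel_qdiff al be (c : R[i]) : qdiff R := fun z =>
  \matrix_(i, j) (c * dw (Lmap al be) z i * dw (Lmap al be) z j).

Lemma parallel_qdiffE al be c z i j : parallel_qdiff al be c z i j =
  c * ((Lmap al be (e2 i)).1 +i* (Lmap al be (e2 i)).2)%C
    * ((Lmap al be (e2 j)).1 +i* (Lmap al be (e2 j)).2)%C.
Proof. by rewrite /parallel_qdiff mxE (dw_Lmap al be z i) (dw_Lmap al be z j). Qed.

Lemma parallel_holomorphic al be (c : R[i]) : be != 0 ->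
  holomorphic_qdiff (Lmetric al be) (parallel_qdiff al be c).
Proof.
move=> be0; split.
  move=> i z; apply/matrixP => k l.
  exact: (etrans (parallel_qdiffE al be c (z + e2 i) k l) (esym (parallel_qdiffE al be c z k l))).
move=> z0; exists setT, (Lmap al be), (fun=> c); split => //.
- exact: Lmap_complex_coord.
- by move=> z _ i j; rewrite parallel_qdiffE !dw_Lmap.
- split => [||z _].
  + exact/smooth_on_cst/openT.
  + exact/smooth_on_cst/openT.
  + by rewrite !derive_cst oppr0.
Qed.

Lemma is_derive_change (f : R -> R) (x v d d' : R) :
  is_derive x v f d -> d = d' -> is_derive x v f d'.
Proof. by move=> ? <-. Qed.

Lemma is_derive_affine (a a' : R) : is_derive (0 : R) (1 : R) (fun s => a + s * a') a'.
Proof.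
have -> : (fun s => a + s * a') = cst a + (id * cst a') by apply/funext.
apply: is_derive_change (is_deriveD (is_derive_cst a (0 : R) (1 : R))
  (is_deriveM (is_derive_id (0 : R) (1 : R)) (is_derive_cst a' (0 : R) (1 : R)))) _.
by rewrite /GRing.scale /=; ring.
Qed.

Lemma is_deriveMul (f g : R -> R) (df dg : R) :
  is_derive (0 : R) (1 : R) f df -> is_derive (0 : R) (1 : R) g dg ->
  is_derive (0 : R) (1 : R) (fun s => f s * g s) (f 0 * dg + g 0 * df).
Proof. by move=> hf hg; exact: is_deriveM. Qed.

Lemma is_deriveInv (f : R -> R) (df : R) : f 0 != 0 ->
  is_derive (0 : R) (1 : R) f df ->
  is_derive (0 : R) (1 : R) (fun s => (f s)^-1) (- f 0 ^- 2 * df).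
Proof.
move=> f0 hf; split; first exact: derivableV.
by rewrite deriveV //; congr (_ * _); exact: derive_val.
Qed.

Lemma Lmetric_horizontal al be al' be' : be != 0 ->
  exists Psi : qdiff R, holomorphic_qdiff (Lmetric al be) Psi /\
    forall z i j,
      is_derive (0 : R) (1 : R)
        (fun s : R => Lmetric (al + s * al') (be + s * be') z i j)
        (complex.Re (Psi z i j)).
Proof.
(* The xx entry forces Re c and the xy entry then forces Im c; the yy entry is consistent with
   both. *)
move=> be0; pose c := (- 2 * be' / be +i* (- (al' + al * be' / be) / be))%C.
exists (parallel_qdiff al be c); split; first exact: parallel_holomorphic.
have dal := is_derive_affine al al'; have dbe := is_derive_affine be be'.
have be00 : be + 0 * be' != 0 by rewrite mul0r addr0.
have dV := is_deriveInv be00 dbe.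
have [L0 L1] := Lmap_e2 al be.
move=> z; apply: ord2P; apply: ord2P; rewrite parallel_qdiffE ?L0 ?L1 /c /=.
- rewrite (_ : (fun s => _) = (fun s => (be + s * be')^-1 * (be + s * be')^-1)); last first.
    by apply/funext => s; have [-> _ _ _] := Lmetric_entries (al + s * al') (be + s * be') z.
  apply: is_derive_change (is_deriveMul dV dV) _; rewrite /= mul0r addr0; by field.
- rewrite (_ : (fun s => _) = (fun s => (al + s * al') * (be + s * be')^-1)); last first.
    by apply/funext => s; have [_ -> _ _] := Lmetric_entries (al + s * al') (be + s * be') z.
  apply: is_derive_change (is_deriveMul dal dV) _; rewrite /= !mul0r !addr0; by field.
- rewrite (_ : (fun s => _) = (fun s => (al + s * al') * (be + s * be')^-1)); last first.
    by apply/funext => s; have [_ _ -> _] := Lmetric_entries (al + s * al') (be + s * be') z.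
  apply: is_derive_change (is_deriveMul dal dV) _; rewrite /= !mul0r !addr0; by field.
- rewrite (_ : (fun s => _) = ((fun s => (al + s * al') * (al + s * al')) \+ (fun s => (be + s * be') * (be + s * be')))); last first.
    by apply/funext => s; have [_ _ _ ->] := Lmetric_entries (al + s * al') (be + s * be') z.
  apply: is_derive_change (is_deriveD (is_deriveMul dal dal) (is_deriveMul dbe dbe)) _.
  rewrite /= !mul0r !addr0; by field.
Qed.

End FlatFamily.

(** * The orthogonal projection on a flat torus *)

Section Projection.
Variable R : realType.

Lemma continuous_lin3 (A B C : R * R -> R) (x y w : R) :
  continuous A -> continuous B -> continuous C ->
  continuous (fun z => x * A z + y * B z + w * C z).
Proof.
move=> cA cB cC z; have cZ (f : R * R -> R) (k : R) : continuous f -> {for z, continuous (fun z => k * f z)}.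
  by move=> cf; apply: continuousM; [exact: cvg_cst|exact: cf].
apply: (@continuousD _ _ _ (fun z => x * A z + y * B z) (fun z => w * C z)); last exact: cZ.
by apply: (@continuousD _ _ _ (fun z => x * A z) (fun z => y * B z)); exact: cZ.
Qed.

Lemma integral_M_lin3 (A B C : R * R -> R) (x y w : R) :
  continuous A -> continuous B -> continuous C ->
  integral_M (fun z => x * A z + y * B z + w * C z) =
  x * integral_M A + y * integral_M B + w * integral_M C.
Proof.
move=> cA cB cC; have cZ (f : R * R -> R) (k : R) : continuous f -> continuous (fun z => k * f z).
  by move=> cf z; apply: continuousM; [exact: cvg_cst|exact: cf].
have cAB : continuous (fun z => x * A z + y * B z).
  move=> z; apply: (@continuousD _ _ _ (fun z => x * A z) (fun z => y * B z)); exact: cZ.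
rewrite (integral_MD cAB (cZ C w cC)) (integral_MD (cZ A x cA) (cZ B y cB)).
by rewrite !integral_MZ.
Qed.

Lemma Re_scaleB (K : R) (x y : R[i]) :
  complex.Re ((K%:C)%C * (x - y)) = K * (complex.Re x - complex.Re y).
Proof. by case: x y => [p q] [r s] /=; ring. Qed.

Lemma Im_scaleB (K : R) (x y : R[i]) :
  complex.Im ((K%:C)%C * (x - y)) = K * (complex.Im x - complex.Im y).
Proof. by case: x y => [p q] [r s] /=; ring. Qed.

(** A single parallel test differential suffices: its complex inner product with Phi - Psi is a
    positive constant times the mean of Phi_xx - c, and both real and imaginary part vanish. *)
Lemma projection_integral (al be : R) (Phi Psi : qdiff R) (c : R[i]) :
  be != 0 -> is_projection (Lmetric al be) Phi Psi ->
  (forall z i j, Phi z i j = Phi z 0 0 * mupow (Lmetric al be) z i * mupow (Lmetric al be) z j) ->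
  (forall z, Psi z 0 0 = c) ->
  continuous (fun z => complex.Re (Phi z 0 0)) -> continuous (fun z => complex.Im (Phi z 0 0)) ->
  complex.Re c = integral_M (fun z => complex.Re (Phi z 0 0)) /\
  complex.Im c = integral_M (fun z => complex.Im (Phi z 0 0)).
Proof.
move=> be0 [hPsi ort] PhiE Psic cRe cIm.
(* The factor be^2 normalises the xx entry of [Theta] to 1, so that its entries are products of
   [mupow]. *)
pose g := Lmetric al be; pose Theta := parallel_qdiff al be ((be ^+ 2)%:C)%C.
have E0 z : 0 < g z 0 0 by exact: Lmetric00_gt0.
have g10 z : g z 1 0 = g z 0 1 by exact: Lmetric_sym.
have d1 z : \det (g z) = 1 by exact: Lmetric_det.
have PsiE z i j : Psi z i j = Psi z 0 0 * mupow g z i * mupow g z j.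
  exact: (holomorphic_qdiff_mu (E0 z) (g10 z) (d1 z) hPsi).
have ThetaE z i j : Theta z i j = mupow g z i * mupow g z j.
  have [L0 L1] := Lmap_e2 al be.
  rewrite /Theta parallel_qdiffE; move: i j; apply: ord2P; apply: ord2P;
    rewrite ?L0 ?L1 /mupow /= /g ?Lmetric_mu //; apply: complex_ext => /=; field => //.
pose X : qdiff R := fun z => Phi z - Psi z.
have XE z i j : X z i j = X z 0 0 * mupow g z i * mupow g z j.
  by rewrite /X !mxE PhiE PsiE; ring.
have X00 z : X z 0 0 = Phi z 0 0 - c by rewrite /X !mxE Psic.
pose K := (2 / be^-1 ^+ 2) ^+ 2.
have K0 : K != 0 by rewrite expf_neq0 // mulf_neq0 ?pnatr_eq0 // invr_eq0 expf_neq0 // invr_eq0.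
have innerE z : qdiff_inner g X Theta z = (K%:C)%C * (Phi z 0 0 - c).
  rewrite (qdiff_inner_mu (E0 z) (g10 z) (d1 z) (XE z) (ThetaE z)) X00 /K.
  by have [-> _ _ _] := Lmetric_entries al be z.
have hT : holomorphic_qdiff g Theta by exact: parallel_holomorphic.
have := ort Theta hT; rewrite /L2_inner => -[].
have cc (f : R * R -> R) (d : R) : continuous f ->
    integral_M (fun z => K * (f z - d)) = K * (integral_M f - d).
  move=> cf; rewrite integral_MZ; last by move=> z; apply: continuousB; [exact: cf|exact: cvg_cst].
  congr (_ * _); rewrite (integral_MD (g := fun=> - d)) ?integral_M_cst //.
  by move=> z; exact: cvg_cst.
have -> : integral_M (fun z => complex.Re (qdiff_inner g X Theta z) * Num.sqrt (\det (g z))) =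
    K * (integral_M (fun z => complex.Re (Phi z 0 0)) - complex.Re c).
  rewrite -cc //; apply: eq_integral_M => z _; by rewrite innerE d1 sqrtr1 mulr1 Re_scaleB.
have -> : integral_M (fun z => complex.Im (qdiff_inner g X Theta z) * Num.sqrt (\det (g z))) =
    K * (integral_M (fun z => complex.Im (Phi z 0 0)) - complex.Im c).
  rewrite -cc //; apply: eq_integral_M => z _; by rewrite innerE d1 sqrtr1 mulr1 Im_scaleB.
move=> /eqP; rewrite mulf_eq0 (negbTE K0) /= subr_eq0 => /eqP h1.
by move=> /eqP; rewrite mulf_eq0 (negbTE K0) /= subr_eq0 => /eqP h2.
Qed.

End Projection.

(** * Evolution of a and b *)

Section Evolution.
Variables (R : realType) (n : nat) (N : topologicalType).
Variable G : riemannian_manifold R n N.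
Variables (eta : R) (T : \bar R) (u : R -> R * R -> N) (g : R -> R * R -> 'M[R]_2).
Hypothesis hflow : flow_solution G eta T u g.
Local Notation I := (time_interval T).

Lemma flow_u_smooth t : I t -> continuous (u t) /\
  (forall c : chart G, smooth_on (u t @^-1` dom c) (crd c \o u t)).
Proof.
move=> It; have [cu su] := u_smooth hflow; split.
  move=> z; move/subspace_continuousP: cu => /(_ (t, z) (conj It Logic.I)) cu.
  apply: cvg_trans cu => P; rewrite /fmap /within /= => -[[P1 P2] [/= H1 H2] HP].
  by apply: filterS H2 => z' H2; apply: (HP (t, z')) => //; split => //; exact: nbhs_singleton.
move=> c; have := smooth_on_slice t (su c).
by rewrite (_ : [set z | _] = u t @^-1` dom c) //; apply/seteqP; split => z /=; [case|].
Qed.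

Lemma in_family_evolution (heta : 0 < eta) (al be : R -> R) t :
  in_family T g al be -> I t ->
  let IA := integral_M (inner_du G (u t) e_x e_x) in
  let IB := integral_M (inner_du G (u t) e_x e_y) in
  let IC := integral_M (inner_du G (u t) e_y e_y) in
  let k := eta ^+ 2 / 4 in
  let a := al t * be t in let b := be t ^+ 2 in
  time_deriv I (fun s => be s ^+ 2) t (k * ((a ^+ 2 - b ^+ 2) * IA - 2 * a * IB + IC)) /\
  time_deriv I (fun s => al s * be s) t (k * (2 * b * (IB - a * IA))).
Proof.
move=> [cal cbe fam] It IA IB IC k a b.
have [uc us] := flow_u_smooth It.
have [be0 gt] := fam t It.
have k0 : k != 0 by rewrite mulf_neq0 ?expf_neq0 ?gt_eqF // invr_eq0 pnatr_eq0.
have [Phi [Psi [hopf proj dg]]] := flow_g hflow It.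
rewrite gt in hopf proj.
pose h := Lmetric (al t) (be t).
have E0 z : 0 < h z 0 0 by exact: Lmetric00_gt0.
have g10 z : h z 1 0 = h z 0 1 by exact: Lmetric_sym.
have d1 z : \det (h z) = 1 by exact: Lmetric_det.
have mE z : frame_ratio h z = (a +i* b)%C by exact: Lmetric_mu.
have [hPsi _] := proj.
have PsiE z i j : Psi z i j = Psi z 0 0 * mupow h z i * mupow h z j.
  exact: (holomorphic_qdiff_mu (E0 z) (g10 z) (d1 z) hPsi).
have gcst s z i j : I s -> g s z i j = g s 0 i j.
  by move=> Is; have [_ ->] := fam s Is; rewrite !mxE.
(* All metrics g s are constant in space, hence so is their time derivative, a nonzero multiple of
   Re Psi. For Im Psi_xx, [Re01] is solved using b != 0. *)
have RePsi z i j : complex.Re (Psi z i j) = complex.Re (Psi 0 i j).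
  apply: (mulfI k0); apply: (time_deriv_unique It (dg z i j)).
  by apply: (eq_time_deriv _ It (dg 0 i j)) => s Is; rewrite (gcst s z).
have Re01 z : complex.Re (Psi z 0 1) =
    complex.Re (Psi z 0 0) * a - complex.Im (Psi z 0 0) * b.
  rewrite (PsiE z 0 1) /mupow /= mE mulr1; by case: (Psi z 0 0).
have b0 : b != 0 by rewrite expf_neq0.
have Psic z : Psi z 0 0 = Psi 0 0 0.
  apply: complex_ext; first exact: RePsi.
  have e := Re01 z; rewrite (RePsi z 0 1) (Re01 0) (RePsi z 0 0) in e.
  by apply: (mulIf b0); move/addrI/oppr_inj: e => ->.
pose PA := inner_du G (u t) e_x e_x; pose PB := inner_du G (u t) e_x e_y.
pose PC := inner_du G (u t) e_y e_y.
have cA : continuous PA by exact: inner_du_continuous.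
have cB : continuous PB by exact: inner_du_continuous.
have cC : continuous PC by exact: inner_du_continuous.
have PhiE z i j : Phi z i j = Phi z 0 0 * mupow h z i * mupow h z j.
  by have [+ _] := hopf_entry uc us (E0 z) (g10 z) (d1 z) hopf; apply.
pose E := (be t)^-1 ^+ 2; pose F := al t / be t.
have Phi00 z : Phi z 0 0 = (((- (F ^+ 2 - 1)) * PA z + (2 * E * F) * PB z + (- E ^+ 2) * PC z)
   +i* ((2 * F) * PA z + (- 2 * E) * PB z + 0 * PC z))%C.
  have [_ ->] := hopf_entry uc us (E0 z) (g10 z) (d1 z) hopf.
  have [-> -> _ _] := Lmetric_entries (al t) (be t) z.
  by rewrite -/E -/F -/(PA z) -/(PB z) -/(PC z); apply: complex_ext => /=; ring.
have ReE : (fun z => complex.Re (Phi z 0 0)) =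
    (fun z => (- (F ^+ 2 - 1)) * PA z + (2 * E * F) * PB z + (- E ^+ 2) * PC z).
  by apply/funext => z; rewrite Phi00.
have ImE : (fun z => complex.Im (Phi z 0 0)) =
    (fun z => (2 * F) * PA z + (- 2 * E) * PB z + 0 * PC z).
  by apply/funext => z; rewrite Phi00.
have cl (x y w : R) : continuous (fun z => x * PA z + y * PB z + w * PC z).
  exact: continuous_lin3.
have [] := projection_integral be0 proj PhiE Psic.
- by rewrite ReE; exact: cl.
- by rewrite ImE; exact: cl.
rewrite ReE ImE.
rewrite (integral_M_lin3 (- (F ^+ 2 - 1)) (2 * E * F) (- E ^+ 2) cA cB cC).
rewrite (integral_M_lin3 (2 * F) (- 2 * E) 0 cA cB cC).
move=> c1 c2.
have c1E : complex.Re (Psi 0 0 0) = - (F ^+ 2 - 1) * IA + 2 * E * F * IB + - E ^+ 2 * IC := c1.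
have c2E : complex.Im (Psi 0 0 0) = 2 * F * IA + - 2 * E * IB + 0 * IC := c2.
move: c1E c2E; clear c1 c2 ReE ImE cl Phi00 PhiE; move: IA IB IC => IA IB IC c1E c2E.
have [g00 g01 _ _] := Lmetric_entries (al t) (be t) 0.
(* In the family b = 1 / E and a = F / E, so the evolution of E and F determines that of a and b. *)
have dE := dg 0 0 0; have dF := dg 0 0 1.
have dV := time_derivV (_ : g t 0 0 0 != 0) dE; rewrite gt g00 in dV.
have E0n : (be t)^-1 ^+ 2 != 0 by rewrite expf_neq0 // invr_eq0.
have {}dV := dV E0n.
split.
  have : - (k * complex.Re (Psi 0 0 0)) / ((be t)^-1 ^+ 2) ^+ 2 =
      k * ((a ^+ 2 - b ^+ 2) * IA - 2 * a * IB + IC).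
    by rewrite c1E /E /F /a /b; field.
  move=> <-; apply: (eq_time_deriv _ It dV) => s Is.
  have [bs0 ->] := fam s Is; have [-> _ _ _] := Lmetric_entries (al s) (be s) 0.
  by rewrite exprVn invrK.
have dM := time_derivM dF dV; rewrite gt g00 g01 in dM.
have : eta ^+ 2 / 4 * complex.Re (Psi 0 0 1) * ((be t)^-1 ^+ 2)^-1 +
    al t / be t * (- (eta ^+ 2 / 4 * complex.Re (Psi 0 0 0)) / ((be t)^-1 ^+ 2) ^+ 2) =
    k * (2 * b * (IB - a * IA)).
  rewrite Re01 -/k c1E c2E /E /F /a /b; by field.
move=> <-; apply: (eq_time_deriv _ It dM) => s Is.
have [bs0 ->] := fam s Is; have [-> -> _ _] := Lmetric_entries (al s) (be s) 0.
by field.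
Qed.

End Evolution.

(** * Evolution of alpha and beta in terms of the map U *)

Section EvolutionU.
Variables (R : realType) (n : nat) (N : topologicalType).
Variable G : riemannian_manifold R n N.

Lemma Lmap_frame (al be : R) : be != 0 ->
  Lmap al be (be, 0) = e_x /\ Lmap al be (- al, be^-1) = e_y.
Proof. by move=> be0; rewrite !LmapE /=; split; congr pair; field. Qed.

Lemma time_deriv_change (J : set R) (f : R -> R) (t l l' : R) :
  time_deriv J f t l -> l = l' -> time_deriv J f t l'.
Proof. by move=> ? <-. Qed.

(** beta is a continuous root of b, and alpha = a / beta. Right-hand sides are written as
    combinations of three integrals, the form to which every integral of the statement is
    reduced. *)
Lemma time_deriv_family (J : set R) (al be : R -> R) (t k IA IB IC : R) :
  {within J, continuous be} -> J t -> (forall s, J s -> be s != 0) ->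
  time_deriv J (fun s => be s ^+ 2) t
    (k * (((al t * be t) ^+ 2 - (be t ^+ 2) ^+ 2) * IA - 2 * (al t * be t) * IB + IC)) ->
  time_deriv J (fun s => al s * be s) t
    (k * (2 * be t ^+ 2 * (IB - al t * be t * IA))) ->
  let a := al t * be t in let b := be t ^+ 2 in
  [/\ time_deriv J be t (- k * (be t / 2) *
        ((be t ^+ 2 - al t ^+ 2) * IA + 2 * al t / be t * IB + - (be t)^-1 ^+ 2 * IC)),
      time_deriv J al t (k *
        ((al t / 2 * (be t ^+ 2 - al t ^+ 2) - 2 * al t * be t ^+ 2) * IA
          + (al t ^+ 2 / be t + 2 * be t) * IB + (- (al t / 2) * (be t)^-1 ^+ 2) * IC)),
      time_deriv J (fun s => al s * be s) t (k * (2 * b * (- a * IA + 1 * IB + 0 * IC))),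
      time_deriv J (fun s => be s ^+ 2) t
        (k * (- (b ^+ 2 - a ^+ 2) * IA + - 2 * a * IB + 1 * IC)) &
      (k = 2 / 4 ->
        time_deriv J (fun s => al s * be s) t (b * (- a * IA + 1 * IB + 0 * IC)) /\
        time_deriv J (fun s => be s ^+ 2) t
          (2^-1 * (- (b ^+ 2 - a ^+ 2) * IA + - 2 * a * IB + 1 * IC)))].
Proof.
move=> cbe Jt be0 tb ta a b; have bt0 := be0 t Jt.
have dbeta := time_deriv_root cbe Jt bt0 tb.
have dal := time_derivM ta (time_derivV bt0 dbeta).
split.
- by move: dbeta; congr (time_deriv _ _ _ _); field.
- apply: (eq_time_deriv (f := fun s => al s * be s * (be s)^-1)) => //.
    by move=> s Js; rewrite mulfK ?be0.
  by move: dal; congr (time_deriv _ _ _ _); field.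
- by move: ta; congr (time_deriv _ _ _ _); rewrite /a /b; ring.
- by move: tb; congr (time_deriv _ _ _ _); rewrite /a /b; ring.
- move=> kE; split.
    by apply: time_deriv_change ta _; rewrite kE /a /b; field.
  by apply: time_deriv_change tb _; rewrite kE /a /b; field.
Qed.

Section Pullback.
Variables (al be : R) (v : R * R -> N) (V : R * R -> N).
Hypothesis be0 : be != 0.
Hypothesis vV : forall z, v z = V (Lmap al be z).
Hypothesis v_cont : continuous v.
Hypothesis v_smooth : forall c : chart G, smooth_on (v @^-1` dom c) (crd c \o v).

Let A := inner_du G v e_x e_x.
Let B := inner_du G v e_x e_y.
Let C := inner_du G v e_y e_y.

Lemma inner_du_pushforward z :
  [/\ inner_du G V e_x e_x (Lmap al be z) = be ^+ 2 * A z + 0 * B z + 0 * C z,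
      inner_du G V e_x e_y (Lmap al be z) = (- al * be) * A z + 1 * B z + 0 * C z &
      inner_du G V e_y e_y (Lmap al be z) =
        al ^+ 2 * A z + (- 2 * al / be) * B z + be^-1 ^+ 2 * C z].
Proof.
have [Lx Ly] := Lmap_frame al be0.
have ip s1 t1 s2 t2 := inner_du_pair v_cont v_smooth s1 t1 s2 t2 z.
have hx := inner_du_Lmap G (be, 0) (be, 0) z vV.
have hxy := inner_du_Lmap G (be, 0) (- al, be^-1) z vV.
have hy := inner_du_Lmap G (- al, be^-1) (- al, be^-1) z vV.
rewrite Lx in hx; rewrite Lx Ly in hxy; rewrite Ly in hy.
split; [apply: (etrans (esym hx)); apply: (etrans (ip _ _ _ _))
  |apply: (etrans (esym hxy)); apply: (etrans (ip _ _ _ _))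
  |apply: (etrans (esym hy)); apply: (etrans (ip _ _ _ _))];
  rewrite -/(A z) -/(B z) -/(C z); by field.
Qed.

Lemma integral_Mab_comb (f : R * R -> R) (x y w : R) :
  (forall z, f (Lmap al be z) = x * A z + y * B z + w * C z) ->
  integral_Mab al be f = x * integral_M A + y * integral_M B + w * integral_M C.
Proof.
move=> fE.
have cA : continuous A by exact: inner_du_continuous.
have cB : continuous B by exact: inner_du_continuous.
have cC : continuous C by exact: inner_du_continuous.
have cl := @continuous_lin3 _ A B C x y w cA cB cC.
have cf : continuous f.
  have -> : f = (fun z => x * A z + y * B z + w * C z) \o Lmap (- al) be^-1.
    by apply/funext => z; rewrite /comp -fE LmapK.
  by move=> z; apply: continuous_comp; [exact: Lmap_continuous|exact: cl].
rewrite integral_Lmap // -(integral_M_lin3 x y w cA cB cC).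
by apply: eq_integral_M => z _; rewrite /comp fE.
Qed.

End Pullback.

Variables (eta : R) (T : \bar R) (u : R -> R * R -> N) (g : R -> R * R -> 'M[R]_2).
Hypothesis hflow : flow_solution G eta T u g.
Local Notation I := (time_interval T).

Lemma in_family_evolution_U (heta : 0 < eta) (alpha beta : R -> R) :
  in_family T g alpha beta -> forall U : R -> R * R -> N,
  (forall t z, I t -> u t z = U t (Lmap (alpha t) (beta t) z)) ->
  forall t, I t ->
  let a s := alpha s * beta s in
  let b s := beta s ^+ 2 in
  [/\ lattice_periodic (fun i => Lmap (alpha t) (beta t) (e2 i)) (U t),
      time_deriv I beta t
        (- (eta ^+ 2 / 4) * (beta t / 2) *
          integral_Mab (alpha t) (beta t) (fun z =>
            inner_du G (U t) e_x e_x z - inner_du G (U t) e_y e_y z)) /\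
      time_deriv I alpha t
        (eta ^+ 2 / 4 *
          integral_Mab (alpha t) (beta t) (fun z =>
            alpha t / 2 * (inner_du G (U t) e_x e_x z - inner_du G (U t) e_y e_y z)
            + 2 * beta t * inner_du G (U t) e_x e_y z)),
      time_deriv I a t
        (eta ^+ 2 / 4 * (2 * b t *
          integral_M (fun z =>
            inner_du G (u t) e_x e_y z - a t * inner_du G (u t) e_x e_x z))) /\
      time_deriv I b t
        (eta ^+ 2 / 4 *
          integral_M (fun z =>
            - (b t ^+ 2 - a t ^+ 2) * inner_du G (u t) e_x e_x z
            + inner_du G (u t) e_y e_y z
            - 2 * a t * inner_du G (u t) e_x e_y z)) &
      [/\ beta t *: Lmap (alpha t) (beta t) e_x = (1, 0),
          beta t *: Lmap (alpha t) (beta t) e_y = (a t, b t) &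
          eta ^+ 2 = 2 ->
            time_deriv I a t (dll_a G (a t) (b t) (u t)) /\
            time_deriv I b t (dll_b G (a t) (b t) (u t))]].
Proof.
move=> fam U hU t It a b.
have [cal cbe Lfam] := fam; have [be0 _] := Lfam t It.
have [uc us] := flow_u_smooth hflow It.
have uU z := hU t z It.
pose A := inner_du G (u t) e_x e_x; pose B := inner_du G (u t) e_x e_y.
pose C := inner_du G (u t) e_y e_y.
have cA : continuous A by exact: inner_du_continuous.
have cB : continuous B by exact: inner_du_continuous.
have cC : continuous C by exact: inner_du_continuous.
have [dbb daa] : time_deriv I (fun s => beta s ^+ 2) t (eta ^+ 2 / 4 *
    (((alpha t * beta t) ^+ 2 - (beta t ^+ 2) ^+ 2) * integral_M A
      - 2 * (alpha t * beta t) * integral_M B + integral_M C)) /\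
    time_deriv I (fun s => alpha s * beta s) t (eta ^+ 2 / 4 *
      (2 * beta t ^+ 2 * (integral_M B - alpha t * beta t * integral_M A))).
  exact: (in_family_evolution hflow heta fam It).
have pf := inner_du_pushforward be0 uU uc us.
have JB : integral_Mab (alpha t) (beta t) (fun z =>
    inner_du G (U t) e_x e_x z - inner_du G (U t) e_y e_y z) =
    (beta t ^+ 2 - alpha t ^+ 2) * integral_M A + (2 * alpha t / beta t) * integral_M B
      + (- (beta t)^-1 ^+ 2) * integral_M C.
  apply: (integral_Mab_comb be0 uc us) => z; have [-> _ ->] := pf z.
  by rewrite -/(A z) -/(B z) -/(C z); field.
have JA : integral_Mab (alpha t) (beta t) (fun z =>
    alpha t / 2 * (inner_du G (U t) e_x e_x z - inner_du G (U t) e_y e_y z)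
      + 2 * beta t * inner_du G (U t) e_x e_y z) =
    (alpha t / 2 * (beta t ^+ 2 - alpha t ^+ 2) - 2 * alpha t * beta t ^+ 2) * integral_M A
      + (alpha t ^+ 2 / beta t + 2 * beta t) * integral_M B
      + (- (alpha t / 2) * (beta t)^-1 ^+ 2) * integral_M C.
  apply: (integral_Mab_comb be0 uc us) => z; have [-> -> ->] := pf z.
  by rewrite -/(A z) -/(B z) -/(C z); field.
have Ja : integral_M (fun z =>
    inner_du G (u t) e_x e_y z - a t * inner_du G (u t) e_x e_x z) =
    (- a t) * integral_M A + 1 * integral_M B + 0 * integral_M C.
  rewrite -(integral_M_lin3 (- a t) 1 0 cA cB cC); apply: eq_integral_M => z _.
  by rewrite -/(A z) -/(B z) -/(C z); ring.
have Jb : integral_M (fun z =>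
    - (b t ^+ 2 - a t ^+ 2) * inner_du G (u t) e_x e_x z
      + inner_du G (u t) e_y e_y z - 2 * a t * inner_du G (u t) e_x e_y z) =
    (- (b t ^+ 2 - a t ^+ 2)) * integral_M A + (- 2 * a t) * integral_M B + 1 * integral_M C.
  rewrite -(integral_M_lin3 (- (b t ^+ 2 - a t ^+ 2)) (- 2 * a t) 1 cA cB cC).
  by apply: eq_integral_M => z _; rewrite -/(A z) -/(B z) -/(C z); ring.
have [tbe tal ta tb tdll] := time_deriv_family cbe It (fun s Is => (Lfam s Is).1) dbb daa.
clear dbb daa; split.
(* Every point is some L z', and L z' + L (e2 i) = L (z' + e2 i) reduces the claim to the
   periodicity of u. *)
- move=> i z; rewrite -(LmapK (alpha t) be0 z); set z' := Lmap (- alpha t) _ z.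
  rewrite addrC -[Lmap _ _ (e2 i)]scale1r -Lmap_lin scale1r -!uU addrC.
  exact: (u_periodic hflow It).
- by split; [rewrite JB|rewrite JA].
- by split; [rewrite Ja|rewrite Jb].
split.
- by rewrite LmapE /=; congr pair; rewrite /GRing.scale /=; field.
- by rewrite LmapE /= /a /b; congr pair; rewrite /GRing.scale /=; ring.
- move=> eta2; have [ha hb] := tdll (congr1 (fun x => x / 4) eta2).
  split; [rewrite /dll_a Ja; exact: ha|rewrite /dll_b Jb; exact: hb].
Qed.

End EvolutionU.

(** * The Beltrami equation and the energy inequality *)

Section Components.
Variables (R : realType) (V W : normedModType R).

Lemma derive_functional (l : {linear W -> R^o}) (f : V -> W) x v :
  continuous l -> derivable f x v ->
  derivable (fun y => l (f y) : R) x v /\ 'D_v (fun y => l (f y) : R) x = l ('D_v f x).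
Proof.
move=> cl df.
have E : (fun h : R => h^-1 *: (((fun y => l (f y) : R) \o shift x) (h *: v) - l (f x))) =
    l \o (fun h : R => h^-1 *: ((f \o shift x) (h *: v) - f x)).
  by apply/funext => h /=; rewrite -linearB -[RHS]/(l _) linearZ_LR.
have c : (l \o (fun h : R => h^-1 *: ((f \o shift x) (h *: v) - f x))) @ 0^' --> l ('D_v f x).
  apply: (@continuous_cvg R W R^o (0 : R)^' _ _ l); last exact: df.
  exact: cl.
split; first by apply/cvg_ex; exists (l ('D_v f x)); rewrite E.
by rewrite {1}/derive E; apply: cvg_lim => //; exact: norm_hausdorff.
Qed.

Lemma smooth_on_functional (l : {linear W -> R^o}) (O : set V) (f : V -> W) :
  continuous l -> open O -> smooth_on O f -> smooth_on O (fun y => l (f y) : R).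
Proof.
move=> cl oO sf k; have {sf} := sf k; elim: k f => [|k IH] f.
  move=> [cf _]; split => //; move: cf; rewrite !continuous_open_subspace // => cf x Ox.
  exact: (continuous_comp (cf _ Ox) (cl _)).
move=> /(Ck_openS _ _ oO)[cf df]; apply/Ck_openS => //; split => [x Ox|v].
  exact: (continuous_comp (cf _ Ox) (cl _)).
have [dfv Cfv] := df v; split => [x Ox|]; first by have [] := derive_functional cl (dfv x Ox).
apply: eq_Ck (IH _ Cfv) => x /set_mem Ox.
by have [_ ->] := derive_functional cl (dfv x Ox).
Qed.

End Components.

Section PlaneMaps.
Variable R : realType.

Lemma fst_linear : linear (fst : R * R -> R^o). Proof. by []. Qed.
Lemma snd_linear : linear (snd : R * R -> R^o). Proof. by []. Qed.
Definition fst_lin : {linear (R * R)%type -> R^o} :=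
  HB.pack (fst : R * R -> R^o) (GRing.isLinear.Build _ _ _ _ _ fst_linear).
Definition snd_lin : {linear (R * R)%type -> R^o} :=
  HB.pack (snd : R * R -> R^o) (GRing.isLinear.Build _ _ _ _ _ snd_linear).

Lemma fst_lin_continuous : continuous fst_lin. Proof. by move=> x; exact: cvg_fst. Qed.
Lemma snd_lin_continuous : continuous snd_lin. Proof. by move=> x; exact: cvg_snd. Qed.

(** The integrand is a divergence: f1_x f2_y - f1_y f2_x = (f1 f2_y)_x - (f1 f2_x)_y, by symmetry of
    the second derivatives of f2. *)
Lemma jac_integral (f1 f2 : R * R -> R) :
  smooth_on setT f1 -> smooth_on setT f2 ->
  lattice_periodic e2 f1 -> lattice_periodic e2 f2 ->
  integral_M (fun z => 'D_(e2 0) f1 z * 'D_(e2 1) f2 z - 'D_(e2 1) f1 z * 'D_(e2 0) f2 z) = 0.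
Proof.
move=> s1 s2 p1 p2; have oT : open [set: R * R] by exact: openT.
have sD i (f : R * R -> R) : smooth_on setT f -> smooth_on setT ('D_(e2 i) f) by move=> sf; exact: smooth_on_derive.
have dv i (f : R * R -> R) z : smooth_on setT f -> derivable f z (e2 i).
  by move=> sf; apply: (smooth_on_derivable (O := setT)).
have ct (f : R * R -> R) : smooth_on setT f -> continuous f.
  by move=> sf z; exact: (smooth_on_continuous oT sf).
have pD i (f : R * R -> R) : lattice_periodic e2 f -> lattice_periodic e2 ('D_(e2 i) f).
  move=> pf j z; rewrite /derive; set q1 := fun h => h^-1 *: _; set q2 := fun h => h^-1 *: _.
  suff -> : q1 = q2 by [].
  by apply/funext => h; rewrite /q1 /q2 /= addrA !pf.
pose h1 z := f1 z * 'D_(e2 1) f2 z; pose h2 z := f1 z * 'D_(e2 0) f2 z.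
have sh1 : smooth_on setT h1 by apply: smooth_onM => //; exact: sD.
have sh2 : smooth_on setT h2 by apply: smooth_onM => //; exact: sD.
have ph1 : lattice_periodic e2 h1 by move=> i z; rewrite /h1 p1 (pD 1 _ p2).
have ph2 : lattice_periodic e2 h2 by move=> i z; rewrite /h2 p1 (pD 0 _ p2).
have I1 : integral_M ('D_(e2 0) h1) = 0.
  by apply: integral_M_derive => //; [move=> z; exact: dv|exact/ct/sD].
have I2 : integral_M ('D_(e2 1) h2) = 0.
  by apply: integral_M_derive => //; [move=> z; exact: dv|exact/ct/sD].
have c1 : continuous ('D_(e2 0) h1) by exact/ct/sD.
have c2 : continuous ('D_(e2 1) h2) by exact/ct/sD.
transitivity (integral_M (fun z => 'D_(e2 0) h1 z + -1 * 'D_(e2 1) h2 z)); last first.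
  have c2' : continuous (fun z => -1 * 'D_(e2 1) h2 z).
    by move=> z; apply: (@continuousM _ _ (fun=> -1) ('D_(e2 1) h2)); [exact: cvg_cst|exact: c2].
  have I2' := etrans (integral_MZ (-1) c2) (congr1 (fun x => -1 * x) I2).
  apply: (etrans (integral_MD c1 c2')); apply: (etrans (congr2 +%R I1 I2')).
  by rewrite mulr0 addr0.
apply: eq_integral_M => z _.
have E1 : 'D_(e2 0) h1 z = f1 z *: 'D_(e2 0) ('D_(e2 1) f2) z + 'D_(e2 1) f2 z *: 'D_(e2 0) f1 z.
  by apply: deriveM; apply: dv => //; exact: sD.
have E2 : 'D_(e2 1) h2 z = f1 z *: 'D_(e2 1) ('D_(e2 0) f2) z + 'D_(e2 0) f2 z *: 'D_(e2 1) f1 z.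
  by apply: deriveM; apply: dv => //; exact: sD.
have S : 'D_(e2 0) ('D_(e2 1) f2) z = 'D_(e2 1) ('D_(e2 0) f2) z by exact: (schwarz _ _ oT s2).
rewrite E1 E2 S /GRing.scale /=.
move: ('D_(e2 1) ('D_(e2 0) f2) z) (f1 z) => a b; clear; ring.
Qed.

End PlaneMaps.

(** * The Beltrami-type equation as an algebraic identity *)

Section HolomorphicEquation.
Variable R : realType.

(* With f = k psi w_x^2 and mu = (F + i) / E this is f_y - mu f_x = 2 mu_x f. *)
Lemma beltrami_algebra (K : comNzRingType) (E m Ex mx w wy wxx wxy psi psix psiy k : K) :
  E * wy = m * w -> Ex * wy + E * wxy = mx * w + m * wxx -> psix * wy = psiy * w ->
  E * (E * (k * (psiy * w * w + 2 * psi * w * wxy))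
    - m * (k * (psix * w * w + 2 * psi * w * wxx))) =
  2 * (k * psi * w * w) * (E * mx - Ex * m).
Proof.
move=> /eqP; rewrite -subr_eq0 => /eqP h1 /eqP; rewrite -subr_eq0 => /eqP h3.
move=> /eqP; rewrite -subr_eq0 => /eqP h5.
apply/eqP; rewrite -subr_eq0; apply/eqP.
(* The difference of the two sides as a combination of the three hypotheses. *)
transitivity (k * (E * w * (- E * (psix * wy - psiy * w) + psix * (E * wy - m * w))
  + 2 * psi * w * (E * (Ex * wy + E * wxy - (mx * w + m * wxx)) - Ex * (E * wy - m * w)))).
  ring.
rewrite h1 h3 h5; ring.
Qed.

(** With m = F + i, these are the real and imaginary part of E (E f_y - m f_x) = 2 f (E m_x - E_x
    m), that is, of the equation for f multiplied by E^2. *)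
Lemma beltrami_algebra_real (E F Ex Fx px py qx qy pxx pxy qxx qxy a b ax ay bx by' k : R) :
  E * py = F * px - 1 * qx -> E * qy = F * qx + 1 * px ->
  Ex * py + E * pxy = Fx * px + F * pxx - qxx ->
  Ex * qy + E * qxy = Fx * qx + F * qxx + pxx ->
  ax * py - bx * qy = ay * px - by' * qx -> ax * qy + bx * py = ay * qx + by' * px ->
  let f1 := k * (a * (px * px - qx * qx) - 2 * b * px * qx) in
  let f2 := k * (2 * a * px * qx + b * (px * px - qx * qx)) in
  let f1d ad bd pd qd := k * (ad * (px * px - qx * qx) + a * (2 * px * pd - 2 * qx * qd)
    - 2 * bd * px * qx - 2 * b * (pd * qx + px * qd)) in
  let f2d ad bd pd qd := k * (2 * ad * px * qx + 2 * a * (pd * qx + px * qd)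
    + bd * (px * px - qx * qx) + b * (2 * px * pd - 2 * qx * qd)) in
  E * (E * f1d ay by' pxy qxy - F * f1d ax bx pxx qxx + f2d ax bx pxx qxx) =
    2 * (f1 * (E * Fx - Ex * F) + f2 * Ex) /\
  E * (E * f2d ay by' pxy qxy - F * f2d ax bx pxx qxx - f1d ax bx pxx qxx) =
    2 * (f2 * (E * Fx - Ex * F) - f1 * Ex).
Proof.
move=> h1 h2 h3 h4 h5 h6 f1 f2 f1d f2d.
have H1 : (E%:C)%C * (py +i* qy)%C = (F +i* 1)%C * (px +i* qx)%C.
  by apply: complex_ext => /=; move: h1 h2; clear; lra.
have H3 : (Ex%:C)%C * (py +i* qy)%C + (E%:C)%C * (pxy +i* qxy)%C =
    (Fx%:C)%C * (px +i* qx)%C + (F +i* 1)%C * (pxx +i* qxx)%C.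
  by apply: complex_ext => /=; move: h3 h4; clear; lra.
have H5 : (ax +i* bx)%C * (py +i* qy)%C = (ay +i* by')%C * (px +i* qx)%C.
  by apply: complex_ext => /=; move: h5 h6; clear; lra.
have C := @beltrami_algebra R[i] _ _ _ _ _ _ _ _ (a +i* b)%C _ _ (k%:C)%C H1 H3 H5.
have two : (2 : R[i]) = (2 +i* 0)%C by apply: complex_ext => /=; ring.
rewrite two in C.
have Cr := congr1 (@complex.Re R) C; have Ci := congr1 (@complex.Im R) C.
rewrite /= in Cr Ci; rewrite /f1 /f2 /f1d /f2d; clear -Cr Ci.
by split; [move: Cr|move: Ci]; clear; lra.
Qed.
End HolomorphicEquation.

(** * Pointwise estimates *)

Section EnergyInequality.
Variable R : realType.
Implicit Types a b c d x y B : R.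

Lemma sqrD_le a b : (a + b) ^+ 2 <= 2 * (a ^+ 2 + b ^+ 2).
Proof. by have := sqr_ge0 (a - b); lra. Qed.

Lemma sqrD3_le a b c : (a + b + c) ^+ 2 <= 3 * (a ^+ 2 + b ^+ 2 + c ^+ 2).
Proof.
by have := sqr_ge0 (a - b); have := sqr_ge0 (a - c); have := sqr_ge0 (b - c); lra.
Qed.

Lemma sqrD4_le a b c d : (a + b + c + d) ^+ 2 <= 4 * (a ^+ 2 + b ^+ 2 + c ^+ 2 + d ^+ 2).
Proof.
have := sqr_ge0 (a - b); have := sqr_ge0 (a - c); have := sqr_ge0 (a - d).
have := sqr_ge0 (b - c); have := sqr_ge0 (b - d); have := sqr_ge0 (c - d); lra.
Qed.

Lemma sqrM_le a x B : a ^+ 2 <= B -> (a * x) ^+ 2 <= B * x ^+ 2.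
Proof. by move=> aB; rewrite exprMn ler_wpM2r // sqr_ge0. Qed.

(* The null form J integrates to 0 over the torus; dividing the first-order system by E
   makes its coefficient constant. *)
Lemma gradient_bound (B E V F f1 f2 ex fx f1x f1y f2x f2y : R) :
  1 <= B -> 0 < E -> E * V = 1 -> E <= B -> V ^+ 2 <= B -> F ^+ 2 <= B ->
  f1 ^+ 2 <= B -> f2 ^+ 2 <= B ->
  E * (E * f1y - F * f1x + f2x) = 2 * (f1 * (E * fx - ex * F) + f2 * ex) ->
  E * (E * f2y - F * f2x - f1x) = 2 * (f2 * (E * fx - ex * F) - f1 * ex) ->
  f1x ^+ 2 + f1y ^+ 2 + f2x ^+ 2 + f2y ^+ 2 <=
    144 * B ^+ 7 * (fx ^+ 2 + ex ^+ 2) + 6 * B ^+ 3 * (f1x * f2y - f1y * f2x).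
Proof.
move=> B1 E0 EV EB VB FB f1B f2B pde1 pde2.
have B0 : 0 <= B by lra.
have En0 : E != 0 by rewrite gt_eqF.
have V0 : 0 < V by rewrite -(pmulr_rgt0 _ E0) EV ltr01.
have VB' : V <= B.
  have [V1|V1] := leP V 1; first by lra.
  by apply: le_trans VB; rewrite expr2 ler_peMr // ltW.
have Bmono (i j : nat) : (i <= j)%N -> B ^+ i <= B ^+ j by move=> ij; exact: ler_weXn2l.
have Bge0 (i : nat) : 0 <= B ^+ i by exact: exprn_ge0.
(* The system reads P = - f2_x + r1 and Q = f1_x + r2, with remainders linear in E_x and F_x. *)
pose P := E * f1y - F * f1x; pose Q := E * f2y - F * f2x.
pose r1 := P + f2x; pose r2 := Q - f1x.
have r1E : r1 = 2 * (f1 * fx + (- (V * f1 * F)) * ex + (V * f2) * ex).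
  apply: (mulfI En0); rewrite -[r1]/(E * f1y - F * f1x + f2x) pde1.
  have -> : E * (2 * (f1 * fx + - (V * f1 * F) * ex + V * f2 * ex)) =
    2 * (f1 * E * fx - (E * V) * f1 * F * ex + (E * V) * f2 * ex) by ring.
  by rewrite EV; ring.
have r2E : r2 = 2 * (f2 * fx + (- (V * f2 * F)) * ex + (- (V * f1)) * ex).
  apply: (mulfI En0); rewrite -[r2]/(E * f2y - F * f2x - f1x) pde2.
  have -> : E * (2 * (f2 * fx + - (V * f2 * F) * ex + - (V * f1) * ex)) =
    2 * (f2 * E * fx - (E * V) * f2 * F * ex - (E * V) * f1 * ex) by ring.
  by rewrite EV; ring.
have e0 : 0 <= fx ^+ 2 + ex ^+ 2 by rewrite addr_ge0 ?sqr_ge0.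
(* 24 = 4 * 3 * 2: the square of the outer factor 2, the three summands, and the two terms in ex,
   each at most B^3 ex^2. *)
have rbound (p q s : R) : p ^+ 2 <= B -> s ^+ 2 <= B -> q = s \/ q = - s ->
    (2 * (p * fx + (- (V * p * F)) * ex + (V * q) * ex)) ^+ 2 <= 24 * B ^+ 3 * (fx ^+ 2 + ex ^+ 2).
  move=> pB sB qs; have qB : q ^+ 2 <= B by case: qs => ->; rewrite ?sqrrN.
  rewrite exprMn; have := sqrD3_le (p * fx) (- (V * p * F) * ex) (V * q * ex).
  have h1 : (p * fx) ^+ 2 <= B * fx ^+ 2 by exact: sqrM_le.
  have h2 : (- (V * p * F) * ex) ^+ 2 <= B ^+ 3 * ex ^+ 2.
    apply: sqrM_le; rewrite sqrrN !exprMn; rewrite (_ : B ^+ 3 = B * B * B); last by ring.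
    have vp : V ^+ 2 * p ^+ 2 <= B * B by apply: ler_pM; rewrite ?sqr_ge0.
    by apply: ler_pM; rewrite ?sqr_ge0 // mulr_ge0 ?sqr_ge0.
  have h3 : (V * q * ex) ^+ 2 <= B ^+ 2 * ex ^+ 2.
    apply: sqrM_le; rewrite exprMn (_ : B ^+ 2 = B * B); last by ring.
    by apply: ler_pM; rewrite ?sqr_ge0.
  have k1 : B * fx ^+ 2 <= B ^+ 3 * fx ^+ 2.
    by apply: ler_wpM2r; rewrite ?sqr_ge0 // -[leLHS]expr1 Bmono.
  have k2 : B ^+ 2 * ex ^+ 2 <= B ^+ 3 * ex ^+ 2.
    by apply: ler_wpM2r; rewrite ?sqr_ge0 // Bmono.
  have k3 : 0 <= B ^+ 3 * fx ^+ 2 by rewrite mulr_ge0 ?sqr_ge0.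
  have k4 : 0 <= B ^+ 3 * ex ^+ 2 by rewrite mulr_ge0 ?sqr_ge0.
  set X := (_ + _ + _) ^+ 2; move: X h1 h2 h3 k1 k2 k3 k4 => X.
  clear; rewrite mulrDr; lra.
have r1B : r1 ^+ 2 <= 24 * B ^+ 3 * (fx ^+ 2 + ex ^+ 2).
  by rewrite r1E; apply: (rbound _ _ f2) => //; left.
have r2B : r2 ^+ 2 <= 24 * B ^+ 3 * (fx ^+ 2 + ex ^+ 2).
  have -> : r2 = 2 * (f2 * fx + (- (V * f2 * F)) * ex + (V * - f1) * ex).
    by rewrite r2E; ring.
  by apply: (rbound _ _ f1) => //; right.
pose J := f1x * f2y - f1y * f2x.
pose S := P ^+ 2 + Q ^+ 2 + f1x ^+ 2 + f2x ^+ 2.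
(* The cross terms P f2_x - Q f1_x equal - E J, as the contributions of F cancel. Multiplying by V =
   1 / E leaves J with the constant coefficient 2. *)
have SE : S = r1 ^+ 2 + r2 ^+ 2 + 2 * E * J by rewrite /S /r1 /r2 /P /Q /J; ring.
have S0 : 0 <= S by rewrite /S !addr_ge0 ?sqr_ge0.
have VS : V * S = V * (r1 ^+ 2 + r2 ^+ 2) + 2 * J.
  by rewrite SE; transitivity (V * (r1 ^+ 2 + r2 ^+ 2) + 2 * (E * V) * J); [ring|rewrite EV; ring].
have SB : S <= B * (V * S).
  have -> : S = E * (V * S) by rewrite mulrA EV mul1r.
  rewrite [in leRHS](_ : V * (E * (V * S)) = V * S); last by rewrite mulrA (mulrC V) EV mul1r.
  by apply: ler_wpM2r => //; rewrite mulr_ge0 // ltW.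
have VSB : V * S <= 48 * B ^+ 4 * (fx ^+ 2 + ex ^+ 2) + 2 * J.
  rewrite VS lerD2r; apply: (@le_trans _ _ (B * (r1 ^+ 2 + r2 ^+ 2))).
    by apply: ler_wpM2r => //; rewrite addr_ge0 ?sqr_ge0.
  rewrite (_ : 48 * B ^+ 4 * (fx ^+ 2 + ex ^+ 2) = B * (24 * B ^+ 3 * (fx ^+ 2 + ex ^+ 2) + 24 * B ^+ 3 * (fx ^+ 2 + ex ^+ 2))); last by ring.
  by apply: ler_wpM2l => //; exact: lerD.
have ybound (p q : R) : V * (p + F * q) = V * p + (V * F) * q by ring.
have yb (p q y : R) : y = V * p + (V * F) * q -> y ^+ 2 <= 2 * B ^+ 2 * (p ^+ 2 + q ^+ 2).
  move=> ->; have h1 : (V * p) ^+ 2 <= B ^+ 2 * p ^+ 2.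
    by apply: sqrM_le; apply: (le_trans VB); rewrite -[leLHS]expr1 Bmono.
  have h2 : (V * F * q) ^+ 2 <= B ^+ 2 * q ^+ 2.
    apply: sqrM_le; rewrite exprMn (_ : B ^+ 2 = B * B); last by ring.
    by apply: ler_pM; rewrite ?sqr_ge0.
  have := sqrD_le (V * p) (V * F * q); move: h1 h2; clear; lra.
have f1yE : f1y = V * P + (V * F) * f1x.
  by rewrite /P; transitivity ((E * V) * f1y); [rewrite EV mul1r|ring].
have f2yE : f2y = V * Q + (V * F) * f2x.
  by rewrite /Q; transitivity ((E * V) * f2y); [rewrite EV mul1r|ring].
have y1 := yb _ _ _ f1yE; have y2 := yb _ _ _ f2yE.
(* The y-derivatives are recovered from P and Q. With [VSB] this gives the constants 3 * 48 B^7 and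
   3 * 2 B^3 of the statement. *)
have D1 : f1x ^+ 2 + f1y ^+ 2 + f2x ^+ 2 + f2y ^+ 2 <= 3 * B ^+ 2 * S.
  have b1 : f1x ^+ 2 <= B ^+ 2 * f1x ^+ 2.
    by apply: ler_peMl; rewrite ?sqr_ge0 // -[leLHS](expr0 B) Bmono.
  have b2 : f2x ^+ 2 <= B ^+ 2 * f2x ^+ 2.
    by apply: ler_peMl; rewrite ?sqr_ge0 // -[leLHS](expr0 B) Bmono.
  have p0 : 0 <= B ^+ 2 * P ^+ 2 by rewrite mulr_ge0 ?sqr_ge0.
  have q0 : 0 <= B ^+ 2 * Q ^+ 2 by rewrite mulr_ge0 ?sqr_ge0.
  rewrite /S; move: y1 y2 b1 b2 p0 q0; clear; lra.
apply: (le_trans D1); have h : S <= B * (48 * B ^+ 4 * (fx ^+ 2 + ex ^+ 2) + 2 * J).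
  by apply: (le_trans SB); apply: ler_wpM2l.
apply: (@le_trans _ _ (3 * B ^+ 2 * (B * (48 * B ^+ 4 * (fx ^+ 2 + ex ^+ 2) + 2 * J)))).
  by apply: ler_wpM2l => //; rewrite mulr_ge0.
by rewrite le_eqVlt; apply/orP; left; apply/eqP; rewrite /J; ring.
Qed.

(** Here f1 = E_t and H = F_t, while hx and hy are the space derivatives of F_t, found by
    differentiating f2 = F E_t - E F_t. From 2 a b <= a^2 + b^2 the claim reduces to
    [gradient_bound], and the factor of the null form depends on B alone. *)
Lemma energy_inequality (B E V F H f1 f2 ex ey fx fy f1x f1y f2x f2y hx hy : R) :
  1 <= B -> 0 < E -> E * V = 1 -> E <= B -> V ^+ 2 <= B -> F ^+ 2 <= B ->
  f1 ^+ 2 <= B -> f2 ^+ 2 <= B -> H ^+ 2 <= B ->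
  E * (E * f1y - F * f1x + f2x) = 2 * (f1 * (E * fx - ex * F) + f2 * ex) ->
  E * (E * f2y - F * f2x - f1x) = 2 * (f2 * (E * fx - ex * F) - f1 * ex) ->
  E * hx + ex * H = fx * f1 + F * f1x - f2x ->
  E * hy + ey * H = fy * f1 + F * f1y - f2y ->
  2 * (ex * f1x + ey * f1y + fx * hx + fy * hy) <=
  (1 + 4 * B ^+ 2) * ((1 + 144 * B ^+ 7) * (ex ^+ 2 + ey ^+ 2 + fx ^+ 2 + fy ^+ 2)
    + 6 * B ^+ 3 * (f1x * f2y - f1y * f2x)).
Proof.
move=> B1 E0 EV EB VB FB f1B f2B HB pde1 pde2 dx dy.
have G := gradient_bound B1 E0 EV EB VB FB f1B f2B pde1 pde2.
have B0 : 0 <= B by lra.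
have Bge0 (i : nat) : 0 <= B ^+ i by exact: exprn_ge0.
have hb (a b c d h : R) : E * h + a * H = b * f1 + F * c - d ->
    h ^+ 2 <= 4 * B ^+ 2 * (a ^+ 2 + b ^+ 2 + c ^+ 2 + d ^+ 2).
  move=> eh; have -> : h = V * f1 * b + V * F * c + (- V) * d + (- (V * H)) * a.
    transitivity (V * (E * h + a * H) - V * H * a).
      by transitivity ((E * V) * h); [rewrite EV mul1r|ring].
    by rewrite eh; ring.
  apply: (le_trans (sqrD4_le _ _ _ _)).
  have sq (p q x : R) : p ^+ 2 <= B -> q ^+ 2 <= B -> (p * q * x) ^+ 2 <= B ^+ 2 * x ^+ 2.
    move=> pB qB; apply: sqrM_le; rewrite exprMn (_ : B ^+ 2 = B * B); last by ring.
    by apply: ler_pM; rewrite ?sqr_ge0.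
  have h1 := sq _ _ b VB f1B; have h2 := sq _ _ c VB FB; have h4 := sq _ _ a VB HB.
  have h3 : (- V * d) ^+ 2 <= B ^+ 2 * d ^+ 2.
    apply: sqrM_le; rewrite sqrrN; apply: (le_trans VB).
    by rewrite -[leLHS]expr1 ler_weXn2l.
  have h4' : (- (V * H) * a) ^+ 2 <= B ^+ 2 * a ^+ 2 by rewrite mulNr sqrrN.
  move: h1 h2 h3 h4'; clear; lra.
have hX := hb _ _ _ _ _ dx; have hY := hb _ _ _ _ _ dy.
have s1 := sqr_ge0 (ex - f1x); have s2 := sqr_ge0 (ey - f1y).
have s3 := sqr_ge0 (fx - hx); have s4 := sqr_ge0 (fy - hy).
pose e := ex ^+ 2 + ey ^+ 2 + fx ^+ 2 + fy ^+ 2.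
pose D := f1x ^+ 2 + f1y ^+ 2 + f2x ^+ 2 + f2y ^+ 2.
have D0 : 0 <= f2x ^+ 2 + f2y ^+ 2 by rewrite addr_ge0 ?sqr_ge0.
have step1 : 2 * (ex * f1x + ey * f1y + fx * hx + fy * hy) <= (1 + 4 * B ^+ 2) * (e + D).
  rewrite /e /D; move: hX hY s1 s2 s3 s4 D0; clear; lra.
apply: (le_trans step1); apply: ler_wpM2l; first by rewrite addr_ge0 // mulr_ge0.
have b0 : 0 <= 144 * B ^+ 7 * (ey ^+ 2 + fy ^+ 2).
  by rewrite mulr_ge0 ?addr_ge0 ?sqr_ge0 // mulr_ge0.
rewrite /e /D; move: G b0; clear; lra.
Qed.

End EnergyInequality.

Section DerivativeRules.
Variables (R : realType) (V : normedModType R).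
Implicit Types (f g : V -> R) (x v : V).

Lemma is_derive_mul f g x v (df dg : R) : is_derive x v f df -> is_derive x v g dg ->
  is_derive x v (fun y => f y * g y) (df * g x + f x * dg).
Proof.
move=> hf hg; have h := is_deriveM hf hg.
by split; [exact: (@ex_derive _ _ _ _ _ _ _ h)|rewrite (@derive_val _ _ _ _ _ _ _ h) /GRing.scale /= addrC mulrC].
Qed.

Lemma is_derive_add f g x v (df dg : R) : is_derive x v f df -> is_derive x v g dg ->
  is_derive x v (fun y => f y + g y) (df + dg).
Proof. by move=> hf hg; exact: is_deriveD. Qed.

Lemma is_derive_sub f g x v (df dg : R) : is_derive x v f df -> is_derive x v g dg ->
  is_derive x v (fun y => f y - g y) (df - dg).
Proof. by move=> hf hg; exact: is_deriveB. Qed.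

Lemma is_derive_const x v (k : R) : is_derive x v (fun=> k) 0.
Proof. exact: is_derive_cst. Qed.

Lemma smooth_on_is_derive (O : set V) f x v : open O -> smooth_on O f -> O x ->
  is_derive x v f ('D_v f x).
Proof. by move=> oO sf Ox; apply/derivableP/(smooth_on_derivable (O := O)). Qed.

Lemma eq_is_derive (O : set V) f g x v (d d' : R) : open O -> O x ->
  (forall y, O y -> f y = g y) -> is_derive x v f d -> is_derive x v g d' -> d = d'.
Proof.
move=> oO Ox fg hf hg.
rewrite -(@derive_val _ _ _ _ _ _ _ hf) -(@derive_val _ _ _ _ _ _ _ hg).
by apply: near_eq_derive; apply: filterS (open_nbhs_nbhs (conj oO Ox)).
Qed.

Lemma eq_is_derive_val (O : set V) f g x v (d : R) : open O -> O x ->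
  (forall y, O y -> f y = g y) -> is_derive x v g d -> 'D_v f x = d.
Proof.
move=> oO Ox fg hg; rewrite -(@derive_val _ _ _ _ _ _ _ hg).
by apply: near_eq_derive; apply: filterS (open_nbhs_nbhs (conj oO Ox)).
Qed.

End DerivativeRules.

Section HolomorphicPde.
Variable R : realType.

Lemma Re_mul_sqr (k x y : R) (c : R[i]) : k * complex.Re (c * (x +i* y)%C * (x +i* y)%C) =
  k * (complex.Re c * (x * x - y * y) - 2 * complex.Im c * x * y).
Proof. by case: c => u v /=; ring. Qed.

Lemma Im_mul_sqr (k x y : R) (c : R[i]) : k * complex.Im (c * (x +i* y)%C * (x +i* y)%C) =
  k * (2 * complex.Re c * x * y + complex.Im c * (x * x - y * y)).
Proof. by case: c => u v /=; ring. Qed.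

(** The derivatives appear in the raw shape left by the product rule, zeros included, so that
    computed derivatives match. The Cauchy-Riemann equations along dp and dq become psi_x w_y =
    psi_y w_x, split into [h5] and [h6]. *)
Lemma beltrami_pointwise (E F Ex Fx px py qx qy pxx pxy qxx qxy a b ax ay bx by' k : R)
    (f1 f1x f1y f2 f2x f2y s1 t1 s2 t2 J : R) : J != 0 ->
  s1 = qy / J -> t1 = - qx / J -> s2 = - py / J -> t2 = px / J ->
  Ex * py + E * pxy = Fx * px + F * pxx - (0 * qx + 1 * qxx) ->
  Ex * qy + E * qxy = Fx * qx + F * qxx + (0 * px + 1 * pxx) ->
  E * py = F * px - 1 * qx -> E * qy = F * qx + 1 * px ->
  let sq := px * px - qx * qx in
  let dsq pd qd := pd * px + px * pd - (qd * qx + qx * qd) in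
  let d1 ad bd pd qd := 0 * (a * sq - 2 * b * px * qx) + k * (ad * sq + a * dsq pd qd -
    (((0 * b + 2 * bd) * px + 2 * b * pd) * qx + 2 * b * px * qd)) in
  let d2 ad bd pd qd := 0 * (2 * a * px * qx + b * sq) + k *
    (((0 * a + 2 * ad) * px + 2 * a * pd) * qx + 2 * a * px * qd + (bd * sq + b * dsq pd qd)) in
  f1x = d1 ax bx pxx qxx -> f1y = d1 ay by' pxy qxy ->
  f2x = d2 ax bx pxx qxx -> f2y = d2 ay by' pxy qxy ->
  f1 = k * (a * sq - 2 * b * px * qx) -> f2 = k * (2 * a * px * qx + b * sq) ->
  s1 * ax + t1 * ay = s2 * bx + t2 * by' ->
  s2 * ax + t2 * ay = - (s1 * bx + t1 * by') ->
  E * (E * f1y - F * f1x + f2x) = 2 * (f1 * (E * Fx - Ex * F) + f2 * Ex) /\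
  E * (E * f2y - F * f2x - f1x) = 2 * (f2 * (E * Fx - Ex * F) - f1 * Ex).
Proof.
move=> J0 -> -> -> -> h3 h4 h1 h2 sq dsq d1 d2 -> -> -> -> -> -> c1 c2.
have h5 : ax * py - bx * qy = ay * px - by' * qx.
  have /(congr1 (fun x => - (J * x))) := c2; rewrite /= => e; clear -e J0.
  transitivity (- (J * (- py / J * ax + px / J * ay)) + ay * px - bx * qy); first by field.
  by rewrite e; field.
have h6 : ax * qy + bx * py = ay * qx + by' * px.
  have /(congr1 (fun x => J * x)) := c1; rewrite /= => e; clear -e J0.
  transitivity (J * (qy / J * ax + - qx / J * ay) + ay * qx + bx * py); first by field.
  by rewrite e; field.
have h3' : Ex * py + E * pxy = Fx * px + F * pxx - qxx by rewrite h3; ring.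
have h4' : Ex * qy + E * qxy = Fx * qx + F * qxx + pxx by rewrite h4; ring.
have [P1 P2] := beltrami_algebra_real a b k h1 h2 h3' h4' h5 h6.
clear -P1 P2; rewrite /d1 /d2 /dsq /sq.
by split; [move: P1|move: P2]; clear; lra.
Qed.

(** Locally f = k psi w_x^2. The relation E w_y = (F + i) w_x is differentiated along x, with w_xy =
    w_yx, and combined with the Cauchy-Riemann equations; w then drops out, so the result is
    global. *)
Lemma holomorphic_pde (g : R * R -> 'M[R]_2) (Psi : qdiff R) (k : R) (f1 f2 : R * R -> R) z0 :
  let E z := g z 0 0 in let F z := g z 0 1 in
  smooth_on setT E -> smooth_on setT F ->
  (forall z, 0 < E z) -> (forall z, g z 1 0 = F z) -> (forall z, \det (g z) = 1) ->
  holomorphic_qdiff g Psi ->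
  (forall z, f1 z = k * complex.Re (Psi z 0 0)) -> (forall z, f2 z = k * complex.Im (Psi z 0 0)) ->
  E z0 * (E z0 * 'D_(e2 1) f1 z0 - F z0 * 'D_(e2 0) f1 z0 + 'D_(e2 0) f2 z0) =
    2 * (f1 z0 * (E z0 * 'D_(e2 0) F z0 - 'D_(e2 0) E z0 * F z0) + f2 z0 * 'D_(e2 0) E z0) /\
  E z0 * (E z0 * 'D_(e2 1) f2 z0 - F z0 * 'D_(e2 0) f2 z0 - 'D_(e2 0) f1 z0) =
    2 * (f2 z0 * (E z0 * 'D_(e2 0) F z0 - 'D_(e2 0) E z0 * F z0) - f1 z0 * 'D_(e2 0) E z0).
Proof.
move=> E F sE sF E0 g10 d1 [_ holo] f1E f2E.
have [Q [w [psi [cw Qz PE [sa sb cr]]]]] := holo z0.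
have [oQ sw _ dj _] := cw.
pose p z : R := (w z).1; pose q z : R := (w z).2.
pose a z := complex.Re (psi z); pose b z := complex.Im (psi z).
have sp : smooth_on Q p := smooth_on_functional (@fst_lin_continuous R) oQ sw.
have sq : smooth_on Q q := smooth_on_functional (@snd_lin_continuous R) oQ sw.
have wE i z : Q z -> 'D_(e2 i) w z = ('D_(e2 i) p z, 'D_(e2 i) q z).
  move=> Oz; have dw' : derivable w z (e2 i) by apply: (smooth_on_derivable (O := Q)).
  have [_ e1] := derive_functional (@fst_lin_continuous R) dw'.
  have [_ e2'] := derive_functional (@snd_lin_continuous R) dw'.
  by rewrite [LHS]surjective_pairing; congr pair; [exact: esym e1|exact: esym e2'].
pose px := 'D_(e2 0) p; pose py := 'D_(e2 1) p; pose qx := 'D_(e2 0) q; pose qy := 'D_(e2 1) q.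
have spx : smooth_on Q px by exact: smooth_on_derive.
have spy : smooth_on Q py by exact: smooth_on_derive.
have sqx : smooth_on Q qx by exact: smooth_on_derive.
have sqy : smooth_on Q qy by exact: smooth_on_derive.
have D1 z : 1 ^+ 2 = \det (g z) by rewrite d1 expr1n.
have cf1 z : Q z -> E z * py z = F z * px z - 1 * qx z.
  move=> Oz; have [h _] := conformal_dw cw Oz (E0 z) (g10 z) ltr01 (D1 z).
  by move: h; rewrite !wE.
have cf2 z : Q z -> E z * qy z = F z * qx z + 1 * px z.
  move=> Oz; have [_ h] := conformal_dw cw Oz (E0 z) (g10 z) ltr01 (D1 z).
  by move: h; rewrite !wE.
have oT : open [set: R * R] by exact: openT.
have dE v : is_derive z0 v E ('D_v E z0) by exact: (smooth_on_is_derive v oT sE).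
have dF v : is_derive z0 v F ('D_v F z0) by exact: (smooth_on_is_derive v oT sF).
have dpx v : is_derive z0 v px ('D_v px z0) by exact: (smooth_on_is_derive v oQ spx).
have dpy v : is_derive z0 v py ('D_v py z0) by exact: (smooth_on_is_derive v oQ spy).
have dqx v : is_derive z0 v qx ('D_v qx z0) by exact: (smooth_on_is_derive v oQ sqx).
have dqy v : is_derive z0 v qy ('D_v qy z0) by exact: (smooth_on_is_derive v oQ sqy).
have da v : is_derive z0 v a ('D_v a z0) by exact: (smooth_on_is_derive v oQ sa).
have db v : is_derive z0 v b ('D_v b z0) by exact: (smooth_on_is_derive v oQ sb).
have c1 v : is_derive z0 v (fun=> 1 : R) 0 by exact: is_derive_const.
have h3 := eq_is_derive oQ Qz cf1 (is_derive_mul (dE (e2 0)) (dpy (e2 0)))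
  (is_derive_sub (is_derive_mul (dF (e2 0)) (dpx (e2 0))) (is_derive_mul (c1 (e2 0)) (dqx (e2 0)))).
have h4 := eq_is_derive oQ Qz cf2 (is_derive_mul (dE (e2 0)) (dqy (e2 0)))
  (is_derive_add (is_derive_mul (dF (e2 0)) (dqx (e2 0))) (is_derive_mul (c1 (e2 0)) (dpx (e2 0)))).
have sch1 : 'D_(e2 0) py z0 = 'D_(e2 1) px z0 by exact: (schwarz _ _ oQ sp Qz).
have sch2 : 'D_(e2 0) qy z0 = 'D_(e2 1) qx z0 by exact: (schwarz _ _ oQ sq Qz).
rewrite sch1 in h3; rewrite sch2 in h4.
have dwE z : Q z -> dw w z 0 = (px z +i* qx z)%C by move=> Oz; rewrite /dw (wE 0 z Oz).
have f1Q z : Q z -> f1 z = k * (a z * (px z * px z - qx z * qx z) - 2 * b z * px z * qx z).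
  by move=> Oz; rewrite (f1E z) (PE z Oz 0 0) (dwE z Oz); exact: Re_mul_sqr.
have f2Q z : Q z -> f2 z = k * (2 * a z * px z * qx z + b z * (px z * px z - qx z * qx z)).
  by move=> Oz; rewrite (f2E z) (PE z Oz 0 0) (dwE z Oz); exact: Im_mul_sqr.
have ck (c : R) v : is_derive z0 v (fun=> c) 0 by exact: is_derive_const.
have dsq v := is_derive_sub (is_derive_mul (dpx v) (dpx v)) (is_derive_mul (dqx v) (dqx v)).
have d1' v := is_derive_mul (ck k v) (is_derive_sub (is_derive_mul (da v) (dsq v))
  (is_derive_mul (is_derive_mul (is_derive_mul (ck 2 v) (db v)) (dpx v)) (dqx v))).
have d2' v := is_derive_mul (ck k v) (is_derive_add
  (is_derive_mul (is_derive_mul (is_derive_mul (ck 2 v) (da v)) (dpx v)) (dqx v))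
  (is_derive_mul (db v) (dsq v))).
have df1 v := eq_is_derive_val oQ Qz f1Q (d1' v).
have df2 v := eq_is_derive_val oQ Qz f2Q (d2' v).
have j0 := dj z0 Qz; have [cr1 cr2] := cr z0 Qz.
have J0 : \det (jac w z0) != 0 by rewrite gt_eqF.
have dpl (h : R * R -> R) s t : smooth_on Q h -> 'D_(s, t) h z0 = s * 'D_(e2 0) h z0 + t * 'D_(e2 1) h z0.
  by move=> sh; exact: (derive_plane s t oQ sh Qz).
have dpe := dpE j0; have dqe := dqE j0.
rewrite (wE 0 z0 Qz) (wE 1 z0 Qz) in dpe dqe.
move: dpe dqe cr1 cr2; case: (dp w z0) => [s1 t1]; case: (dq w z0) => [s2 t2].
rewrite (dpl a s1 t1 sa) (dpl b s2 t2 sb) (dpl a s2 t2 sa) (dpl b s1 t1 sb).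
rewrite -[('D_(e2 1) p z0, _).2]/(qy z0) -[(px z0, qx z0).2]/(qx z0).
move=> [s1E t1E] [s2E t2E].
move: h3 h4 (cf1 z0 Qz) (cf2 z0 Qz) (df1 (e2 0)) (df1 (e2 1)) (df2 (e2 0)) (df2 (e2 1)) (f1Q z0 Qz) (f2Q z0 Qz).
exact: (beltrami_pointwise J0 s1E t1E s2E t2E).
Qed.

End HolomorphicPde.

(** * Rigidity of flat metrics along the flow *)

Section Gronwall.
Variable R : realType.

(** X exp (- K t) is nonincreasing on t > 0, so its value at t is at most C s for every s in ]0, t[.
    The linear bound thus replaces X 0 = 0. *)
Lemma gronwall (X dX : R -> R) (K C t1 : R) : 0 <= K -> 0 <= C ->
  (forall t, 0 < t <= t1 -> is_derive t (1 : R) X (dX t)) ->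
  (forall t, 0 < t <= t1 -> dX t <= K * X t) ->
  (forall t, 0 < t <= t1 -> X t <= C * t) ->
  forall t, 0 < t <= t1 -> X t <= 0.
Proof.
move=> K0 C0 dXX XK XC t /andP[t0 tt1].
pose Y s := X s * expR (- K * s).
have dY s : 0 < s <= t1 -> is_derive s (1 : R) Y (dX s * expR (- K * s) + X s * (- K * expR (- K * s))).
  move=> s01; apply: is_derive_mul; first exact: dXX.
  have h1 : is_derive s (1 : R) (fun s : R => - K * s) (- K).
    have := is_derive_mul (is_derive_const s (1 : R) (- K)) (is_derive_id s (1 : R)).
    by rewrite mul0r add0r mulr1.
  have := @is_derive1_comp R expR (fun s : R => - K * s) s _ _ (is_derive_expR (- K * s)) h1.
  by rewrite mulrC.
have Ys s : 0 < s -> s < t -> Y t <= C * s.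
  move=> s0 st.
  have sub x : x \in `[s, t] -> 0 < x <= t1.
    by rewrite in_itv /= => /andP[sx xt]; rewrite (lt_le_trans s0 sx) (le_trans xt tt1).
  have [||c cst YE] := @MVT R Y (fun x => dX x * expR (- K * x) + X x * (- K * expR (- K * x))) s t st.
  - by move=> x xI; apply/dY/sub; exact: subset_itv_oo_cc.
  - apply: continuous_in_subspaceT => x /set_mem xI.
    apply: differentiable_continuous; apply/derivable1_diffP.
    by have [] := dY x (sub x xI).
  have c01 : 0 < c <= t1 by apply: sub; exact: subset_itv_oo_cc.
  have : Y t - Y s <= 0.
    rewrite YE; apply: mulr_le0_ge0; last by rewrite subr_ge0 ltW.
    rewrite (_ : _ + _ = (dX c - K * X c) * expR (- K * c)); last by ring.
    by apply: mulr_le0_ge0; rewrite ?subr_le0 ?XK // expR_ge0.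
  rewrite subr_le0 => /le_trans; apply; rewrite /Y.
  have s01 : 0 < s <= t1 by rewrite s0 (le_trans (ltW st) tt1).
  have e1 : expR (- K * s) <= 1 by rewrite expR_le1 mulNr oppr_le0 mulr_ge0 // ltW.
  have [Xs|Xs] := leP 0 (X s).
    apply: le_trans (XC s s01); rewrite -[leRHS]mulr1; exact: ler_wpM2l.
  apply: (@le_trans _ _ 0); last by rewrite mulr_ge0 // ltW.
  by apply: mulr_le0_ge0; [exact: ltW|exact: expR_ge0].
have Yt : Y t <= 0.
  rewrite leNgt; apply/negP => Yt0.
  have C1 : 0 < 2 * (C + 1) by rewrite mulr_gt0 // ltr_wpDl.
  (* Chosen so that s < t and C s < Y t. *)
  pose s := Num.min (t / 2) (Y t / (2 * (C + 1))).
  have s0 : 0 < s by rewrite lt_min !divr_gt0.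
  have st : s < t.
    by apply: (@le_lt_trans _ _ (t / 2)); [rewrite ge_min lexx|rewrite ltr_pdivrMr //; lra].
  have := Ys s s0 st; apply/negP; rewrite -ltNge.
  have : s * (2 * (C + 1)) <= Y t by rewrite -ler_pdivlMr // ge_min lexx orbT.
  have := mulr_ge0 C0 (ltW s0); move: s0; clearbody s; clear; lra.
by move: Yt; rewrite /Y pmulr_lle0 // expR_gt0.
Qed.

End Gronwall.

(** * Space-time functions on [0, T[ and at positive times *)

Section TimeSlices.
Variables (R : realType) (T : \bar R).
Local Notation I := (time_interval T).
Local Notation A := (I `*` [set: R * R]).

Definition open_time : set R := [set t | 0 < t /\ (t%:E < T)%E].

Lemma open_open_time : open open_time.
Proof.
have oT : open [set t : R | (t%:E < T)%E].
  case: T => [r| |].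
  - by have := @open_lt R r; congr open; apply/seteqP; split => t /=; rewrite lte_fin.
  - by have := @openT R; congr open; apply/seteqP; split => t //= _; rewrite ltry.
  - by have := @open0 R; congr open; apply/seteqP; split => t.
by apply: (@openI _ [set t : R | 0 < t] _ _ oT); exact: open_gt.
Qed.

Lemma open_time_sub t : open_time t -> I t.
Proof. by move=> [t0 tT]; split => //; exact: ltW. Qed.

Lemma time_interval_pos t : I t -> 0 < t -> open_time t.
Proof. by move=> [_ tT] t0. Qed.

Lemma time_interval_le s t : I t -> 0 <= s <= t -> I s.
Proof.
by move=> [t0 tT] /andP[s0 st]; split => //; apply: le_lt_trans tT; rewrite lee_fin.
Qed.

Lemma eq0_of_derive0 (f : R -> R) : {within I, continuous f} ->
  (forall t, open_time t -> is_derive t (1 : R) f 0) -> forall t, I t -> f t = f 0.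
Proof.
move=> cf df t It; have [t0 _] := It.
have [||c _ E] := @MVT_segment R f (fun=> 0) 0 t t0.
- move=> s; rewrite in_itv /= => /andP[s0 st]; apply: df; apply: time_interval_pos => //.
  by apply: (time_interval_le It); rewrite !ltW.
- apply: continuous_subspaceW cf => s; rewrite /= in_itv /= => sI.
  exact: (time_interval_le It).
by apply/eqP; rewrite -subr_eq0 E mul0r.
Qed.

Definition interior_set : set (R * (R * R)) := fst @^-1` open_time.

Lemma open_interior_set : open interior_set.
Proof. by apply: open_comp; [move=> x _; exact: cvg_fst|exact: open_open_time]. Qed.

Lemma interior_set_sub : interior_set `<=` A.
Proof. by move=> [t z] /open_time_sub It; split. Qed.

Definition dt : R * (R * R) := (1, 0).
Definition dx (i : 'I_2) : R * (R * R) := (0, e2 i).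

Section Function.
Variable phi : R * (R * R) -> R.
Hypothesis sphi : smooth_on A phi.

Lemma slice_set t : I t -> [set z | A (t, z)] = [set: R * R].
Proof. by move=> It; apply/seteqP; split => z // _; split. Qed.

Lemma smooth_slice t : I t -> smooth_on setT (fun z => phi (t, z)).
Proof. by move=> It; rewrite -(slice_set It); exact: smooth_on_slice. Qed.

Lemma dderiv_slice t z v : I t -> dderiv A phi (0, v) (t, z) = 'D_v (fun z => phi (t, z)) z.
Proof.
move=> It; rewrite /dderiv -dquot_slice (slice_set It).
by apply: dderiv_nbhs; exact: filterT.
Qed.

(** Identifies the velocity given by the flow with a space-time derivative, at t = 0 too; this makes
    the velocity smooth on [0, T[ x R^2. *)
Lemma dderiv_time t z l : I t -> time_deriv I (fun s => phi (s, z)) t l ->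
  dderiv A phi dt (t, z) = l.
Proof.
move=> It dl.
have E (h : R) : (t, z) + h *: dt = (t + h, z).
  by congr pair; rewrite /= ?scaler0 ?addr0 // [h *: 1]mulr1.
have AE (h : R) : A ((t, z) + h *: dt) = I (t + h).
  by rewrite E; apply/propext; split => [[]|].
have pF : ProperFilter (within [set h : R | A ((t, z) + h *: dt)] 0^').
  rewrite (_ : [set h : R | A _] = [set h : R | I (t + h)]); first exact: (time_filter_proper It).
  by apply/funext => h; exact: AE.
apply: cvg_lim => //.
move=> P /dl HP.
have {}HP : (0 : R)^' (fun h => I (t + h) -> P (h^-1 *: (phi (t + h, z) - phi (t, z)))) by exact: HP.
change ((0 : R)^' (fun h => A ((t, z) + h *: dt) ->
  P (h^-1 *: (phi ((t, z) + h *: dt) - phi (t, z))))).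
by apply: filterS HP => h HP; rewrite AE E.
Qed.

Lemma interior_is_derive t z : open_time t ->
  is_derive t (1 : R) (fun s => phi (s, z)) (dderiv A phi dt (t, z)).
Proof.
move=> Ot; have oO := open_interior_set.
have sO : smooth_on interior_set phi by apply: smooth_on_sub sphi => //; exact: interior_set_sub.
have nA : nbhs (t, z) A.
  by apply: filterS interior_set_sub _; apply: open_nbhs_nbhs; split.
have E (s : R) : (0, z) + s *: dt = (s, z).
  by congr pair; rewrite /= ?scaler0 ?addr0 // [s *: 1]mulr1 add0r.
have := @is_derive_line R _ _ phi dt (0, z) t; rewrite E (dderiv_nbhs _ _ nA).
rewrite (_ : (fun s => phi ((0, z) + s *: dt)) = (fun s => phi (s, z))); last first.
  by apply/funext => s; rewrite E.
by apply; apply: (smooth_on_derivable (O := interior_set)).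
Qed.

(** [schwarz] in space-time, which asks for an open set and hence for t > 0. *)
Lemma dderiv_commute t z i : open_time t ->
  dderiv A (dderiv A phi (dx i)) dt (t, z) = dderiv A (dderiv A phi dt) (dx i) (t, z).
Proof.
move=> Ot; have oO := open_interior_set.
have sO : smooth_on interior_set phi by apply: smooth_on_sub sphi => //; exact: interior_set_sub.
have nA p : interior_set p -> nbhs p A.
  by move=> Op; apply: filterS interior_set_sub _; apply: open_nbhs_nbhs; split.
have Oz : interior_set (t, z) by [].
have DD v w : dderiv A (dderiv A phi v) w (t, z) = 'D_w ('D_v phi) (t, z).
  rewrite (dderiv_nbhs _ _ (nA _ Oz)); apply: near_eq_derive.
  apply: filterS (open_nbhs_nbhs (conj oO Oz)) => p Op; exact: (dderiv_nbhs _ _ (nA _ Op)).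
by rewrite !DD; exact: (schwarz _ _ oO sO Oz).
Qed.

End Function.

Lemma within_time_slice (phi : R * (R * R) -> R) z : {within A, continuous phi} ->
  {within I, continuous (fun s => phi (s, z))}.
Proof.
move=> /subspace_continuousP cphi; apply/subspace_continuousP => t It.
apply: cvg_trans (cphi (t, z) (conj It Logic.I)) => P.
rewrite /fmap /within /= => -[[P1 P2] [/= H1 H2] HP].
by apply: filterS H1 => s H1 Is; apply: (HP (s, z)) => //; split => //; exact: nbhs_singleton.
Qed.

Lemma within_bounded (phi : R * (R * R) -> R) t1 : {within A, continuous phi} -> I t1 ->
  exists2 C, 0 <= C & forall t z, 0 <= t <= t1 -> unit_square z -> `|phi (t, z)| <= C.
Proof.
move=> cphi It1.
have cK : compact (`[0, t1] `*` @unit_square R).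
  by apply: compact_setX; [exact: segment_compact|exact: unit_square_compact].
have cphi' : {within `[0, t1] `*` @unit_square R, continuous phi}.
  apply: continuous_subspaceW cphi => -[t z] [/= t01 _]; split => //=.
  by apply: (time_interval_le It1); move: t01; rewrite in_itv.
have [M [_ HM]] := compact_bounded (continuous_compact cphi' cK).
exists (`|M| + 1) => [|t z t01 Qz]; first by rewrite addr_ge0.
apply: (HM (`|M| + 1)); first by rewrite (le_lt_trans (ler_norm M)) // ltrDl.
by exists (t, z) => //; split => //=; rewrite in_itv.
Qed.

Lemma within_continuousM (phi psi : R * (R * R) -> R) : {within A, continuous phi} ->
  {within A, continuous psi} -> {within A, continuous (fun p => phi p * psi p)}.
Proof. by move=> c1 c2 x; apply: continuousM; [exact: c1|exact: c2]. Qed.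

End TimeSlices.

Section Auxiliary.
Variable R : realType.

Lemma is_derive_integral_M (f df : R -> R * R -> R) (a b c C : R) : b < a < c ->
  (forall x, b < x < c -> continuous (f x)) ->
  (forall x z, b < x < c -> unit_square z -> is_derive x (1 : R) (f^~ z) (df x z)) ->
  (forall x z, b < x < c -> unit_square z -> `|df x z| <= C) -> 0 <= C ->
  is_derive a (1 : R) (fun x => integral_M (f x)) (integral_M (df a)).
Proof.
move=> bac cf dff dfC C0.
have Ia : `]b, c[%classic a by rewrite /= in_itv.
have dE x z : b < x < c -> unit_square z -> partial1of2 f x z = df x z.
  by move=> bxc Qz; rewrite partial1of2E; exact: (@derive_val _ _ _ _ _ _ _ (dff x z bxc Qz)).
have itvP (x : R) : `]b, c[%classic x -> b < x < c by rewrite /= in_itv.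
have h1 x : `]b, c[%classic x -> (lebesgue_measure \x lebesgue_measure)%E.-integrable (@unit_square R) (EFin \o f x).
  by move=> /itvP /cf; exact: continuous_integrable_plane (@unit_square_compact R).
have h2 x z : `]b, c[%classic x -> unit_square z -> derivable (f^~ z) x 1.
  by move=> /itvP bxc Qz; have [] := dff x z bxc Qz.
have h3 : (lebesgue_measure \x lebesgue_measure)%E.-integrable (@unit_square R) (EFin \o (fun=> C)).
  by apply: continuous_integrable_plane; [exact: unit_square_compact|move=> z; exact: cvg_cst].
have h4 x z : `]b, c[%classic x -> unit_square z -> `|partial1of2 f x z| <= C.
  by move=> /itvP bxc Qz; rewrite dE //; exact: dfC.
have mQ := @measurable_unit_square R.
have dF := derivable_under_integral mQ Ia h1 h2 (fun=> C0) h3 h4.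
have dV := differentiation_under_integral mQ Ia h1 h2 (fun=> C0) h3 h4.
apply: DeriveDef; first exact: dF.
rewrite -derive1E; apply: (etrans dV); apply: eq_Rintegral => z /set_mem Qz.
exact: dE.
Qed.

Lemma periodic_int (f : R * R -> R) i : (forall z, f (z + e2 i) = f z) ->
  forall (m : int) z, f (z + m%:~R *: e2 i) = f z.
Proof.
move=> pf; have pn (k : nat) z : f (z + k%:R *: e2 i) = f z.
  elim: k z => [|k IH] z; first by rewrite scale0r addr0.
  by rewrite -natr1 scalerDl scale1r addrA pf.
move=> [k|k] z; first exact: pn.
by rewrite NegzE mulrNz scaleNr -[RHS](congr1 f (subrK ((k.+1)%:R *: e2 i) z)) pn.
Qed.

Lemma periodic_eq0 (f : R * R -> R) : lattice_periodic e2 f ->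
  (forall z, unit_square z -> f z = 0) -> forall z, f z = 0.
Proof.
move=> pf f0 [x y].
have -> : (x, y) = (x - (Num.floor x)%:~R, y - (Num.floor y)%:~R)
    + (Num.floor x)%:~R *: e2 0 + (Num.floor y)%:~R *: e2 1.
  move: (Num.floor x)%:~R (Num.floor y)%:~R => a b; congr pair; rewrite /= /GRing.scale /=.
    by rewrite mulr1 mulr0 addr0 subrK.
  by rewrite mulr1 mulr0 addr0 subrK.
rewrite !periodic_int ?f0 //; try by move=> z; exact: pf.
have frac (r : R) : `[0, 1]%classic (r - (Num.floor r)%:~R).
  rewrite /= in_itv /= subr_ge0 floor_le /= lerBlDr addrC.
  have := floorD1_gt r; rewrite intrD; exact: ltW.
by split; exact: frac.
Qed.

Lemma constant_of_gradient0 (f : R * R -> R) : smooth_on setT f ->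
  (forall i z, 'D_(e2 i) f z = 0) -> forall z, f z = f 0.
Proof.
move=> sf df z; have oT : open [set: R * R] by exact: openT.
have Dz y : 'D_z f y = 0.
  case: z => a b; rewrite (@derive_plane _ setT f y a b oT sf Logic.I).
  by rewrite (df 0 y) (df 1 y) !mulr0 addr0.
have dl s : is_derive s (1 : R) (fun s : R => f (0 + s *: z)) 0.
  rewrite -(Dz (0 + s *: z)); apply: is_derive_line.
  exact: (smooth_on_derivable oT sf).
have [th _] := @MVT_abs R (fun s : R => f (0 + s *: z)) (fun=> 0) 1 (fun s _ => dl s).
by rewrite mul0r scale1r scale0r !add0r => /eqP; rewrite subr_eq0 => /eqP.
Qed.

End Auxiliary.

Section Translation.
Variables (R : realType) (V : normedModType R).

Lemma dderiv_translate (A : set V) (phi : V -> R) p v x :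
  (forall y, A (y + p) = A y) -> (forall y, A y -> phi (y + p) = phi y) -> A x ->
  dderiv A phi v (x + p) = dderiv A phi v x.
Proof.
move=> Ap fp Ax; rewrite /dderiv; congr lim.
have E (h : R) : x + p + h *: v = x + h *: v + p by rewrite addrAC.
have AE (h : R) : A (x + p + h *: v) = A (x + h *: v) by rewrite E Ap.
apply/seteqP; split => P HP.
  have {}HP : (0 : R)^' (fun h => A (x + p + h *: v) ->
      P (h^-1 *: (phi (x + p + h *: v) - phi (x + p)))) by exact: HP.
  change ((0 : R)^' (fun h => A (x + h *: v) -> P (h^-1 *: (phi (x + h *: v) - phi x)))).
  by apply: filterS HP => h; rewrite AE E (fp x) // => HP Ah; move: (HP Ah); rewrite fp.
have {}HP : (0 : R)^' (fun h => A (x + h *: v) -> P (h^-1 *: (phi (x + h *: v) - phi x))).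
  exact: HP.
change ((0 : R)^' (fun h => A (x + p + h *: v) ->
      P (h^-1 *: (phi (x + p + h *: v) - phi (x + p))))).
by apply: filterS HP => h; rewrite AE E (fp x) // => HP Ah; move: (HP Ah); rewrite fp.
Qed.

End Translation.

Section TimeDependent.
Variables (R : realType) (T : \bar R).
Local Notation I := (time_interval T).
Local Notation A := (I `*` [set: R * R]).

Lemma dderiv_periodic (phi : R * (R * R) -> R) v t : (forall t, I t -> lattice_periodic e2 (fun z => phi (t, z))) ->
  I t -> lattice_periodic e2 (fun z => dderiv A phi v (t, z)).
Proof.
move=> pphi It i z.
have E (s : R) y : (s, y) + (0, e2 i) = (s, y + e2 i) :> R * (R * R) by congr pair; rewrite /= addr0.
rewrite -E; apply: dderiv_translate => //.
- by move=> [s y]; rewrite E; apply/propext; split => -[].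
- by move=> [s y] [/= Is _]; rewrite E; exact: pphi.
Qed.

Lemma within_continuousV (phi : R * (R * R) -> R) : {within A, continuous phi} ->
  (forall p, A p -> phi p != 0) -> {within A, continuous (fun p => (phi p)^-1)}.
Proof.
move=> /subspace_continuousP cphi phi0; apply/subspace_continuousP => p Ap.
by apply: cvgV; [exact: phi0|exact: cphi].
Qed.

End TimeDependent.

(** * The energy method *)

Section EnergyMethod.
Variables (R : realType) (T : \bar R).
Local Notation I := (time_interval T).
Local Notation A := (I `*` [set: R * R]).

Lemma sqr_bound (x C B : R) : `|x| <= C -> C ^+ 2 <= B -> x ^+ 2 <= B.
Proof.
move=> xC; apply: le_trans; rewrite -real_normK ?num_real //.
by apply: lerXn2r => //; rewrite nnegrE (le_trans _ xC).
Qed.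

Lemma slice_is_derive (phi : R * (R * R) -> R) t z i : smooth_on A phi -> I t ->
  is_derive z (e2 i) (fun z => phi (t, z)) (dderiv A phi (dx R i) (t, z)).
Proof.
move=> sphi It; rewrite (dderiv_slice _ _ _ It).
apply: (smooth_on_is_derive _ openT) => //; exact: smooth_slice.
Qed.

Lemma slice_derive (phi : R * (R * R) -> R) t z i : smooth_on A phi -> I t ->
  'D_(e2 i) (fun z => phi (t, z)) z = dderiv A phi (dx R i) (t, z).
Proof. by move=> sphi It; rewrite (dderiv_slice _ _ _ It). Qed.

Lemma common_bound (c a1 a2 a3 a4 a5 : R) : 0 <= c -> exists B, [/\ 1 <= B, c <= B &
  [/\ a1 ^+ 2 <= B, a2 ^+ 2 <= B & [/\ a3 ^+ 2 <= B, a4 ^+ 2 <= B & a5 ^+ 2 <= B]]].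
Proof.
move=> c0; exists (1 + c + a1 ^+ 2 + a2 ^+ 2 + a3 ^+ 2 + a4 ^+ 2 + a5 ^+ 2).
have := sqr_ge0 a1; have := sqr_ge0 a2; have := sqr_ge0 a3.
have := sqr_ge0 a4; have := sqr_ge0 a5.
by do !split; lra.
Qed.

Variables E F : R * (R * R) -> R.
Hypotheses (sE : smooth_on A E) (sF : smooth_on A F).
Hypothesis E_gt0 : forall p, A p -> 0 < E p.
Hypotheses (pE : forall t, I t -> lattice_periodic e2 (fun z => E (t, z)))
           (pF : forall t, I t -> lattice_periodic e2 (fun z => F (t, z))).

Local Notation Et := (dderiv A E (dt R)).
Local Notation Ft := (dderiv A F (dt R)).
Local Notation E_ i := (dderiv A E (dx R i)).
Local Notation F_ i := (dderiv A F (dx R i)).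
Local Notation Et_ i := (dderiv A Et (dx R i)).
Local Notation Ft_ i := (dderiv A Ft (dx R i)).

(** This is k Im Psi_xx in terms of the metric: the real part of k Psi_xy = mu k Psi_xx reads E F_t
    = F E_t - f2. *)
Definition conj_rate (p : R * (R * R)) : R := F p * Et p - E p * Ft p.
Local Notation f2 := conj_rate.

Hypothesis pde1 : forall t z, I t ->
  E (t, z) * (E (t, z) * 'D_(e2 1) (fun z => Et (t, z)) z
    - F (t, z) * 'D_(e2 0) (fun z => Et (t, z)) z + 'D_(e2 0) (fun z => f2 (t, z)) z) =
  2 * (Et (t, z) * (E (t, z) * 'D_(e2 0) (fun z => F (t, z)) z
    - 'D_(e2 0) (fun z => E (t, z)) z * F (t, z)) + f2 (t, z) * 'D_(e2 0) (fun z => E (t, z)) z).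
Hypothesis pde2 : forall t z, I t ->
  E (t, z) * (E (t, z) * 'D_(e2 1) (fun z => f2 (t, z)) z
    - F (t, z) * 'D_(e2 0) (fun z => f2 (t, z)) z - 'D_(e2 0) (fun z => Et (t, z)) z) =
  2 * (f2 (t, z) * (E (t, z) * 'D_(e2 0) (fun z => F (t, z)) z
    - 'D_(e2 0) (fun z => E (t, z)) z * F (t, z)) - Et (t, z) * 'D_(e2 0) (fun z => E (t, z)) z).
Hypotheses (initE : forall z i, E_ i (0, z) = 0) (initF : forall z i, F_ i (0, z) = 0).

Let sEt : smooth_on A Et. Proof. exact: smooth_on_dderiv. Qed.
Let sFt : smooth_on A Ft. Proof. exact: smooth_on_dderiv. Qed.

Definition energy p := E_ 0 p * E_ 0 p + E_ 1 p * E_ 1 p + F_ 0 p * F_ 0 p + F_ 1 p * F_ 1 p.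
Definition energy_rate p :=
  2 * (E_ 0 p * Et_ 0 p + E_ 1 p * Et_ 1 p + F_ 0 p * Ft_ 0 p + F_ 1 p * Ft_ 1 p).
Definition null_form t z :=
  'D_(e2 0) (fun z => Et (t, z)) z * 'D_(e2 1) (fun z => f2 (t, z)) z
    - 'D_(e2 1) (fun z => Et (t, z)) z * 'D_(e2 0) (fun z => f2 (t, z)) z.

Lemma energy_is_derive t z : open_time T t ->
  is_derive t (1 : R) (fun s => energy (s, z)) (energy_rate (t, z)).
Proof.
move=> Ot.
have d (phi : R * (R * R) -> R) i : smooth_on A phi ->
    is_derive t (1 : R) (fun s => dderiv A phi (dx R i) (s, z)) (dderiv A (dderiv A phi (dt R)) (dx R i) (t, z)).
  by move=> sphi; rewrite -(dderiv_commute sphi z i Ot); apply: interior_is_derive Ot; exact: smooth_on_dderiv.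
have dd phi i sphi := is_derive_mul (d phi i sphi) (d phi i sphi).
apply: is_derive_change (is_derive_add (is_derive_add (is_derive_add
  (dd E 0 sE) (dd E 1 sE)) (dd F 0 sF)) (dd F 1 sF)) _.
rewrite /energy_rate.
move: (E_ 0 _) (E_ 1 _) (F_ 0 _) (F_ 1 _) (Et_ 0 _) (Et_ 1 _) (Ft_ 0 _) (Ft_ 1 _) => a b c e a' b' c' e'.
ring.
Qed.

Lemma smooth_conj_rate t : I t -> smooth_on setT (fun z => f2 (t, z)).
Proof.
move=> It; apply: (@smooth_onB _ _ setT (fun z => F (t, z) * Et (t, z)) (fun z => E (t, z) * Ft (t, z)));
  [exact: openT| |]; apply: smooth_onM; try exact: openT; exact: smooth_slice.
Qed.

Lemma conj_rate_derive t z i : I t -> 'D_(e2 i) (fun z => f2 (t, z)) z =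
  (F_ i (t, z) * Et (t, z) + F (t, z) * Et_ i (t, z)) - (E_ i (t, z) * Ft (t, z) + E (t, z) * Ft_ i (t, z)).
Proof.
move=> It.
exact: (@derive_val _ _ _ _ _ _ _ (is_derive_sub
  (is_derive_mul (slice_is_derive z i sF It) (slice_is_derive z i sEt It))
  (is_derive_mul (slice_is_derive z i sE It) (slice_is_derive z i sFt It)))).
Qed.

(** Compactness of [0, t1] times the square bounds E, 1 / E, F, E_t, F_t and f2 by one constant B,
    hence the coefficients do not depend on t or z. *)
Lemma energy_rate_le t1 : I t1 -> exists K K2, 0 <= K /\
  forall t z, 0 <= t <= t1 -> unit_square z ->
    energy_rate (t, z) <= K * energy (t, z) + K2 * null_form t z.
Proof.
move=> It1.
have cE := smooth_on_within sE; have cF := smooth_on_within sF.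
have cEt := smooth_on_within sEt; have cFt := smooth_on_within sFt.
have cV : {within A, continuous (fun p => (E p)^-1)}.
  by apply: within_continuousV => // p Ap; rewrite gt_eqF ?E_gt0.
have cf2 : {within A, continuous f2}.
  have := within_continuousM cF cEt; have := within_continuousM cE cFt => c1 c2 x.
  exact: (continuousB (c2 x) (c1 x)).
have [CE CE0 bE] := within_bounded cE It1; have [CF CF0 bF] := within_bounded cF It1.
have [C1 C10 b1] := within_bounded cEt It1; have [C3 C30 b3] := within_bounded cFt It1.
have [CV CV0 bV] := within_bounded cV It1; have [C2 C20 b2] := within_bounded cf2 It1.
have [B [B1 BE [BV BF [Bf1 Bf2 BH]]]] := common_bound CV CF C1 C2 C3 CE0.
exists ((1 + 4 * B ^+ 2) * (1 + 144 * B ^+ 7)), ((1 + 4 * B ^+ 2) * (6 * B ^+ 3)).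
have B0 : 0 <= B by apply: le_trans B1.
split; first by rewrite !mulr_ge0 ?addr_ge0 ?mulr_ge0 ?exprn_ge0.
move=> t z t01 Qz; have It := time_interval_le It1 t01.
have E0 : 0 < E (t, z) by apply: E_gt0.
have EV : E (t, z) * (E (t, z))^-1 = 1 by rewrite divff // gt_eqF.
have h1 : E (t, z) <= B by apply: le_trans (ler_norm _) (le_trans (bE t z t01 Qz) BE).
have h2 := sqr_bound (bV t z t01 Qz) BV; have h3 := sqr_bound (bF t z t01 Qz) BF.
have h4 := sqr_bound (b1 t z t01 Qz) Bf1; have h5 := sqr_bound (b2 t z t01 Qz) Bf2.
have h6 := sqr_bound (b3 t z t01 Qz) BH.
have p1 := pde1 z It; have p2 := pde2 z It.
have r0 := conj_rate_derive z 0 It; have r1 := conj_rate_derive z 1 It.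
rewrite (slice_derive z 0 sE It) (slice_derive z 0 sF It) (slice_derive z 0 sEt It) (slice_derive z 1 sEt It) in p1 p2.
rewrite /energy /energy_rate /null_form (slice_derive z 0 sEt It) (slice_derive z 1 sEt It).
move: {b1 b2 b3 bE bF bV} E0 EV h1 h2 h3 h4 h5 h6 p1 p2 r0 r1.
move: ('D_(e2 0) (fun z => f2 (t, z)) z) ('D_(e2 1) (fun z => f2 (t, z)) z) (f2 (t, z)) => f2x f2y v2.
move: (E_ 0 _) (E_ 1 _) (F_ 0 _) (F_ 1 _) (Et_ 0 _) (Et_ 1 _) (Ft_ 0 _) (Ft_ 1 _) => ex ey fx fy f1x f1y hx hy.
move: (Et _) (Ft _) (E (t, z))^-1 (E _) (F _) => f1 H V e f E0 EV h1 h2 h3 h4 h5 h6 p1 p2 r0 r1.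
have r0' : e * hx + ex * H = fx * f1 + f * f1x - f2x by rewrite r0; ring.
have r1' : e * hy + ey * H = fy * f1 + f * f1y - f2y by rewrite r1; ring.
have := energy_inequality B1 E0 EV h1 h2 h3 h4 h5 h6 p1 p2 r0' r1'.
move/le_trans; apply; rewrite le_eqVlt; apply/orP; left; apply/eqP; ring.
Qed.

Lemma time_interval_next t : I t -> exists2 t1, t < t1 & I t1.
Proof.
move=> [t0]; case: T => [r| |] //= tT; last first.
  by exists (t + 1); [rewrite ltrDl|split; [rewrite addr_ge0|rewrite ltry]].
exists ((t + r) / 2); first by move: tT; rewrite lte_fin; lra.
by move: tT; split => /=; [|rewrite lte_fin]; move: tT t0; rewrite lte_fin; lra.
Qed.

Lemma slice_continuous (phi : R * (R * R) -> R) t : {within A, continuous phi} -> I t ->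
  continuous (fun z => phi (t, z)).
Proof.
move=> /subspace_continuousP cphi It z.
apply: cvg_trans (cphi (t, z) (conj It Logic.I)) => P.
rewrite /fmap /within /= => -[[P1 P2] [/= H1 H2] HP].
by apply: filterS H2 => z' H2; apply: (HP (t, z')) => //; split => //; exact: nbhs_singleton.
Qed.

Let cE_ i : {within A, continuous (E_ i)}. Proof. exact/smooth_on_within/smooth_on_dderiv. Qed.
Let cF_ i : {within A, continuous (F_ i)}. Proof. exact/smooth_on_within/smooth_on_dderiv. Qed.
Let cEt_ i : {within A, continuous (Et_ i)}. Proof. exact/smooth_on_within/smooth_on_dderiv. Qed.
Let cFt_ i : {within A, continuous (Ft_ i)}. Proof. exact/smooth_on_within/smooth_on_dderiv. Qed.

Lemma within_continuous_sum4 (a b c d : R * (R * R) -> R) :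
  {within A, continuous a} -> {within A, continuous b} ->
  {within A, continuous c} -> {within A, continuous d} ->
  {within A, continuous (fun p => a p + b p + c p + d p)}.
Proof.
move=> ca cb cc cd.
exact: (within_continuousD (within_continuousD (within_continuousD ca cb) cc) cd).
Qed.

Lemma energy_continuous : {within A, continuous energy}.
Proof. by apply: within_continuous_sum4; apply: within_continuousM. Qed.

Lemma energy_rate_continuous : {within A, continuous energy_rate}.
Proof.
apply: (@within_continuousM _ _ (fun=> 2)).
  by apply: continuous_subspaceT => p; exact: cvg_cst.
by apply: within_continuous_sum4; apply: within_continuousM.
Qed.

Lemma sum4_sqr_ge0 (a b c d : R) : 0 <= a * a + b * b + c * c + d * d.
Proof. by rewrite !addr_ge0 // -expr2 sqr_ge0. Qed.

Lemma sum4_sqr_eq0 (a b c d : R) : a * a + b * b + c * c + d * d = 0 ->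
  [/\ a = 0, b = 0, c = 0 & d = 0].
Proof.
move/eqP; rewrite !paddr_eq0 ?addr_ge0 -?expr2 ?sqr_ge0 // !sqrf_eq0 -!andbA.
by move=> /and4P[/eqP-> /eqP-> /eqP-> /eqP->].
Qed.

Lemma energy_ge0 p : 0 <= energy p.
Proof. exact: sum4_sqr_ge0. Qed.

Lemma energy_eq0 p : energy p = 0 -> forall i, E_ i p = 0 /\ F_ i p = 0.
Proof.
move=> h; have [a b c d] := sum4_sqr_eq0 h.
exact: (ord2P (P := fun i => E_ i p = 0 /\ F_ i p = 0) (conj a c) (conj b d)).
Qed.

Lemma energy0 z : energy (0, z) = 0.
Proof. by rewrite /energy !initE !initF !mulr0 !addr0. Qed.

Lemma integral_null_form t : I t -> integral_M (null_form t) = 0.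
Proof.
move=> It; apply: jac_integral; [exact: smooth_slice|exact: smooth_conj_rate| |].
  exact: dderiv_periodic.
move=> i z; rewrite /conj_rate (dderiv_periodic _ pE It i z) (dderiv_periodic _ pF It i z).
by rewrite (pE It i z) (pF It i z).
Qed.

Lemma null_form_continuous t : I t -> continuous (null_form t).
Proof.
move=> It z; have oT := @openT (R * R)%type.
apply: (smooth_on_continuous oT) => //.
have sD (f : R * R -> R) i : smooth_on setT f -> smooth_on setT ('D_(e2 i) f) by exact: smooth_on_derive.
have s1 : smooth_on setT (fun z => Et (t, z)) by exact: smooth_slice.
have s2 := smooth_conj_rate It.
apply: (@smooth_onB _ _ setT (fun z => 'D_(e2 0) (fun z => Et (t, z)) z * 'D_(e2 1) (fun z => f2 (t, z)) z)
  (fun z => 'D_(e2 1) (fun z => Et (t, z)) z * 'D_(e2 0) (fun z => f2 (t, z)) z)) => //.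
  by apply: smooth_onM => //; exact: sD.
by apply: smooth_onM => //; exact: sD.
Qed.

(** Integrated over the torus, the pointwise inequality loses its null form and becomes X' <= K X.
    The energy is continuous and nonnegative, so X t = 0 makes it vanish at every point of the
    square. *)
Lemma energy_vanishes t z : I t -> unit_square z -> energy (t, z) = 0.
Proof.
move=> It; move: z; have [t0 _] := It.
move: t0; rewrite le_eqVlt => /orP[/eqP <- z _|t0]; first exact: energy0.
(* A later time t1 leaves a neighbourhood of t on which to differentiate under the integral. *)
have [t1 tt1 It1] := time_interval_next It.
have [K [K2 [K0 He]]] := energy_rate_le It1.
have [C C0 bC] := within_bounded energy_rate_continuous It1.
have Is s : 0 < s < t1 -> I s.
  by move=> /andP[s0 st]; apply: (time_interval_le It1); rewrite !ltW.
have ce s : I s -> continuous (fun z => energy (s, z)) by exact: slice_continuous energy_continuous.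
have cr s : I s -> continuous (fun z => energy_rate (s, z)) by exact: slice_continuous energy_rate_continuous.
have cK (k : R) (f : R * R -> R) : continuous f -> continuous (fun z => k * f z).
  by move=> cf z; apply: continuousM; [exact: cvg_cst|exact: cf].
pose X s := integral_M (fun z => energy (s, z)).
have X0 s : I s -> 0 <= X s.
  move=> Is'; rewrite -(integral_M_cst (0 : R)); apply: le_integral_M; [|exact: ce|].
    by move=> z; exact: cvg_cst.
  by move=> z _; exact: energy_ge0.
have sub s : 0 < s <= t -> 0 < s < t1.
  by move=> /andP[s0 st]; rewrite s0 (le_lt_trans st).
have Xt : X t <= 0.
  apply: (@gronwall R X (fun s => integral_M (fun z => energy_rate (s, z))) K C t) => //; last by rewrite t0 lexx.
  - move=> s /sub s01; apply: (is_derive_integral_M (b := 0) (c := t1) (C := C) (f := fun s z => energy (s, z))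
      (df := fun s z => energy_rate (s, z))) => //.
    + by move=> x /Is; exact: ce.
    + by move=> x z x01 _; apply: energy_is_derive; apply: time_interval_pos; [exact: Is|case/andP: x01].
    + by move=> x z /andP[x0 x1] Qz; apply: bC => //; rewrite !ltW.
  - move=> s /sub s01; have I_s := Is s s01.
    apply: (@le_trans _ _ (integral_M (fun z => K * energy (s, z) + K2 * null_form s z))).
      apply: le_integral_M; first exact: cr.
        move=> z; apply: (@continuousD _ _ _ (fun z => K * energy (s, z)) (fun z => K2 * null_form s z)).
          exact: (cK _ _ (ce s I_s) z).
        exact: (cK _ _ (null_form_continuous I_s) z).
      by move=> z Qz; apply: He => //; case/andP: s01 => s0 s1; rewrite !ltW.
    rewrite integral_MD; [|exact: (cK _ _ (ce s I_s))|exact: (cK _ _ (null_form_continuous I_s))].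
    rewrite (integral_MZ _ (ce s I_s)) (integral_MZ _ (null_form_continuous I_s)).
    by rewrite (integral_null_form I_s) mulr0 addr0.
  (* The energy is 0 at time 0 and its rate is at most C, so the mean value theorem bounds it by C
     s. *)
  - move=> s /sub s01; have I_s := Is s s01; have [s0 s1] := andP s01.
    rewrite -(integral_M_cst (C * s)); apply: le_integral_M; first exact: ce.
      by move=> z; exact: cvg_cst.
    move=> z Qz.
    have [||c c01] := @MVT_segment R (fun s => energy (s, z)) (fun s => energy_rate (s, z)) 0 s (ltW s0).
    + move=> x; rewrite in_itv /= => /andP[x0 x1]; apply: energy_is_derive; apply: time_interval_pos => //.
      by apply: Is; rewrite x0 (lt_trans x1).
    + have ctz : {within I, continuous (fun s => energy (s, z))}.
        by apply: within_time_slice; exact: energy_continuous.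
      apply: continuous_subspaceW ctz => x /=.
      by rewrite in_itv /=; exact: time_interval_le.
    rewrite energy0 !subr0 => ->; rewrite ler_pM2r //.
    apply: le_trans (ler_norm _) _; apply: bC => //.
    by move: c01; rewrite in_itv /= => /andP[-> /le_trans]; apply; exact: ltW.
apply: (integral_M_eq0 (ce t It)); first by move=> z _; exact: energy_ge0.
by apply/eqP; rewrite eq_le Xt X0.
Qed.

Lemma gradient_vanishes t z i : I t -> E_ i (t, z) = 0 /\ F_ i (t, z) = 0.
Proof.
move=> It; split; move: z; apply: periodic_eq0; try exact: dderiv_periodic.
  by move=> z Qz; have [] := energy_eq0 (energy_vanishes It Qz) i.
by move=> z Qz; have [] := energy_eq0 (energy_vanishes It Qz) i.
Qed.

End EnergyMethod.

(** * Holomorphic quadratic differentials are trace free *)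

Section Trace.
Variable R : realType.

(** The sum is the real part of psi (H w_x^2 - 2 F w_x w_y + E w_y^2). The bracket is det g times
    the square of dw in the dual metric, and dw is null for a conformal coordinate. *)
Lemma qdiff_trace_algebra (E F H D px py qx qy a b : R) : 0 < E -> D ^+ 2 = E * H - F * F ->
  E * py = F * px - D * qx -> E * qy = F * qx + D * px ->
  H * complex.Re ((a +i* b)%C * (px +i* qx)%C * (px +i* qx)%C)
  - 2 * F * complex.Re ((a +i* b)%C * (px +i* qx)%C * (py +i* qy)%C)
  + E * complex.Re ((a +i* b)%C * (py +i* qy)%C * (py +i* qy)%C) = 0.
Proof.
move=> E0 D2 e1 e2'; have En0 : E != 0 by rewrite gt_eqF.
have -> : py = (F * px - D * qx) / E by apply: (mulfI En0); rewrite e1; field.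
have -> : qy = (F * qx + D * px) / E by apply: (mulfI En0); rewrite e2'; field.
have -> : H = (D ^+ 2 + F ^+ 2) / E by apply: (mulfI En0); rewrite D2; field.
by rewrite /=; field.
Qed.

Lemma holomorphic_qdiff_trace (g : R * R -> 'M[R]_2) Psi z :
  0 < g z 0 0 -> g z 1 0 = g z 0 1 -> 0 < \det (g z) -> holomorphic_qdiff g Psi ->
  Psi z 1 0 = Psi z 0 1 /\
  g z 1 1 * complex.Re (Psi z 0 0) - 2 * g z 0 1 * complex.Re (Psi z 0 1)
    + g z 0 0 * complex.Re (Psi z 1 1) = 0.
Proof.
move=> E0 g10 d0 [_ HP]; have [Q [w [psi [cw Oz PE _]]]] := HP z.
have D0 : 0 < Num.sqrt (\det (g z)) by rewrite sqrtr_gt0.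
have D2 := sqr_sqrtr (ltW d0).
have [e1 e2'] := conformal_dw cw Oz E0 g10 D0 D2.
rewrite (PE z Oz 0 0) (PE z Oz 0 1) (PE z Oz 1 0) (PE z Oz 1 1).
split; first exact: mulrAC.
have D2' : Num.sqrt (\det (g z)) ^+ 2 = g z 0 0 * g z 1 1 - g z 0 1 * g z 0 1.
  by rewrite D2 det22 g10.
rewrite /dw; case: (psi z) => a b.
exact: (qdiff_trace_algebra a b E0 D2' e1 e2').
Qed.

End Trace.

(** * The metric along the flow *)

Section FlowMetric.
Variables (R : realType) (n : nat) (N : topologicalType).
Variable G : riemannian_manifold R n N.
Variables (eta : R) (T : \bar R) (u : R -> R * R -> N) (g : R -> R * R -> 'M[R]_2).
Hypothesis hflow : flow_solution G eta T u g.
Variables (al0 be0 : R).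
Hypothesis be0_neq0 : be0 != 0.
Hypothesis hg0 : g 0 = Lmetric al0 be0.
Hypothesis T_gt0 : (0 < T)%E.
Local Notation I := (time_interval T).
Local Notation A := (I `*` [set: R * R]).

Definition entry i j (p : R * (R * R)) : R := g p.1 p.2 i j.

Lemma entry_smooth i j : smooth_on A (entry i j).
Proof. exact: (g_smooth hflow). Qed.

Lemma entry_properties t z : I t ->
  [/\ 0 < g t z 0 0, g t z 1 0 = g t z 0 1 & 0 < \det (g t z)].
Proof. by move=> It; have [_ gs gp] := g_metric hflow It; apply: (metric_entries (gs z)); exact: gp. Qed.

Lemma entry_rate t : I t -> exists Psi, holomorphic_qdiff (g t) Psi /\
  forall z i j, dderiv A (entry i j) (dt R) (t, z) = eta ^+ 2 / 4 * complex.Re (Psi z i j).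
Proof.
move=> It; have [Phi [Psi [_ [hPsi _] dg]]] := flow_g hflow It.
exists Psi; split => // z i j; apply: dderiv_time => //; exact: dg.
Qed.

Lemma entry_continuous i j z : {within I, continuous (fun s => g s z i j)}.
Proof.
exact: (@within_time_slice R T (entry i j) z (smooth_on_within (entry_smooth i j))).
Qed.

Lemma time0 : I 0. Proof. by split. Qed.

(* The trace of the velocity vanishes, and it is the logarithmic derivative of det g. *)
Lemma metric_det t z : I t -> \det (g t z) = 1.
Proof.
move=> It.
pose f s := g s z 0 0 * g s z 1 1 - g s z 0 1 * g s z 1 0.
have cf : {within I, continuous f}.
  have c i j k l : {within I, continuous (fun s => g s z i j * g s z k l)}.
    by move=> s; apply: continuousM; [exact: entry_continuous|exact: entry_continuous].
  by move=> s; exact: (continuousB (c 0 0 1 1 s) (c 0 1 1 0 s)).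
have df s : open_time T s -> is_derive s (1 : R) f 0.
  move=> Os; have Is := open_time_sub Os; have [Psi [hPsi dg]] := entry_rate Is.
  have [E0 g10 d0] := entry_properties z Is.
  have [P10 tr0] := holomorphic_qdiff_trace E0 g10 d0 hPsi.
  have d i j : is_derive s (1 : R) (fun s => g s z i j) (eta ^+ 2 / 4 * complex.Re (Psi z i j)).
    by rewrite -dg; exact: (interior_is_derive (entry_smooth i j)).
  apply: is_derive_change (is_derive_sub (is_derive_mul (d 0 0) (d 1 1)) (is_derive_mul (d 0 1) (d 1 0))) _.
  rewrite P10 g10; move: tr0.
  move: (complex.Re (Psi z 0 0)) (complex.Re (Psi z 0 1)) (complex.Re (Psi z 1 1)) => a b c.
  move: (g s z 0 0) (g s z 0 1) (g s z 1 1) => e x h tr0.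
  rewrite [LHS](_ : _ = eta ^+ 2 / 4 * (h * a - 2 * x * b + e * c)); last by ring.
  by rewrite tr0 mulr0.
have := eq0_of_derive0 cf df It; rewrite /f -!det22 hg0 Lmetric_det //.
Qed.

Lemma entry_pde s y Psi : I s -> holomorphic_qdiff (g s) Psi ->
  (forall z i j, dderiv A (entry i j) (dt R) (s, z) = eta ^+ 2 / 4 * complex.Re (Psi z i j)) ->
  let E z := g s z 0 0 in let F z := g s z 0 1 in
  let f1 z := dderiv A (entry 0 0) (dt R) (s, z) in
  let f2 z := conj_rate T (entry 0 0) (entry 0 1) (s, z) in
  E y * (E y * 'D_(e2 1) f1 y - F y * 'D_(e2 0) f1 y + 'D_(e2 0) f2 y) =
    2 * (f1 y * (E y * 'D_(e2 0) F y - 'D_(e2 0) E y * F y) + f2 y * 'D_(e2 0) E y) /\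
  E y * (E y * 'D_(e2 1) f2 y - F y * 'D_(e2 0) f2 y - 'D_(e2 0) f1 y) =
    2 * (f2 y * (E y * 'D_(e2 0) F y - 'D_(e2 0) E y * F y) - f1 y * 'D_(e2 0) E y).
Proof.
move=> Is hPsi dg E F f1 f2.
apply: (@holomorphic_pde R (g s) Psi (eta ^+ 2 / 4)) => //.
- exact: (smooth_slice (entry_smooth 0 0) Is).
- exact: (smooth_slice (entry_smooth 0 1) Is).
- by move=> z; have [] := entry_properties z Is.
- by move=> z; have [] := entry_properties z Is.
- by move=> z; exact: metric_det.
- by move=> z; rewrite /f1 dg.
- move=> z; rewrite /f2 /conj_rate !dg; have [E0 g10 _] := entry_properties z Is.
  have En0 := lt0r_neq0 E0.
  rewrite (holomorphic_qdiff_mu E0 g10 (metric_det z Is) hPsi 0 1) /mupow /frame_ratio /entry /=.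
  by move: (Psi z 0 0) => [a b] /=; field.
Qed.

Lemma metric_constant t z : I t -> g t z = g t 0.
Proof.
move=> It.
have E_gt0 p : A p -> 0 < entry 0 0 p by move=> [Ip _]; have [] := entry_properties p.2 Ip.
have per i j s : I s -> lattice_periodic e2 (fun z => entry i j (s, z)).
  by move=> Is k y; rewrite /entry /=; have [pg _ _] := g_metric hflow Is; rewrite pg.
have slice s i j : I s -> smooth_on setT (fun z => g s z i j).
  by move=> Is; exact: (smooth_slice (entry_smooth i j) Is).
have init i j k y : dderiv A (entry i j) (dx R k) (0, y) = 0.
  rewrite -(slice_derive _ _ (entry_smooth i j) time0).
  rewrite (_ : (fun z => entry i j (0, z)) = cst (Lmetric al0 be0 0 i j)) ?derive_cst //.
  by apply/funext => x; rewrite /entry /= hg0.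
have grad s y k : I s -> dderiv A (entry 0 0) (dx R k) (s, y) = 0 /\ dderiv A (entry 0 1) (dx R k) (s, y) = 0.
  apply: (gradient_vanishes (entry_smooth 0 0) (entry_smooth 0 1) E_gt0 (per 0 0) (per 0 1)).
  - move=> {}s {}y Is; have [Psi [hPsi dg]] := entry_rate Is.
    exact: (proj1 (entry_pde y Is hPsi dg)).
  - move=> {}s {}y Is; have [Psi [hPsi dg]] := entry_rate Is.
    exact: (proj2 (entry_pde y Is hPsi dg)).
  - by move=> x i; exact: init.
  - by move=> x i; exact: init.
have cst i j : (forall s y k, I s -> dderiv A (entry i j) (dx R k) (s, y) = 0) -> g t z i j = g t 0 i j.
  move=> gr; apply: (@constant_of_gradient0 R (fun z => g t z i j) (slice t i j It)) => k y.
  by rewrite -(gr t y k It); exact: (slice_derive y k (entry_smooth i j) It).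
have c00 := cst 0 0 (fun s y k Is => proj1 (grad s y k Is)).
have c01 := cst 0 1 (fun s y k Is => proj2 (grad s y k Is)).
have [E0 g10 _] := entry_properties z It; have [_ g10' _] := entry_properties 0 It.
(* The energy involves only E and F; the yy entry is recovered from det g = 1. *)
have c11 : g t z 1 1 = g t 0 1 1.
  apply: (mulfI (lt0r_neq0 E0)).
  have := metric_det z It; have := metric_det 0 It; rewrite !det22 g10 g10' c00 c01; lra.
by apply/matrixP; apply: ord2P; apply: ord2P; rewrite // g10 c01 g10'.
Qed.

(** E = beta^-2 determines beta up to sign. Taking the sign of beta0 at all times makes beta
    continuous with the right initial value; then alpha = F beta, and the yy entry matches because
    det g = 1. *)
Lemma metric_in_family : exists alpha beta : R -> R,
  [/\ in_family T g alpha beta, alpha 0 = al0 & beta 0 = be0].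
Proof.
pose be t := Num.sg be0 * (Num.sqrt (g t 0 0 0))^-1.
pose al t := g t 0 0 1 * be t.
have s0 t : I t -> 0 < Num.sqrt (g t 0 0 0).
  by move=> It; have [E0 _ _] := entry_properties 0 It; rewrite sqrtr_gt0.
have cbe : {within I, continuous be}.
  apply/subspace_continuousP => t It; apply: cvgM; first exact: cvg_cst.
  apply: cvgV; first by rewrite gt_eqF ?s0.
  have ce : {within I, continuous (fun s => g s 0 0 0)} by exact: entry_continuous.
  move/subspace_continuousP: ce => /(_ t It) c.
  by apply: cvg_comp c _; exact: sqrt_continuous.
have sg2 : Num.sg be0 * Num.sg be0 = 1 by rewrite -expr2 sqr_sg be0_neq0.
have [L00 L01 _ _] := Lmetric_entries al0 be0 0.
have be00 : be 0 = be0.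
  by rewrite /be hg0 L00 sqrtr_sqr normrV ?unitfE // invrK -numEsg.
exists al, be; split => //; last by rewrite /al be00 hg0 L01 divfK.
split => //; first by move=> t; apply: continuousM; [exact: entry_continuous|exact: cbe].
move=> t It; have [E0 g10 _] := entry_properties 0 It; have sE := s0 t It.
have be_neq0 : be t != 0 by rewrite mulf_neq0 ?invr_eq0 ?(gt_eqF sE) // sgr_eq0.
have be2 : be t * be t * g t 0 0 0 = 1.
  rewrite (_ : be t * be t = (Num.sqrt (g t 0 0 0) ^+ 2)^-1); last first.
    by rewrite [LHS]mulrACA sg2 mul1r -invfM.
  rewrite -[X in _ * X = _](sqr_sqrtr (ltW E0)).
  by rewrite mulVf // expf_neq0 // gt_eqF.
split => //; apply/funext => z; rewrite metric_constant //.
have [l00 l01 l10 l11] := Lmetric_entries (al t) (be t) z.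
have dg := metric_det 0 It; rewrite det22 g10 in dg.
have e00 : g t 0 0 0 = (be t)^-1 ^+ 2.
  by apply: (mulfI (mulf_neq0 be_neq0 be_neq0)); rewrite be2; field.
have e01 : g t 0 0 1 = al t / be t by rewrite /al mulfK.
apply/matrixP; apply: ord2P; apply: ord2P; rewrite ?l00 ?l01 ?l10 ?l11 // ?g10 //.
apply: (mulfI (lt0r_neq0 E0)); move: dg; rewrite e01 e00 => dg.
transitivity (1 + al t / be t * (al t / be t)); first by rewrite -dg subrK.
by field.
Qed.

End FlowMetric.

Theorem mainTheorem3 (R : realType) (n : nat) (N : topologicalType)
    (G : riemannian_manifold R n N) (hN : closed_manifold N)
    (eta : R) (heta : 0 < eta) (T : \bar R) (hT : (0 < T)%E)
    (u : R -> R * R -> N) (g : R -> R * R -> 'M[R]_2)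
    (hflow : flow_solution G eta T u g)
    (alpha0 beta0 : R) (hbeta0 : beta0 != 0)
    (hg0 : g 0 = Lmetric alpha0 beta0) :
  (* the family is horizontal *)
  (forall alpha beta alpha' beta' : R, beta != 0 ->
     exists Psi : qdiff R, holomorphic_qdiff (Lmetric alpha beta) Psi /\
       forall z i j,
         is_derive (0 : R) (1 : R)
           (fun s : R => Lmetric (alpha + s * alpha') (beta + s * beta') z i j)
           (complex.Re (Psi z i j))) /\
  (* the metric stays in the family *)
  (exists alpha beta : R -> R,
     [/\ in_family T g alpha beta, alpha 0 = alpha0 & beta 0 = beta0]) /\
  (* evolution equations *)
  (forall alpha beta : R -> R, in_family T g alpha beta ->
   forall U : R -> R * R -> N,
     (forall t z, time_interval T t -> u t z = U t (Lmap (alpha t) (beta t) z)) ->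
   forall t, time_interval T t ->
     let a s := alpha s * beta s in
     let b s := beta s ^+ 2 in
     [/\ lattice_periodic (fun i => Lmap (alpha t) (beta t) (e2 i)) (U t),
         time_deriv (time_interval T) beta t
           (- (eta ^+ 2 / 4) * (beta t / 2) *
            integral_Mab (alpha t) (beta t) (fun z =>
              inner_du G (U t) e_x e_x z - inner_du G (U t) e_y e_y z)) /\
         time_deriv (time_interval T) alpha t
           (eta ^+ 2 / 4 *
            integral_Mab (alpha t) (beta t) (fun z =>
              alpha t / 2 *
                (inner_du G (U t) e_x e_x z - inner_du G (U t) e_y e_y z)
              + 2 * beta t * inner_du G (U t) e_x e_y z)),
         time_deriv (time_interval T) a t
           (eta ^+ 2 / 4 * (2 * b t *
            integral_M (fun z =>
              inner_du G (u t) e_x e_y z - a t * inner_du G (u t) e_x e_x z))) /\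
         time_deriv (time_interval T) b t
           (eta ^+ 2 / 4 *
            integral_M (fun z =>
              - (b t ^+ 2 - a t ^+ 2) * inner_du G (u t) e_x e_x z
              + inner_du G (u t) e_y e_y z
              - 2 * a t * inner_du G (u t) e_x e_y z)) &
         (* the case of Ding-Li-Liu *)
         [/\ beta t *: Lmap (alpha t) (beta t) e_x = (1, 0),
             beta t *: Lmap (alpha t) (beta t) e_y = (a t, b t) &
             eta ^+ 2 = 2 ->
               time_deriv (time_interval T) a t (dll_a G (a t) (b t) (u t)) /\
               time_deriv (time_interval T) b t (dll_b G (a t) (b t) (u t))]]).
Proof.
split; first by move=> al be al' be'; exact: Lmetric_horizontal.
split; first exact: (metric_in_family hflow hbeta0 hg0 hT).
move=> al be fam U hU t It; exact: (in_family_evolution_U hflow heta fam hU It).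
Qed.
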